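(* Fix an integer $k\ge 3$. Let $\Omega=[N]$ or $\Omega=\mathbb{Z}/N\mathbb{Z}$, and in the latter case assume that $N$ is prime. Let $p=p_N\in(0,1)$ with $p\to0$ and $\delta=\delta_N>0$ be such that $\delta=O(1)$, $\delta p^kN^2\to\infty$, and $\delta^{-3}p^{k-2}(\log(1/p))^2\to0$. Then, as $N\to\infty$ (along primes in the case $\Omega=\mathbb{Z}/N\mathbb{Z}$), $$\phi_p^{(k,\Omega)}(\delta)=(1+o(1))\sqrt{(k-1)\,\delta\, p^k\,T_k(\Omega)}\;\log(1/p),$$ and this equals $$(1+o(1))\sqrt{\delta}\,p^{k/2}N\log(1/p)\ \text{ if }\Omega=[N],\qquad (1+o(1))\sqrt{(k-1)\delta}\,p^{k/2}N\log(1/p)\ \text{ if }\Omega=\mathbb{Z}/N\mathbb{Z}\text{ with } N \text{ prime}.$$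
   Context: $[N]=\{1,\dots,N\}$. The ambient group is $\mathbb{Z}$ if $\Omega=[N]$ and $\mathbb{Z}/N\mathbb{Z}$ if $\Omega=\mathbb{Z}/N\mathbb{Z}$. For a subset $A$ of the ambient group, $T_k(A)$ is the number of pairs $(a,b)$ of elements of the ambient group with $a,a+b,\dots,a+(k-1)b\in A$ (so $b=0$ and negative differences are allowed). For $f:\Omega\to\mathbb{R}$, $T_k(f)=\sum_{a,b} f(a)f(a+b)\cdots f(a+(k-1)b)$, the sum over pairs $(a,b)$ in the ambient group with $\{a,a+b,\dots,a+(k-1)b\}\subset\Omega$. $I_p(x)=x\log\frac{x}{p}+(1-x)\log\frac{1-x}{1-p}$ for $x\in[0,1]$ (with $0\log 0=0$), and $$\phi_p^{(k,\Omega)}(\delta)=\inf_{f:\Omega\to[0,1]}\Big\{\sum_{a\in\Omega}I_p(f(a)) : T_k(f)\ge(1+\delta)p^kT_k(\Omega)\Big\}.$$ *)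

(* Defs.v *)
From HB Require Import structures.
From mathcomp Require Import all_boot all_order all_algebra finmap.
From mathcomp Require Import all_classical all_reals all_analysis.
Import Order.TTheory GRing.Theory Num.Theory.
Import numFieldNormedType.Exports.

Set Implicit Arguments.
Unset Strict Implicit.
Unset Printing Implicit Defensive.

Local Open Scope classical_set_scope.
Local Open Scope ring_scope.

Section progressions.
Variables (R : realType) (G : zmodType) (k : nat).

Definition progressions (A : set G) : set (G * G) :=
  [set ab | forall i, (i < k)%N -> A (ab.1 + ab.2 *+ i)].

(* [fset_set] of an infinite set is empty; [progressions A] is finite when A
   is finite and either G is finite or G = int and 2 <= k. *)
Definition Tset (A : set G) : nat := #|` fset_set (progressions A)|%fset.

(* A function on Omega is represented by a function on G whose values outside
   Omega are never used. *)
Definition Tfun (Omega : set G) (f : G -> R) : R :=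
  \sum_(ab \in progressions Omega) \prod_(i < k) f (ab.1 + ab.2 *+ i).

(* Since 0 * y = 0, this agrees with the convention 0 log 0 = 0. *)
Definition relent (p x : R) : R :=
  x * ln (x / p) + (1 - x) * ln ((1 - x) / (1 - p)).

(* The infimum is +oo when no function is feasible. *)
Definition phi (Omega : set G) (p delta : R) : \bar R :=
  ereal_inf [set (\sum_(a \in Omega) relent p (f a))%:E | f in
    [set f : G -> R | (forall a, Omega a -> 0 <= f a <= 1) /\
       (1 + delta) * p ^+ k * (Tset Omega)%:R <= Tfun Omega f]].

End progressions.

Inductive domain := Interval | Cyclic.

(* 'Z_N is the ring of integers modulo N only for 1 < N; in the cyclic case N
   is always prime, see [admissible]. *)
Definition ambient (D : domain) (N : nat) : zmodType :=
  match D with Interval => int | Cyclic => 'Z_N end.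

Definition Omega (D : domain) (N : nat) : set (ambient D N) :=
  match D return set (ambient D N) with
  | Interval => [set a : int | 1 <= a <= N%:Z]
  | Cyclic => setT
  end.

Definition admissible (D : domain) (N : nat) : bool :=
  match D with Interval => (0 < N)%N | Cyclic => prime N end.

Definition size_to_infty (D : domain) : set_system nat :=
  within [set N | admissible D N] \oo.

#[global] Instance size_to_infty_filter D : Filter (size_to_infty D).
Proof. exact: within_filter. Qed.

(* u = (1 + o(1)) v along F *)
Definition asymptotic (R : realType) (F : set_system nat)
    (u : nat -> \bar R) (v : nat -> R) : Prop :=
  exists2 e : nat -> R, e N @[N --> F] --> 0 &
    \forall N \near F, u N = ((1 + e N) * v N)%:E.

Definition explicit_rate (R : realType) (D : domain) (k N : nat)
    (p delta : R) : R :=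
  match D with
  | Interval => Num.sqrt delta * p `^ (k%:R / 2) * N%:R * ln (1 / p)
  | Cyclic =>
      Num.sqrt ((k%:R - 1) * delta) * p `^ (k%:R / 2) * N%:R * ln (1 / p)
  end.

(* Main.v *)
(** The extremal input is that a set A in a cyclic group of prime order much larger
    than |A| contains at most (1/(k-1) + eps) |A|^2 + 2 |A| progressions. In a minimal
    counterexample, dependent random choice among the popular sums gives a large
    X in A having many differences in a small set; its large spectrum is then rich, and
    sampling yields many frequencies whose pairwise differences are almost trivial
    characters on X. By minimality many progressions cross from any proper part G of A
    to its complement, and along them almost triviality spreads until it covers almost
    all of A. Multiplication by such a frequency difference puts almost all of A into a
    short arc, where progressions are monotone; cutting the arc into k-1 blocks of equal
    size, some two consecutive points of a progression lie in the block of their index,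
    which leaves (k-1) (|A|/(k-1))^2 progressions. An interval embeds in a large prime
    cyclic group.

    For the lower bound on the entropy write f = p + g. As progression counts are at
    most affine in each value of g, the extremal bound holds for weights as well as for
    sets. If the entropy is of the expected order, convexity bounds the moments of g so
    that every term of the expanded product is o(delta p^k N^2), except the one in which
    g takes values bounded away from 0 at all k points. So the large values of g have mass
    at least (1 - o(1)) sqrt((k-1) delta p^k T), and each unit of mass costs log(1/p).
    Equality is attained by f = 1 on an interval of this length and f = p elsewhere. *)
Require Import Defs.
From HB Require Import structures.
From mathcomp Require Import all_boot all_order all_algebra finmap.
From mathcomp Require Import all_classical all_reals all_analysis.
From mathcomp Require Import ring lra zify.
Import Order.TTheory GRing.Theory Num.Theory.
Import numFieldNormedType.Exports.

Set Implicit Arguments.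
Unset Strict Implicit.
Unset Printing Implicit Defensive.

Local Open Scope ring_scope.

(** * Characters of Z/NZ *)

(** Minimality pays because [ap_bound] is a quadratic term plus an additive linear one: splitting A
    into G and A \ G lowers the quadratic term by a multiple of |G| |A \ G|, and crossing
    progressions must fill that gap. Two notions of popular difference are needed. The richness of
    the spectrum requires only half of the pairs of X, and uses a set Q0 of size C0 |X| with C0
    depending on the popularity alone. The sampling requires all but a fraction de of the pairs,
    hence a larger set Q1; its error is multiplied by C0, so de has to be chosen after C0. In the
    entropy part, the hypothesis on delta^-3 p^(k-2) log(1/p)^2 makes the total mass of g a small
    multiple of delta p N, which controls the low-order terms of the expansion. The obstacle is the
    term with g at all k points, one value being small: second moments handle it for k >= 4, but a
    product of three values is too short for them, so k = 3 uses moments of order 3/2 above a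
    cutoff. *)

Section characters.
Variables (R : realType) (N : nat).
Hypothesis N_gt1 : (1 < N)%N.
Local Notation G := 'Z_N.

Definition angle (m : nat) : R := pi *+ 2 * (m%:R / N%:R).
(** [co x] and [si x] are the real and imaginary parts of the character e(x) = exp(2 pi i x / N);
    the pair keeps all estimates over the reals. *)
Definition co (x : G) : R := cos (angle x).
Definition si (x : G) : R := sin (angle x).

Let N_neq0 : N%:R != 0 :> R.
Proof. by rewrite pnatr_eq0; lia. Qed.

Lemma angleD m n : angle (m + n) = angle m + angle n.
Proof. by rewrite /angle natrD -mulrDr -mulrDl. Qed.

Lemma angle_modn m : angle m = angle (m %% N) + pi *+ 2 *+ (m %/ N).
Proof.
rewrite {1}(divn_eq m N) addnC angleD; congr (_ + _).
by rewrite /angle natrM mulfK // mulr_natr.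
Qed.

Lemma co0 : co 0 = 1.
Proof. by rewrite /co /angle mul0r mulr0 cos0. Qed.

Lemma si0 : si 0 = 0.
Proof. by rewrite /si /angle mul0r mulr0 sin0. Qed.

Lemma coD x y : co (x + y) = co x * co y - si x * si y.
Proof.
rewrite /co /si -cosD -angleD (angle_modn (x + y)).
rewrite (periodicn (@cosD2pi R)) /=.
by congr (cos (angle (_ %% _))); rewrite Zp_cast.
Qed.

Lemma siD x y : si (x + y) = si x * co y + co x * si y.
Proof.
rewrite /co /si -sinD -angleD (angle_modn (x + y)).
rewrite (periodicn (@sinD2pi R)) /=.
by congr (sin (angle (_ %% _))); rewrite Zp_cast.
Qed.

Lemma co2si2 x : co x ^+ 2 + si x ^+ 2 = 1.
Proof. exact: cos2Dsin2. Qed.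

(** The addition formulas at x and -x form a linear system for the two unknowns, with determinant
    [co x ^+ 2 + si x ^+ 2 = 1]; no representative of -x is needed. *)
Lemma cosiN x : co (- x) = co x /\ si (- x) = - si x.
Proof.
have h := coD x (- x); have h' := siD x (- x); have h2 := co2si2 x.
move: h h' h2; rewrite addrN co0 si0.
move: (co (- x)) (si (- x)) (co x) (si x) => u v c s h h' h2.
have hu : u = c * (c * u - s * v) + s * (s * u + c * v) + (1 - (c ^+ 2 + s ^+ 2)) * u.
  by ring.
have hv : v = c * (s * u + c * v) - s * (c * u - s * v) + (1 - (c ^+ 2 + s ^+ 2)) * v.
  by ring.
by split; [rewrite hu|rewrite hv]; rewrite -h -h' h2; ring.
Qed.

Lemma coN x : co (- x) = co x. Proof. by case: (cosiN x). Qed.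
Lemma siN x : si (- x) = - si x. Proof. by case: (cosiN x). Qed.

Lemma coB x y : co (x - y) = co x * co y + si x * si y.
Proof. by rewrite coD coN siN mulrN opprK. Qed.

Lemma siB x y : si (x - y) = si x * co y - co x * si y.
Proof. by rewrite siD coN siN mulrN. Qed.

(** By the half-angle formula cosine 1 forces sin(pi x / N) = 0, but this sine is positive for 0 < x
    < N. *)
Lemma co_eq1 x : co x = 1 -> x = 0.
Proof.
move=> h; apply/eqP; apply: contraT => x0.
have x_gt0 : (0 < val x)%N by rewrite lt0n -[0%N]/(val (0 : G)) val_eqE.
have xN : (val x < N)%N by have := ltn_ord x; rewrite {2}Zp_cast.
have : 0 < sin (pi * (x%:R / N%:R) : R).
  have pi0 := @pi_gt0 R; apply: sin_gt0_pi; apply/andP; split.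
    by rewrite mulr_gt0// divr_gt0// ltr0n ?(ltnW N_gt1).
  by rewrite gtr_pMr// ltr_pdivrMr ?mul1r ?ltr_nat ?ltr0n ?(ltnW N_gt1).
move: h; rewrite /co /angle [pi *+ 2 * _]mulrnAl cos_mulr2n => h h'.
have := cos2Dsin2 (pi * (x%:R / N%:R) : R).
move: h h'; move: (cos _) (sin _) => u v; nra.
Qed.

Lemma sum_co d : \sum_(x : G) co (x * d) = N%:R * (d == 0)%:R.
Proof.
have [->|d0] := eqVneq d 0.
  under eq_bigr do rewrite mulr0 co0.
  by rewrite sumr_const mulr1 card_ord Zp_cast.
rewrite mulr0.
pose S := \sum_(x : G) co (x * d); pose T := \sum_(x : G) si (x * d).
(* Shifting the summation index by 1 rotates the vector (S, T) by the angle of [d], and a nontrivial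
   rotation fixes only 0. *)
have hS : S = S * co d - T * si d.
  rewrite /S /T [LHS](reindex_inj (addIr 1)) /= 2!mulr_suml -sumrB.
  by apply: eq_bigr => x _; rewrite mulrDl mul1r coD.
have hT : T = T * co d + S * si d.
  rewrite /S /T [LHS](reindex_inj (addIr 1)) /= 2!mulr_suml -big_split /=.
  by apply: eq_bigr => x _; rewrite mulrDl mul1r siD.
have cd : co d != 1 by apply: contra_neq d0; exact: co_eq1.
have := co2si2 d; rewrite -/S; move: hS hT cd; move: (co d) (si d) => u v.
move=> hS hT cd h; have : (2 - 2 * u) * S = 0 by nra.
by move/eqP; rewrite mulf_eq0 => /orP[/eqP h2|/eqP//]; move/eqP: cd; lra.
Qed.

(* The squared chord |e(x) - 1|^2. *)
Definition chord2 (x : G) : R := 2 - 2 * co x.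

Lemma chord2_ge0 x : 0 <= chord2 x.
Proof. have := co2si2 x; rewrite /chord2; nra. Qed.

Lemma chord20 : chord2 0 = 0.
Proof. by rewrite /chord2 co0; lra. Qed.

Lemma chord2N x : chord2 (- x) = chord2 x.
Proof. by rewrite /chord2 coN. Qed.

Lemma chord2B x y : chord2 (x - y) = (co x - co y) ^+ 2 + (si x - si y) ^+ 2.
Proof. by rewrite /chord2 coB; have := co2si2 x; have := co2si2 y; nra. Qed.

(** The triangle inequality for chords with (a + b)^2 <= 2 a^2 + 2 b^2. Iterating it loses a factor
    exponential in the multiple, which is harmless since only multiples below k occur. *)
Lemma chord2D x y : chord2 (x + y) <= 2 * chord2 x + 2 * chord2 y.
Proof.
rewrite /chord2 coD; have := co2si2 x; have := co2si2 y.
move: (co x) (si x) (co y) (si y) => c s w z hw hc.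
have h1 : (w * c - z * s) ^+ 2 + (w * s + z * c) ^+ 2 = 1.
  by transitivity ((c ^+ 2 + s ^+ 2) * (w ^+ 2 + z ^+ 2)); [ring|rewrite hc hw mulr1].
have := sqr_ge0 (w * c - z * s - 2 * w + 1); have := sqr_ge0 (w * s + z * c - 2 * z).
have h2 : (w * c - z * s) * w + (w * s + z * c) * z = c * (w ^+ 2 + z ^+ 2) by ring.
rewrite hw mulr1 in h2; nra.
Qed.

Lemma chord2Mn x n : chord2 (x *+ n) <= 4 ^+ n * chord2 x.
Proof.
elim: n => [|n IH]; first by rewrite mulr0n chord20 expr0 mul1r chord2_ge0.
rewrite mulrS; apply: le_trans (chord2D _ _) _.
have := chord2_ge0 x; have : 1 <= 4 ^+ n :> R by apply: exprn_ege1; lra.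
rewrite exprS; move: IH; move: (4 ^+ n) (chord2 x) (chord2 (x *+ n)).
by move=> a b c; nra.
Qed.

End characters.

(** * Counting monotone progressions *)

Definition apset (k N : nat) (A : {set 'Z_N}) : {set 'Z_N * 'Z_N} :=
  [set ab | [forall i : 'I_k, ab.1 + ab.2 *+ i \in A]].

Lemma apsetP k N (A : {set 'Z_N}) a b :
  reflect (forall i, (i < k)%N -> a + b *+ i \in A) ((a, b) \in apset k A).
Proof.
rewrite inE; apply: (iffP forallP) => h i; last exact: h.
by move=> ik; exact: (h (Ordinal ik)).
Qed.

(** Primality enters here: every multiplier strictly between 0 and N is a unit, so two points of a
    progression of length at most N determine it. *)
Lemma Zp_mulrn_eq0 N (x : 'Z_N) d :
  prime N -> (0 < d < N)%N -> (x *+ d == 0) = (x == 0).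
Proof.
move=> pN /andP[d0 dN]; have N1 := prime_gt1 pN.
have ud : (d%:R : 'Z_N) \is a GRing.unit.
  by rewrite unitZpE// prime_coprime// gtnNdvd.
by rewrite -mulr_natr -{1}(mul0r d%:R) (inj_eq (mulIr ud)).
Qed.

Lemma ap_point_sub N (a b : 'Z_N) i j :
  (i <= j)%N -> a + b *+ j - (a + b *+ i) = b *+ (j - i).
Proof. by move=> ij; rewrite opprD addrACA subrr add0r mulrnBr. Qed.

Lemma ap_inj N k i j (a b a' b' : 'Z_N) : prime N -> (k <= N)%N ->
  (i < k)%N -> (j < k)%N -> i != j ->
  a + b *+ i = a' + b' *+ i -> a + b *+ j = a' + b' *+ j -> (a, b) = (a', b').
Proof.
move=> pN kN ik jk; wlog ij : i j ik jk / (i < j)%N.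
  move=> h; case: (ltngtP i j) => // ij _ hi hj; first by apply: (h i j) => //; lia.
  by apply: (h j i) => //; lia.
move=> _ hi hj.
have hb : b = b'.
  apply/eqP; rewrite -subr_eq0 -(Zp_mulrn_eq0 _ (d := j - i))//; last by lia.
  by rewrite mulrnBl -(ap_point_sub a b (ltnW ij)) -(ap_point_sub a' b' (ltnW ij)) hi hj subrr.
by move: hi; rewrite hb => /addIr ->.
Qed.

(** Take the largest [i] with [i <= B i]: maximality gives [B i.+1 <= i], and monotonicity squeezes
    i <= B i <= B i.+1 <= i. *)
Lemma diagonal_crossing (q : nat) (B : nat -> nat) : (0 < q)%N ->
  (forall i, (i < q)%N -> (B i <= B i.+1)%N) -> (B q < q)%N ->
  exists i, [/\ (i < q)%N, B i = i & B i.+1 = i].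
Proof.
move=> q0 mono Bq.
have [i /andP[iq Bi] imax] : {i | (i <= q)%N && (i <= B i)%N &
    forall j, (j <= q)%N && (j <= B j)%N -> (j <= i)%N}.
  have ex : exists i, (i <= q)%N && (i <= B i)%N by exists 0%N; rewrite !leq0n.
  have ub i : (i <= q)%N && (i <= B i)%N -> (i <= q)%N by case/andP.
  by case: (ex_maxnP ex ub) => i h1 h2; exists i.
have iq' : (i < q)%N by rewrite ltn_neqAle iq andbT; apply: contraTneq Bi => ->; lia.
have := imax i.+1; rewrite iq' /= => h.
have hB : (B i.+1 <= i)%N by rewrite leqNgt; apply/negP => /h; rewrite ltnn.
have := mono i iq' => h1; exists i; split => //; lia.
Qed.

Section rank_blocks.
Variables (R : realDomainType) (T : finType) (A : {set T}) (phi : T -> R).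
Hypothesis phi_inj : {in A &, injective phi}.

Definition rank (x : T) : nat := #|[set y in A | phi y < phi x]|.

Lemma rank_lt x : x \in A -> (rank x < #|A|)%N.
Proof.
move=> xA; apply: proper_card; apply/properP; split.
  by apply/fintype.subsetP => y; rewrite inE => /andP[].
by exists x => //; rewrite inE ltxx andbF.
Qed.

Lemma rank_mono x y : x \in A -> phi x < phi y -> (rank x < rank y)%N.
Proof.
move=> xA xy; apply: proper_card; apply/properP; split.
  by apply/fintype.subsetP => z; rewrite !inE => /andP[-> zx]; exact: lt_trans xy.
by exists x; rewrite !inE xA ?xy// ltxx.
Qed.

Lemma rank_inj : {in A &, injective rank}.
Proof.
move=> x y xA yA h; apply: phi_inj => //.
by case: (ltgtP (phi x) (phi y)) => // /rank_mono h'; [have := h' xA|have := h' yA]; rewrite h ltnn.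
Qed.

(** Cutting by rank rather than by the value of [phi] makes the blocks equal in size up to
    rounding. *)
Definition block (q : nat) (x : T) : nat := ((q * rank x) %/ #|A|)%N.

Lemma block_lt q x : (0 < q)%N -> x \in A -> (block q x < q)%N.
Proof.
move=> q0 xA; have := rank_lt xA => h.
by rewrite ltn_divLR ?(leq_ltn_trans _ h)// ltn_pmul2l.
Qed.

Lemma block_mono q x y : x \in A -> phi x < phi y -> (block q x <= block q y)%N.
Proof. by move=> xA /(rank_mono xA) /ltnW h; rewrite leq_div2r// leq_mul2l h orbT. Qed.

Lemma card_block q b : (0 < q)%N ->
  (q * #|[set x in A | block q x == b]| <= #|A| + q)%N.
Proof.
move=> q0; set S := [set _ in _ | _]; set n := #|A|.
have [n0|n0] := posnP n.
  have -> : S = finset.set0.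
    by apply/setP => x; rewrite !inE (cards0_eq n0) inE.
  by rewrite cards0; lia.
(* [m0] is b n / q rounded up, the least rank that can fall in block [b]; the block lies in a run of
   n / q rounded up consecutive ranks, written [(n.-1 %/ q).+1]. *)
pose m0 := ((b * n + q.-1) %/ q)%N.
have hm0 : (b * n <= q * m0 < b * n + q)%N.
  have := divn_eq (b * n + q.-1) q; have := ltn_pmod (b * n + q.-1) q0.
  rewrite -/m0; nia.
have hd : (n.-1 < q * ((n.-1) %/ q).+1)%N.
  by rewrite mulnC -ltn_divLR.
have hd2 : (q * ((n.-1) %/ q) <= n.-1)%N by rewrite mulnC leq_divM.
suff : (#|S| <= (n.-1 %/ q).+1)%N by move=> h; nia.
rewrite cardE -(size_map rank) -[X in (_ <= X)%N](size_iota m0).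
apply: uniq_leq_size.
  rewrite map_inj_in_uniq ?enum_uniq// => x y; rewrite !mem_enum !inE.
  by move=> /andP[xA _] /andP[yA _]; exact: rank_inj.
move=> j /mapP[x]; rewrite mem_enum inE => /andP[xA /eqP hb] ->.
rewrite mem_iota; move: hb; rewrite /block -/n => hb.
have := divn_eq (q * rank x) n; have := ltn_pmod (q * rank x) n0.
by rewrite hb; move: hm0 => /andP[]; nia.
Qed.

Lemma card_block_pairs q : (0 < q)%N ->
  (q * #|[set xy | [&& xy.1 \in A, xy.2 \in A & block q xy.1 == block q xy.2]]|
   <= #|A| * (#|A| + q))%N.
Proof.
move=> q0; rewrite -sum1_card.
under eq_bigl do rewrite inE.
rewrite -(pair_big_dep (mem A) (fun x y => (y \in A) && (block q x == block q y))
  (fun _ _ => 1%N)) /= big_distrr /=.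
rewrite -[X in (_ <= X * _)%N]sum1_card big_distrl /=.
apply: leq_sum => x xA; rewrite mul1n sum1_card.
rewrite (_ : #|_| = #|[set y in A | block q y == block q x]|) ?card_block//.
by apply: eq_card => y; rewrite !inE eq_sym.
Qed.

End rank_blocks.

(* Along a monotone progression the blocks of the points increase from a value
   >= 0 to a value <= k - 2, so that the i-th and the next point both lie in
   block i for some i; the progression is determined by this pair. *)
Lemma card_monotone_aps (R : realDomainType) N k (A : {set 'Z_N}) (phi : 'Z_N -> R) :
  prime N -> (2 <= k)%N -> {in A &, injective phi} ->
  (forall a b, (a, b) \in apset k A -> b != 0 ->
     (forall i, (i.+1 < k)%N -> phi (a + b *+ i) < phi (a + b *+ i.+1)) \/
     (forall i, (i.+1 < k)%N -> phi (a + b *+ i.+1) < phi (a + b *+ i))) ->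
  (k.-1 * #|apset k A| <= #|A| ^ 2 + 2 * k.-1 * #|A|)%N.
Proof.
move=> pN k2 inj mono; set q := k.-1; have q0 : (0 < q)%N by rewrite /q; lia.
have kq : k = q.+1 by rewrite /q; lia.
pose P := [set xy | [&& xy.1 \in A, xy.2 \in A &
  block A phi q xy.1 == block A phi q xy.2]].
(* [H] recovers a progression from two consecutive points in a common block: the block is the
   position of the first point if [phi] increases, and [q.-1] minus that position if it
   decreases. *)
pose H (xy : 'Z_N * 'Z_N) : 'Z_N * 'Z_N :=
  let j := if phi xy.1 < phi xy.2 then block A phi q xy.1
           else (q.-1 - block A phi q xy.1)%N in
  (xy.1 - (xy.2 - xy.1) *+ j, xy.2 - xy.1).
have sub : apset k A \subset [set (x, 0) | x in A] :|: H @: P.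
  apply/fintype.subsetP => -[a b] abA; rewrite inE.
  have pt i : (i <= q)%N -> a + b *+ i \in A.
    by move=> iq; move/apsetP: abA; apply; rewrite kq ltnS.
  have [->|b0] := eqVneq b 0.
    by rewrite mem_imset ?(fun x y => fun e => congr1 fst e)//;
       [have := pt 0%N; rewrite mulr0n addr0 => ->|move=> x y []].
  apply/orP; right.
  have back j x y : x = a + b *+ j -> y = a + b *+ j.+1 ->
      (x - (y - x) *+ j, y - x) = (a, b).
    move=> -> ->; rewrite ap_point_sub// subSn// subnn mulr1n.
    by rewrite addrK.
  case: (mono _ _ abA b0) => inc.
  - have [i [iq Bi Bi1]] : exists i, [/\ (i < q)%N,
        block A phi q (a + b *+ i) = i & block A phi q (a + b *+ i.+1) = i].
      apply: (diagonal_crossing (B := fun i => block A phi q (a + b *+ i))) => //.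
        by move=> i iq; apply: block_mono; [apply: pt; lia|apply: inc; lia].
      by apply: block_lt => //; exact: pt.
    apply/imsetP; exists (a + b *+ i, a + b *+ i.+1).
      by rewrite inE /= !pt ?Bi ?Bi1 ?eqxx//; lia.
    by rewrite /H /= inc; [rewrite Bi (back i _ _ erefl erefl)|lia].
  - have [i [iq Bi Bi1]] : exists i, [/\ (i < q)%N,
        block A phi q (a + b *+ (q - i)) = i &
        block A phi q (a + b *+ (q - i.+1)) = i].
      apply: (diagonal_crossing (B := fun i => block A phi q (a + b *+ (q - i)))) => //.
        move=> i iq; apply: block_mono; first by apply: pt; lia.
        have -> : (q - i = (q - i.+1).+1)%N by lia.
        by apply: inc; lia.
      by apply: block_lt => //; apply: pt; lia.
    have e : (q - i = (q - i.+1).+1)%N by lia.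
    apply/imsetP; exists (a + b *+ (q - i.+1), a + b *+ (q - i)).
      by rewrite inE /= !pt ?Bi ?Bi1 ?eqxx//; lia.
    rewrite /H /= e ltNge ltW ?inc//=; last by lia.
    have -> : (q.-1 - block A phi q (a + b *+ (q - i.+1))%R)%N = (q - i.+1)%N.
      by rewrite Bi1; lia.
    by rewrite (back (q - i.+1)%N _ _ erefl erefl).
have h1 := leq_trans (subset_leq_card sub) (leq_card_setU _ _).
have h2 := leq_imset_card (fun x => (x, 0 : 'Z_N)) A.
have h3 := leq_imset_card H P.
have h4 := leq_trans h1 (leq_add h2 h3).
(* The linear term 2 |A| is made of |A| constant progressions and |A| from the rounding of the block
   sizes. *)
rewrite -mulnn; apply: leq_trans (leq_mul (leqnn q) h4) _.
rewrite mulnDr; apply: leq_trans (leq_add (leqnn _) (card_block_pairs inj q0)) _.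
by rewrite mulnDr; lia.
Qed.

(** * Averaging, deterministic sampling and pigeonhole *)

Section averaging.
Variable R : realFieldType.

Lemma exists_le_avg (T : finType) (Q : {set T}) (F : T -> R) (c : R) :
  (0 < #|Q|)%N -> \sum_(u in Q) F u <= #|Q|%:R * c -> exists2 u, u \in Q & F u <= c.
Proof.
move=> Q0 h; apply: contrapT => nex.
suff : #|Q|%:R * c < \sum_(u in Q) F u by rewrite ltNge h.
rewrite -[#|Q|]sum1_card natr_sum mulr_suml.
under eq_bigr do rewrite mul1r.
case/card_gt0P: Q0 => u0 u0Q.
have lt u : u \in Q -> c < F u.
  by move=> uQ; rewrite ltNge; apply/negP => le; apply: nex; exists u.
rewrite (bigD1 u0)//= [ltRHS](bigD1 u0)//= ltr_leD ?lt//.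
by apply: ler_sum => u /andP[uQ _]; rewrite ltW ?lt.
Qed.

Lemma exists_ge_avg (T : finType) (Q : {set T}) (F : T -> R) (c : R) :
  (0 < #|Q|)%N -> #|Q|%:R * c <= \sum_(u in Q) F u -> exists2 u, u \in Q & c <= F u.
Proof.
move=> Q0 h; have [|u uQ] := @exists_le_avg T Q (fun u => - F u) (- c) Q0 _.
  by rewrite sumrN mulrN lerN2.
by rewrite lerN2; exists u.
Qed.

Lemma sum_sqr_center (T : finType) (Q : {set T}) (F : T -> R) :
  \sum_(u in Q) (#|Q|%:R * F u - \sum_(v in Q) F v) ^+ 2 =
  #|Q|%:R ^+ 2 * (\sum_(u in Q) F u ^+ 2) - #|Q|%:R * (\sum_(u in Q) F u) ^+ 2.
Proof.
set n := #|Q|%:R; set S := \sum_(u in Q) F u.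
have e u : (n * F u - S) ^+ 2 = n ^+ 2 * F u ^+ 2 - 2 * n * S * F u + S ^+ 2.
  by ring.
under eq_bigr do rewrite e.
rewrite big_split sumr_const -[S ^+ 2 *+ _]mulr_natl sumrB /= -2!mulr_sumr -/S -/n; ring.
Qed.

Lemma sqr_sum_le (T : finType) (Q : {set T}) (F : T -> R) :
  (\sum_(u in Q) F u) ^+ 2 <= #|Q|%:R * \sum_(u in Q) F u ^+ 2.
Proof.
set n := #|Q|%:R; set S := \sum_(u in Q) F u.
have h : 0 <= \sum_(u in Q) (n * F u - S) ^+ 2 by apply: sumr_ge0 => u _; exact: sqr_ge0.
have [n0|n0] := eqVneq n 0.
  rewrite /S n0 mul0r; have /eqP : #|Q| = 0%N by apply/eqP; rewrite -(eqr_nat R) -/n n0.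
  by rewrite cards_eq0 => /eqP ->; rewrite big_set0 expr0n.
have n_gt0 : 0 < n by rewrite lt_def n0 ler0n.
move: h; rewrite sum_sqr_center -/n -/S -[n ^+ 2 * _](mulrA n n) -mulrBr pmulr_rge0// subr_ge0.
by [].
Qed.

(** Random sampling made deterministic: elements are picked one at a time, each no worse than
    average for the sum of squares. Cross terms average to 0 because each [psi z] sums to 0 over
    [Q]. *)
Lemma greedy_sample (T Z : finType) (Q : {set T}) (P : pred Z) (psi : Z -> T -> R) t :
  (0 < #|Q|)%N -> (forall z, P z -> \sum_(u in Q) psi z u = 0) ->
  exists us : seq T, [/\ size us = t, all (mem Q) us &
   #|Q|%:R * \sum_(z | P z) (\sum_(u <- us) psi z u) ^+ 2 <=
   t%:R * \sum_(z | P z) \sum_(u in Q) psi z u ^+ 2].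
Proof.
move=> Q0 zero; set B := \sum_(z | _) \sum_(u in Q) _.
elim: t => [|t [us [sz mem le]]].
  exists [::]; split => //; rewrite mul0r big1 ?mulr0// => z _.
  by rewrite big_nil expr0n.
pose S z := \sum_(u <- us) psi z u.
have [||u uQ hu] := @exists_le_avg T Q
    (fun u => #|Q|%:R * \sum_(z | P z) (psi z u + S z) ^+ 2) (t.+1%:R * B).
- by [].
- rewrite -mulr_sumr ler_wpM2l// exchange_big /=.
  have -> : \sum_(z | P z) \sum_(u in Q) (psi z u + S z) ^+ 2 =
      \sum_(z | P z) (\sum_(u in Q) psi z u ^+ 2 + #|Q|%:R * S z ^+ 2).
    apply: eq_bigr => z Pz; under eq_bigr do rewrite sqrrD.
    rewrite big_split big_split /= sumr_const -[X in _ + X]mulr_natl; congr (_ + _).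
    by rewrite sumrMnl -(mulr_suml _ _ _ (S z)) zero// mul0r mul0rn addr0.
  rewrite big_split /= -mulr_sumr -/B mulrSr mulrDl mul1r [leRHS]addrC.
  by rewrite lerD2l.
exists (u :: us); split; rewrite /= ?sz//; first by rewrite uQ.
by under eq_bigr do rewrite big_cons.
Qed.

(** A single sample serves all [z], since only the sum of the errors over [z] is bounded; centring
    [phi z] provides the zero sums that [greedy_sample] asks for. *)
Lemma sample_mean (T Z : finType) (Q : {set T}) (P : pred Z) (phi : Z -> T -> R) t :
  (0 < #|Q|)%N -> (0 < t)%N ->
  exists us : seq T, [/\ size us = t, all (mem Q) us &
   \sum_(z | P z) (#|Q|%:R / t%:R * (\sum_(u <- us) phi z u) - \sum_(u in Q) phi z u) ^+ 2
   <= #|Q|%:R / t%:R * \sum_(z | P z) \sum_(u in Q) phi z u ^+ 2].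
Proof.
move=> Q0 t0; set n : R := #|Q|%:R.
have n_gt0 : 0 < n by rewrite ltr0n.
have t_gt0 : 0 < t%:R :> R by rewrite ltr0n.
pose S z := \sum_(u in Q) phi z u.
have [us [sz mem le]] := @greedy_sample T Z Q P (fun z u => n * phi z u - S z) t Q0
  (fun z _ => ltac:(rewrite sumrB -mulr_sumr sumr_const -mulr_natl; exact: subrr)).
exists us; split => //.
have e1 z : \sum_(u <- us) (n * phi z u - S z) = n * (\sum_(u <- us) phi z u) - t%:R * S z.
  by rewrite sumrB -mulr_sumr big_const_seq count_predT sz iter_addr_0 mulr_natl.
have e2 z : \sum_(u in Q) (n * phi z u - S z) ^+ 2 <= n ^+ 2 * \sum_(u in Q) phi z u ^+ 2.
  rewrite sum_sqr_center -/n.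
  by rewrite lerBlDr lerDl mulr_ge0 ?sqr_ge0// ltW.
have e3 z : (n / t%:R * (\sum_(u <- us) phi z u) - S z) ^+ 2 =
    (\sum_(u <- us) (n * phi z u - S z)) ^+ 2 / t%:R ^+ 2.
  by rewrite e1; field; rewrite gt_eqF.
under eq_bigr do rewrite e3; rewrite -mulr_suml.
rewrite ler_pdivrMr ?exprn_gt0// -(ler_pM2l n_gt0).
apply: le_trans le _.
have -> : n * (n / t%:R * (\sum_(z | P z) \sum_(u in Q) phi z u ^+ 2) * t%:R ^+ 2) =
   t%:R * (\sum_(z | P z) n ^+ 2 * \sum_(u in Q) phi z u ^+ 2).
  by rewrite -mulr_sumr; field; rewrite gt_eqF.
by rewrite ler_wpM2l ?ler0n// ler_sum.
Qed.

End averaging.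

Lemma pigeonhole (T S : finType) (X : {set T}) (key : T -> S) M :
  (0 < M)%N -> (0 < #|S|)%N -> (M * #|S| <= #|X|)%N ->
  exists X' : {set T}, [/\ X' \subset X, (M <= #|X'|)%N &
    {in X' &, forall x y, key x = key y}].
Proof.
move=> M0 S0 h; have [[s hs]|nex] := pselect (exists s, (M <= #|[set x in X | key x == s]|)%N).
  exists [set x in X | key x == s]; split => //.
    by apply/fintype.subsetP => x; rewrite inE => /andP[].
  by move=> x y; rewrite !inE => /andP[_ /eqP->] /andP[_ /eqP->].
exfalso; have : (#|X| <= #|S| * M.-1)%N.
  rewrite -sum1_card (partition_big key predT)//= -sum_nat_const.
  apply: leq_sum => s _; rewrite sum1_card -ltnS prednK//.
  rewrite ltnNge; apply/negP => le; apply: nex; exists s.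
  by rewrite (leq_trans le)// subset_leq_card//; apply/fintype.subsetP => x; rewrite !inE.
by move: h; clear nex; case: M M0 => // M _; nia.
Qed.

Lemma real_pigeonhole (R : realType) (T J : finType) (X : {set T}) (v : T -> J -> R) M K :
  (0 < M)%N -> (0 < K)%N -> (forall x i, -1 <= v x i <= 1) ->
  (M * (2 * K).+1 ^ #|J| <= #|X|)%N ->
  exists X' : {set T}, [/\ X' \subset X, (M <= #|X'|)%N &
    {in X' &, forall x y, forall i, `|v x i - v y i| <= K%:R^-1}].
Proof.
move=> M0 K0 v1 h; have KR : 0 < K%:R :> R by rewrite ltr0n.
(* [-1, 1] is cut into cells of length 1/K; the value 1 lands in an extra cell numbered 2K, so there
   are 2K + 1 of them. *)
pose tr x i := Num.truncn ((v x i + 1) * K%:R).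
have [||X' [sub le eqk]] := @pigeonhole T {ffun J -> 'I_(2 * K).+1} X
  (fun x => [ffun i => inord (tr x i)]) M M0.
- by rewrite card_ffun !card_ord expn_gt0.
- by rewrite card_ffun !card_ord.
exists X'; split => // x y xX yX i.
have pos z : 0 <= (v z i + 1) * K%:R.
  by rewrite mulr_ge0 ?ler0n//; have /andP[] := v1 z i; lra.
have trlt z : (tr z i < (2 * K).+1)%N.
  rewrite ltnS /tr truncn_le_nat -natr1 natrM; have /andP[_ h1] := v1 z i.
  by nra.
have := eqk x y xX yX => /ffunP /(_ i); rewrite !ffunE => /(congr1 val) /=.
rewrite !inordK// => e.
have /andP[a1 a2] := truncn_itv (pos x); have /andP[b1 b2] := truncn_itv (pos y).
rewrite -/(tr x i) -/(tr y i) e -natr1 in a1 a2 b1 b2.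
rewrite -[K%:R^-1]mul1r ler_pdivlMr// -[in X in _ * X](ger0_norm (ltW KR)) -normrM.
by rewrite ler_norml mulrBl; apply/andP; split; lra.
Qed.

Lemma markov_card (R : realFieldType) (T : finType) (Q : {set T}) (F : T -> R) (c : R) :
  (forall u, u \in Q -> 0 <= F u) ->
  c * #|[set u in Q | c < F u]|%:R <= \sum_(u in Q) F u.
Proof.
move=> F0; rewrite -[#|_|]sum1_card natr_sum mulr_sumr.
rewrite [leRHS](bigID (fun u => c < F u)) /=.
rewrite (eq_bigl (fun u => (u \in Q) && (c < F u))); last by move=> u; rewrite inE.
apply: ler_wpDr; first by apply: sumr_ge0 => u /andP[uQ _]; exact: F0.
by apply: ler_sum => u /andP[_ h]; rewrite mulr1 ltW.
Qed.

(** * Large spectrum and concentrated frequencies *)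

Section spectrum.
Variables (R : realType) (N : nat).
Hypothesis N_gt1 : (1 < N)%N.
Local Notation G := 'Z_N.
Local Notation co := (@co R N).
Local Notation si := (@si R N).
Local Notation chord2 := (@chord2 R N).
Variable X : {set G}.

Definition diffcount (d : G) : R := \sum_(x in X) \sum_(y in X) (x - y == d)%:R.
Definition coX (xi : G) : R := \sum_(x in X) co (xi * x).
Definition siX (xi : G) : R := \sum_(x in X) si (xi * x).
(** The squared modulus of the Fourier coefficient of the indicator of [X]. *)
Definition rho (xi : G) : R := coX xi ^+ 2 + siX xi ^+ 2.

Lemma rho_pairs xi : rho xi = \sum_(x in X) \sum_(y in X) co (xi * (x - y)).
Proof.
rewrite /rho /coX /siX !expr2 !mulr_suml -big_split; apply: eq_bigr => x _ /=.
rewrite !mulr_sumr -big_split; apply: eq_bigr => y _ /=.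
by rewrite mulrBr coB.
Qed.

Lemma sum_diffcount (F : G -> R) :
  \sum_d diffcount d * F d = \sum_(x in X) \sum_(y in X) F (x - y).
Proof.
under eq_bigr do rewrite mulr_suml; rewrite exchange_big /=; apply: eq_bigr => x _.
under eq_bigr do rewrite mulr_suml; rewrite exchange_big /=; apply: eq_bigr => y _.
rewrite (bigD1 (x - y))//= eqxx mul1r big1 ?addr0// => d dxy.
by rewrite eq_sym (negbTE dxy) mul0r.
Qed.

Lemma rhoE xi : rho xi = \sum_d diffcount d * co (xi * d).
Proof. by rewrite rho_pairs (sum_diffcount (fun d => co (xi * d))). Qed.

Lemma diffcountN d : diffcount (- d) = diffcount d.
Proof.
rewrite /diffcount exchange_big; apply: eq_bigr => x _; apply: eq_bigr => y _.
by rewrite -(opprB x y) eqr_opp.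
Qed.

Lemma rho_ge0 xi : 0 <= rho xi.
Proof. by rewrite addr_ge0 ?sqr_ge0. Qed.

Lemma co_le1 x : co x <= 1.
Proof. by have := @co2si2 R N x; nra. Qed.

Lemma rho_le xi : rho xi <= #|X|%:R ^+ 2.
Proof.
rewrite rho_pairs expr2 -[in X in _ <= X * _]sum1_card natr_sum mulr_suml.
apply: ler_sum => x _; rewrite mul1r -sum1_card natr_sum.
by apply: ler_sum => y _; exact: co_le1.
Qed.

Lemma sum_rho : \sum_xi rho xi = N%:R * #|X|%:R.
Proof.
under eq_bigr do rewrite rho_pairs; rewrite exchange_big /=.
rewrite -sum1_card natr_sum mulr_sumr; apply: eq_bigr => x xX.
rewrite exchange_big /= (bigD1 x)//= sum_co// subrr eqxx.
rewrite big1 ?addr0// => y /andP[_ yx].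
by rewrite sum_co// subr_eq0 eq_sym (negbTE yx) mulr0.
Qed.

Lemma sum_co2 d d' :
  \sum_(xi : G) co (xi * d) * co (xi * d') = N%:R / 2 * ((d == d')%:R + (d == - d')%:R).
Proof.
have e xi : co (xi * d) * co (xi * d') = 2^-1 * (co (xi * (d - d')) + co (xi * (d + d'))).
  by rewrite (mulrBr xi) (mulrDr xi) coB// coD//; field.
under eq_bigr do rewrite e.
rewrite -mulr_sumr big_split /= !sum_co// subr_eq0 -[d' in d + d']opprK subr_eq0; by field.
Qed.

(** Parseval for [diffcount], whose squares sum to the additive energy of [X]. Cosines do not
    separate d from -d, but [diffcount] is even, so the two half contributions agree. *)
Lemma sum_rho2 : \sum_xi rho xi ^+ 2 = N%:R * \sum_d diffcount d ^+ 2.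
Proof.
transitivity (\sum_d \sum_d' diffcount d * diffcount d' *
    (N%:R / 2 * ((d == d')%:R + (d == - d')%:R))).
  under eq_bigr do rewrite rhoE expr2 mulr_suml.
  rewrite exchange_big; apply: eq_bigr => d _ /=.
  under eq_bigr do rewrite mulr_sumr.
  rewrite exchange_big; apply: eq_bigr => d' _ /=.
  by rewrite -sum_co2 mulr_sumr; apply: eq_bigr => xi _; ring.
rewrite mulr_sumr; apply: eq_bigr => d _.
have pick (d0 : G) : \sum_d' diffcount d * diffcount d' * (N%:R / 2 * (d' == d0)%:R) =
    N%:R / 2 * (diffcount d * diffcount d0).
  rewrite (bigD1 d0)//= eqxx mulr1 big1 ?addr0; first by ring.
  by move=> i /negbTE ->; rewrite !mulr0.
under eq_bigr do rewrite mulrDr mulrDr (eq_sym d) -(eqr_oppLR d).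
under eq_bigr do rewrite [- d == _]eq_sym.
rewrite big_split /= !pick diffcountN; by field.
Qed.

(* Few differences carrying half of the pairs force [\sum_xi rho xi ^+ 2] to be
   large, by Cauchy-Schwarz; small values of [rho] contribute little to it because
   [\sum_xi rho xi] is known exactly. *)
Lemma large_spectrum (Q0 : {set G}) (C0 : R) :
  (0 < #|X|)%N -> 0 < C0 -> #|Q0|%:R <= C0 * #|X|%:R ->
  #|X|%:R ^+ 2 / 2 <= \sum_(d in Q0) diffcount d ->
  N%:R / (8 * C0 * #|X|%:R) <=
    #|[set xi | #|X|%:R ^+ 2 / (8 * C0) <= rho xi]|%:R.
Proof.
move=> X0 C00 hQ hd; set Xi := [set _ | _]; set m : R := #|X|%:R.
have m0 : 0 < m by rewrite ltr0n.
have n0 : 0 < N%:R :> R by rewrite ltr0n; lia.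
have hE : m ^+ 3 / (4 * C0) <= \sum_d diffcount d ^+ 2.
  have h1 := sqr_sum_le Q0 diffcount.
  have h2 : \sum_(d in Q0) diffcount d ^+ 2 <= \sum_d diffcount d ^+ 2.
    by rewrite [leRHS](bigID (mem Q0)) /= lerDl sumr_ge0// => d _; exact: sqr_ge0.
  have h3 : 0 <= \sum_(d in Q0) diffcount d ^+ 2 by apply: sumr_ge0 => d _; exact: sqr_ge0.
  rewrite ler_pdivrMr ?mulr_gt0//; rewrite -(ler_pM2l m0).
  have h4 : (m ^+ 2 / 2) ^+ 2 <= (\sum_(d in Q0) diffcount d) ^+ 2.
    have p2 : 0 <= m ^+ 2 / 2 by rewrite divr_ge0 ?sqr_ge0.
    by rewrite ler_pXn2r ?nnegrE// (le_trans p2).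
  have h5 : #|Q0|%:R * \sum_(d in Q0) diffcount d ^+ 2 <=
      C0 * m * \sum_d diffcount d ^+ 2.
    by apply: ler_pM.
  have := le_trans h4 (le_trans h1 h5).
  by have -> : (m ^+ 2 / 2) ^+ 2 = m * m ^+ 3 / 4; [field|move=> h; lra].
have split : \sum_xi rho xi ^+ 2 <= #|Xi|%:R * m ^+ 4 + m ^+ 2 / (8 * C0) * (N%:R * m).
  rewrite (bigID (mem Xi)) /= lerD//.
    rewrite -sum1_card natr_sum mulr_suml; apply: ler_sum => xi _.
    rewrite mul1r (_ : m ^+ 4 = (m ^+ 2) ^+ 2); last by ring.
    by rewrite ler_pXn2r ?nnegrE ?rho_ge0 ?rho_le// exprn_ge0// ltW.
  rewrite -sum_rho mulr_sumr [leRHS](bigID (mem Xi)) /=.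
  apply: ler_wpDl.
    by apply: sumr_ge0 => xi _; rewrite mulr_ge0 ?rho_ge0// mulr_ge0 ?invr_ge0 ?mulr_ge0 ?exprn_ge0 ?ltW.
  apply: ler_sum => xi; rewrite inE -ltNge => /ltW h.
  by rewrite expr2 ler_wpM2r ?rho_ge0.
rewrite sum_rho2 in split.
have h := le_trans (ler_wpM2l (ltW n0) hE) split.
have e1 : N%:R * (m ^+ 3 / (4 * C0)) = N%:R / (8 * C0 * m) * m ^+ 4 + m ^+ 2 / (8 * C0) * (N%:R * m).
  by field; rewrite !gt_eqF.
by move: h; rewrite e1 lerD2r ler_pM2r ?exprn_gt0.
Qed.

End spectrum.

(** * Frequencies that nearly agree on most of a set *)

Section concentration.
Variables (R : realType) (N : nat).
Hypothesis N_gt1 : (1 < N)%N.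
Local Notation G := 'Z_N.
Local Notation co := (@co R N).
Local Notation si := (@si R N).
Local Notation chord2 := (@chord2 R N).
Variables (X Q : {set G}).
Let m : R := #|X|%:R.

Definition trig (b : bool) (x : G) : R := if b then co x else si x.

Lemma trig_le1 b x : -1 <= trig b x <= 1.
Proof.
have := @co2si2 R N x; rewrite /trig; case: b; move: (co x) (si x) => u v h;
  apply/andP; split; nra.
Qed.

(* With e(t) = exp(2 pi i t / N), [conv true] and [conv false] are the real and
   imaginary parts of e(xi x) \sum_(s in X) e(- xi s). As most differences x - s lie
   in the small set Q, they are determined up to a small error by samples from Q. *)
Definition conv (b : bool) (xi x : G) : R := \sum_(s in X) trig b (xi * (x - s)).
Definition kernel (z : G * G * bool) (u : G) : R :=
  (z.1.2 - u \in X)%:R * trig z.2 (z.1.1 * u).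
Definition conv_in (b : bool) (xi x : G) : R := \sum_(u in Q) kernel (xi, x, b) u.
Definition missed (x : G) : R := \sum_(s in X) (x - s \notin Q)%:R.

Lemma conv_sub b xi x : (conv b xi x - conv_in b xi x) ^+ 2 <= missed x ^+ 2.
Proof.
have e : conv_in b xi x = \sum_(s in X) (x - s \in Q)%:R * trig b (xi * (x - s)).
  rewrite /conv_in /kernel /= big_mkcond [RHS]big_mkcond /=.
  rewrite (reindex_inj (inv_inj (subKr x))) /=; apply: eq_bigr => s _.
  rewrite subKr; case: (x - s \in Q); case: (s \in X); rewrite ?mul1r ?mul0r//.
rewrite /conv e -sumrB; set S := \sum_(s in X) _.
have : `|S| <= missed x.
  apply: le_trans (ler_norm_sum _ _ _) _; apply: ler_sum => s _.
  case: (x - s \in Q); rewrite ?mul1r ?subrr ?normr0 ?mul0r ?subr0//= ler_norml.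
  exact: trig_le1.
by rewrite ler_norml => /andP[h1 h2]; nra.
Qed.

Lemma conv_co xi x :
  conv true xi x = co (xi * x) * coX R X xi + si (xi * x) * siX R X xi.
Proof.
rewrite /conv /coX /siX 2!mulr_sumr -big_split; apply: eq_bigr => s _ /=.
by rewrite mulrBr coB.
Qed.

Lemma conv_si xi x :
  conv false xi x = si (xi * x) * coX R X xi - co (xi * x) * siX R X xi.
Proof.
rewrite /conv /coX /siX 2!mulr_sumr -sumrB; apply: eq_bigr => s _ /=.
by rewrite mulrBr siB.
Qed.

Lemma sum_kernel2 xi x :
  \sum_b \sum_(u in Q) kernel (xi, x, b) u ^+ 2 <= m.
Proof.
rewrite exchange_big /=.
apply: (@le_trans _ _ (\sum_(u in Q) (x - u \in X)%:R)).
  apply: ler_sum => u _; rewrite big_bool /= /kernel /=.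
  by case: (x - u \in X); rewrite ?mul0r ?expr0n ?addr0// !mul1r co2si2.
rewrite /m -sum1_card natr_sum [leRHS]big_mkcond /= (reindex_inj (inv_inj (subKr x))) /=.
rewrite big_mkcond; apply: ler_sum => s _; rewrite subKr.
by case: (x - s \in Q); case: (s \in X).
Qed.

(* If (A,B) and (A',B') are close and the rotated vectors are close, then so are
   the rotations (p,q) and (p',q'). *)
Lemma rotation_close (p q p' q' A B A' B' : R) : p' ^+ 2 + q' ^+ 2 = 1 ->
  ((p - p') ^+ 2 + (q - q') ^+ 2) * (A ^+ 2 + B ^+ 2) <=
  2 * ((p * A + q * B - (p' * A' + q' * B')) ^+ 2 +
       (q * A - p * B - (q' * A' - p' * B')) ^+ 2) +
  2 * ((A - A') ^+ 2 + (B - B') ^+ 2).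
Proof.
move=> h.
set D := p * A + q * B - _; set E := q * A - p * B - _.
set al := p' * (A - A') + q' * (B - B'); set be := q' * (A - A') - p' * (B - B').
have e1 : al ^+ 2 + be ^+ 2 = (A - A') ^+ 2 + (B - B') ^+ 2.
  transitivity ((p' ^+ 2 + q' ^+ 2) * ((A - A') ^+ 2 + (B - B') ^+ 2)).
    by rewrite /al /be; ring.
  by rewrite h mul1r.
have e2 : ((p - p') ^+ 2 + (q - q') ^+ 2) * (A ^+ 2 + B ^+ 2) =
    (D - al) ^+ 2 + (E - be) ^+ 2 by rewrite /D /E /al /be; ring.
rewrite e2 -e1; have := sqr_ge0 (D + al); have := sqr_ge0 (E + be); lra.
Qed.

Lemma sqr5 (a b c d e : R) : (a + b + c + d + e) ^+ 2 <=
  5 * (a ^+ 2 + b ^+ 2 + c ^+ 2 + d ^+ 2 + e ^+ 2).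
Proof.
have := sqr_ge0 (a - b); have := sqr_ge0 (a - c); have := sqr_ge0 (a - d).
have := sqr_ge0 (a - e); have := sqr_ge0 (b - c); have := sqr_ge0 (b - d).
have := sqr_ge0 (b - e); have := sqr_ge0 (c - d); have := sqr_ge0 (c - e).
have := sqr_ge0 (d - e); lra.
Qed.

Lemma sum_affine (f1 f2 f3 f4 : G -> R) (c d : R) :
  \sum_(x in X) (10 * (f1 x + f2 x + c + f3 x + f4 x) + d) =
  10 * (\sum_(x in X) f1 x + \sum_(x in X) f2 x + m * c +
        \sum_(x in X) f3 x + \sum_(x in X) f4 x) + m * d.
Proof. by rewrite big_split -mulr_sumr 4!big_split 2!sumr_const /= !mulr_natl. Qed.

(** The values of [conv] at [xi] and [eta] are compared through [conv_in] and the sampled values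
    [Y], a chain of five differences. [rotation_close] then turns this into closeness of e(xi x) and
    e(eta x), weighted by [rho]. *)
Lemma conv_close (C1 de t K : R) xi eta (Y : G -> bool -> G -> R) :
  (0 < #|X|)%N -> 0 < t -> 0 < K -> #|Q|%:R <= C1 * m ->
  \sum_(x in X) missed x <= de * m ^+ 2 ->
  (forall z, z \in [:: xi; eta] ->
    \sum_(x in X) \sum_b (Y z b x - conv_in b z x) ^+ 2 <= 2 * C1 * m ^+ 3 / t) ->
  (forall x b, (Y xi b x - Y eta b x) ^+ 2 <= C1 ^+ 2 * m ^+ 2 / K ^+ 2) ->
  (coX R X xi - coX R X eta) ^+ 2 <= m ^+ 2 / K ^+ 2 ->
  (siX R X xi - siX R X eta) ^+ 2 <= m ^+ 2 / K ^+ 2 ->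
  rho R X xi * \sum_(x in X) chord2 ((xi - eta) * x) <=
  (10 * (4 * de + 4 * C1 / t + 2 * C1 ^+ 2 / K ^+ 2) + 4 / K ^+ 2) * m ^+ 3.
Proof.
move=> X0 t0 K0 hQ hmiss hY hYY hA hB.
have m0 : 0 < m by rewrite ltr0n.
have miss0 x : 0 <= missed x by apply: sumr_ge0 => s _; exact: ler0n.
have miss_le x : missed x <= m.
  by rewrite /m -sum1_card natr_sum; apply: ler_sum => s _; rewrite lern1 leq_b1.
(* As [missed x] is at most m, its square is at most m times it, so the bound on the sum of [missed]
   suffices. *)
have sum_miss z : \sum_(x in X) \sum_b (conv b z x - conv_in b z x) ^+ 2 <= 2 * de * m ^+ 3.
  apply: (@le_trans _ _ (\sum_(x in X) 2 * m * missed x)).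
    apply: ler_sum => x _; rewrite big_bool /=.
    have := conv_sub true z x; have := conv_sub false z x.
    have := miss_le x; have := miss0 x; set u := missed x; nra.
  rewrite -mulr_sumr; apply: le_trans (ler_wpM2l _ hmiss) _; first by rewrite mulr_ge0 ?ltW.
  by lra.
pose V z x := \sum_b (conv b z x - conv_in b z x) ^+ 2.
pose W z x := \sum_b (Y z b x - conv_in b z x) ^+ 2.
have VE z x : V z x = (conv true z x - conv_in true z x) ^+ 2 + (conv false z x - conv_in false z x) ^+ 2.
  by rewrite /V big_bool.
have WE z x : W z x = (Y z true x - conv_in true z x) ^+ 2 + (Y z false x - conv_in false z x) ^+ 2.
  by rewrite /W big_bool.
have pt x : rho R X xi * chord2 ((xi - eta) * x) <=
    10 * (V xi x + W xi x + 2 * (C1 ^+ 2 * m ^+ 2 / K ^+ 2) + W eta x + V eta x) +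
    4 * (m ^+ 2 / K ^+ 2).
  rewrite mulrBl chord2B// mulrC.
  apply: le_trans (rotation_close _ _ _ _ (coX R X eta) (siX R X eta) (co2si2 R (eta * x))) _.
  rewrite -!conv_co -!conv_si.
  have close b : (conv b xi x - conv b eta x) ^+ 2 <= 5 *
     ((conv b xi x - conv_in b xi x) ^+ 2 + (Y xi b x - conv_in b xi x) ^+ 2 +
      (C1 ^+ 2 * m ^+ 2 / K ^+ 2) + (Y eta b x - conv_in b eta x) ^+ 2 +
      (conv b eta x - conv_in b eta x) ^+ 2).
    have -> : conv b xi x - conv b eta x =
      (conv b xi x - conv_in b xi x) + (conv_in b xi x - Y xi b x) +
      (Y xi b x - Y eta b x) + (Y eta b x - conv_in b eta x) +
      (conv_in b eta x - conv b eta x) by ring.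
    apply: le_trans (sqr5 _ _ _ _ _) _.
    rewrite -(sqrrN (conv_in b xi x - _)) opprB -(sqrrN (conv_in b eta x - _)) opprB.
    by have := hYY x b; lra.
  move: (close true) (close false) hA hB; rewrite !VE !WE.
  move: (C1 ^+ 2 * m ^+ 2 / K ^+ 2) (m ^+ 2 / K ^+ 2) => cc dd.
  move: ((conv true xi x - conv_in true xi x) ^+ 2) => a0.
  move: ((Y xi true x - conv_in true xi x) ^+ 2) => a1.
  move: ((conv false xi x - conv_in false xi x) ^+ 2) => a2.
  move: ((Y xi false x - conv_in false xi x) ^+ 2) => a3.
  move: ((conv true eta x - conv_in true eta x) ^+ 2) => a4.
  move: ((Y eta true x - conv_in true eta x) ^+ 2) => a5.
  move: ((conv false eta x - conv_in false eta x) ^+ 2) => a6.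
  move: ((Y eta false x - conv_in false eta x) ^+ 2) => a7.
  move: ((conv true xi x - conv true eta x) ^+ 2) => a8.
  move: ((conv false xi x - conv false eta x) ^+ 2) => a9.
  move: ((coX R X xi - coX R X eta) ^+ 2) => a10.
  move: ((siX R X xi - siX R X eta) ^+ 2) => a11.
  clear; lra.
rewrite mulr_sumr; apply: le_trans (ler_sum _ (fun x _ => pt x)) _.
rewrite sum_affine.
have h1 := hY xi ltac:(by rewrite !inE eqxx).
have h2 := hY eta ltac:(by rewrite !inE eqxx orbT).
have h3 := sum_miss xi; have h4 := sum_miss eta.
have e : m * (2 * (C1 ^+ 2 * m ^+ 2 / K ^+ 2)) = 2 * C1 ^+ 2 / K ^+ 2 * m ^+ 3.
  by field; rewrite gt_eqF.
have e' : m * (4 * (m ^+ 2 / K ^+ 2)) = 4 / K ^+ 2 * m ^+ 3.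
  by field; rewrite gt_eqF.
have e2 : 2 * C1 * m ^+ 3 / t = 2 * C1 / t * m ^+ 3 by ring.
rewrite e e' [leRHS]mulrDl lerD2r -[leRHS]mulrA ler_wpM2l//.
rewrite e2 in h1 h2.
have -> : (4 * de + 4 * C1 / t + 2 * C1 ^+ 2 / K ^+ 2) * m ^+ 3 =
    2 * (2 * de * m ^+ 3) + 2 * (2 * C1 / t * m ^+ 3) + 2 * C1 ^+ 2 / K ^+ 2 * m ^+ 3.
  by ring.
move: h1 h2 h3 h4; rewrite -/(V xi _) -/(V eta _) -/(W xi _) -/(W eta _).
move: (\sum_(x in X) W xi x) (\sum_(x in X) W eta x) (\sum_(x in X) V xi x).
move: (\sum_(x in X) V eta x) (2 * C1 / t * m ^+ 3) (2 * de * m ^+ 3).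
move: (2 * C1 ^+ 2 / K ^+ 2 * m ^+ 3); clear => *; lra.
Qed.

End concentration.

Lemma sum_triple (R : nmodType) (T1 T2 : finType) (A : {set T1}) (B : {set T2})
    (F : T1 * T2 * bool -> R) :
  \sum_(z | (z.1.1 \in A) && (z.1.2 \in B)) F z =
  \sum_(x in A) \sum_(y in B) \sum_b F (x, y, b).
Proof.
transitivity (\sum_(p | (p.1 \in A) && (p.2 \in B)) \sum_b F (p, b)).
  rewrite pair_big /=; apply: eq_big => [[p b]|[p b] _] //=.
  by rewrite andbT.
by rewrite [RHS]pair_big; apply: eq_big => [[x y]|[x y] _].
Qed.

(** [Q0] makes the large spectrum rich and [Q1] carries the sampling. The sample is good on average
    over the spectrum, so Markov's inequality keeps half of it, which turns the 8 of
    [large_spectrum] into 16; the last hypothesis leaves M frequencies in one cell of the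
    pigeonhole. *)
Lemma concentrated_frequencies (R : realType) (N : nat) (X Q0 Q1 : {set 'Z_N})
    (C0 C1 de eps : R) (t K M : nat) : (1 < N)%N ->
  (0 < #|X|)%N -> (0 < #|Q1|)%N -> 0 < C0 -> 0 < C1 ->
  (0 < t)%N -> (0 < K)%N -> (0 < M)%N ->
  #|Q0|%:R <= C0 * #|X|%:R -> #|X|%:R ^+ 2 / 2 <= \sum_(d in Q0) diffcount R X d ->
  #|Q1|%:R <= C1 * #|X|%:R -> \sum_(x in X) missed R X Q1 x <= de * #|X|%:R ^+ 2 ->
  8 * C0 * (10 * (4 * de + 4 * C1 / t%:R + 2 * C1 ^+ 2 / K%:R ^+ 2) + 4 / K%:R ^+ 2)
    <= eps ->
  (M * (2 * K).+1 ^ (t.+1 * 2))%:R * (16 * C0 * #|X|%:R) <= N%:R ->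
  exists Xi : {set 'Z_N}, (M <= #|Xi|)%N /\
    {in Xi &, forall xi eta,
       \sum_(x in X) chord2 R ((xi - eta) * x) <= eps * #|X|%:R}.
Proof.
move=> N1 X0 Q10 C00 C10 t0 K0 M0 hQ0 hd hQ1 hmiss heps hN.
have := large_spectrum N1 X0 C00 hQ0 hd.
set m : R := #|X|%:R; set Xi0 := [set xi | _] => hXi0.
have m0 : 0 < m by rewrite ltr0n.
have tR : 0 < t%:R :> R by rewrite ltr0n.
have KR : 0 < K%:R :> R by rewrite ltr0n.
have [us [szus usQ]] := sample_mean
  (fun z : 'Z_N * 'Z_N * bool => (z.1.1 \in Xi0) && (z.1.2 \in X)) (kernel R X) Q10 t0.
pose Y z b x := #|Q1|%:R / t%:R * \sum_(u <- us) kernel R X (z, x, b) u.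
rewrite !sum_triple => hY.
pose W z := \sum_(x in X) \sum_b (Y z b x - conv_in R X Q1 b z x) ^+ 2.
pose c := 2 * C1 * m ^+ 3 / t%:R.
have hW : \sum_(z in Xi0) W z <= c / 2 * #|Xi0|%:R.
  apply: le_trans hY _.
  apply: (@le_trans _ _ (#|Q1|%:R / t%:R * \sum_(z in Xi0) \sum_(x in X) m)).
    apply: ler_wpM2l; first by rewrite divr_ge0.
    apply: ler_sum => z _; apply: ler_sum => x _.
    exact: sum_kernel2.
  rewrite !sumr_const -/m -[m *+ _]mulr_natl -[_ *+ #|Xi0|]mulr_natl -/m.
  have -> : c / 2 * #|Xi0|%:R = C1 * m / t%:R * (#|Xi0|%:R * (m * m)).
    by rewrite /c; field; rewrite gt_eqF.
  apply: ler_wpM2r; first by rewrite !mulr_ge0// ltW.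
  by rewrite ler_pM2r ?invr_gt0.
have c0 : 0 < c by rewrite /c divr_gt0// !mulr_gt0// exprn_gt0.
have hmk := @markov_card R _ Xi0 W c
  (fun z _ => ltac:(apply: sumr_ge0 => x _; apply: sumr_ge0 => b _; exact: sqr_ge0)).
pose Xi1 := Xi0 :\: [set z in Xi0 | c < W z].
have hXi1 : #|Xi0|%:R / 2 <= #|Xi1|%:R :> R.
  have := le_trans hmk hW; rewrite -mulrA ler_pM2l// => h.
  have -> : #|Xi1|%:R = #|Xi0|%:R - #|[set z in Xi0 | c < W z]|%:R :> R.
    rewrite /Xi1 cardsD (finset.setIidPr _) ?natrB ?subset_leq_card//;
      by apply/fintype.subsetP => z; rewrite inE => /andP[].
  by move: h; lra.
have hM : (M * (2 * K).+1 ^ (t.+1 * 2) <= #|Xi1|)%N.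
  rewrite -(ler_nat R); apply: le_trans hXi1; rewrite ler_pdivlMr//.
  apply: le_trans hXi0; rewrite ler_pdivlMr ?mulr_gt0//.
  by apply: le_trans hN; rewrite -mulrA ler_wpM2l//; lra.
(* A frequency is recorded by its character values at the [t] sample points and, in the extra slot
   [t], by its Fourier coefficient divided by m; each is two real numbers, hence the exponent
   [t.+1 * 2]. *)
pose v (z : 'Z_N) (j : 'I_t.+1 * bool) : R :=
  if j.1 == t :> nat then (if j.2 then coX R X z else siX R X z) / m
  else trig R j.2 (z * nth 0 us j.1).
have bnd (b : bool) z : -1 <= (if b then coX R X z else siX R X z) / m <= 1.
  rewrite ler_pdivlMr// ler_pdivrMr// mulN1r mul1r.
  have -> : (if b then coX R X z else siX R X z) = \sum_(x in X) trig R b (z * x).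
    by case: b.
  rewrite -ler_norml; apply: le_trans (ler_norm_sum _ _ _) _.
  rewrite /m -sum1_card natr_sum; apply: ler_sum => x _.
  by rewrite ler_norml trig_le1.
have v1 z j : -1 <= v z j <= 1.
  by rewrite /v; case: eqP => _; [exact: bnd|exact: trig_le1].
have [|Xi [sXi MXi closeXi]] := @real_pigeonhole R _ _ Xi1 v M K M0 K0 v1.
  by rewrite card_prod card_bool card_ord.
exists Xi; split => // xi eta xiX etaX.
have inXi1 z : z \in Xi -> m ^+ 2 / (8 * C0) <= rho R X z /\ W z <= c.
  move=> /(fintype.subsetP sXi); rewrite !inE => /andP[h1 h2].
  by split => //; move: h1; rewrite h2 /= -leNgt.
have sq (a b : R) : `|a| <= b -> a ^+ 2 <= b ^+ 2.
  by rewrite ler_norml => /andP[]; nra.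
have hmain := @conv_close R N N1 X Q1 C1 de t%:R K%:R xi eta Y X0 tR KR hQ1 hmiss.
have {}hmain : rho R X xi * \sum_(x in X) chord2 R ((xi - eta) * x) <=
  (10 * (4 * de + 4 * C1 / t%:R + 2 * C1 ^+ 2 / K%:R ^+ 2) + 4 / K%:R ^+ 2) * m ^+ 3.
  have endpt (b : bool) : ((if b then coX R X xi else siX R X xi) -
      (if b then coX R X eta else siX R X eta)) ^+ 2 <= m ^+ 2 / K%:R ^+ 2.
    have := closeXi xi eta xiX etaX (ord_max, b).
    rewrite /v /= eqxx -mulrBl => /sq; rewrite exprMn exprVn.
    by rewrite ler_pdivrMr ?exprn_gt0// mulrC exprVn mulrC.
  apply: hmain; [| |exact: (endpt true)|exact: (endpt false)].
    by move=> z; rewrite !inE => /orP[] /eqP ->; case: (inXi1 _ xiX); case: (inXi1 _ etaX).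
  move=> x b; rewrite /Y -mulrBr -sumrB.
  have h : `|\sum_(u <- us) (kernel R X (xi, x, b) u - kernel R X (eta, x, b) u)| <= t%:R / K%:R.
    apply: le_trans (ler_norm_sum _ _ _) _.
    rewrite (big_nth 0) szus big_mkord.
    have -> : t%:R / K%:R = \sum_(i < t) K%:R^-1 :> R.
      by rewrite sumr_const card_ord mulr_natl.
    apply: ler_sum => i _; rewrite /kernel /= -mulrBr normrM.
    have := closeXi xi eta xiX etaX (widen_ord (leqnSn t) i, b).
    rewrite /v /= (ltn_eqF (ltn_ord i)) => h; apply: le_trans h.
    by rewrite ger0_norm// ler_piMl// lern1 leq_b1.
  have -> : C1 ^+ 2 * m ^+ 2 / K%:R ^+ 2 = (C1 * m / K%:R) ^+ 2.
    by rewrite expr_div_n exprMn.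
  apply: sq; rewrite normrM ger0_norm ?divr_ge0//.
  have -> : C1 * m / K%:R = C1 * m / t%:R * (t%:R / K%:R) by field; rewrite !gt_eqF.
  by apply: ler_pM => //; rewrite ?divr_ge0// ler_pM2r ?invr_gt0.
have [hrho _] := inXi1 _ xiX.
have S0 : 0 <= \sum_(x in X) chord2 R ((xi - eta) * x).
  by apply: sumr_ge0 => x _; exact: chord2_ge0.
have h1 := le_trans (ler_wpM2r S0 hrho) hmain.
have h2 : m ^+ 2 / (8 * C0) * \sum_(x in X) chord2 R ((xi - eta) * x) <=
    m ^+ 2 / (8 * C0) * (eps * m).
  apply: le_trans h1 _; rewrite -[leRHS]mulrA -/m.
  have -> : m ^+ 2 * ((8 * C0)^-1 * (eps * m)) = eps / (8 * C0) * m ^+ 3 by ring.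
  rewrite ler_pM2r ?exprn_gt0// ler_pdivlMr ?mulr_gt0//.
  by apply: le_trans heps; rewrite mulrC.
by move: h2; rewrite ler_pM2l// divr_gt0 ?exprn_gt0 ?mulr_gt0.
Qed.

(** * Dependent random choice on popular sums *)

Section dependent_random_choice.
Variables (R : realFieldType) (T : finType) (A : {set T}) (E : rel T).
Let n : R := #|A|%:R.

Definition common (x x' : T) : R := \sum_(z in A) (E x z && E x' z)%:R.
Definition bad (th : R) (X : {set T}) : R :=
  \sum_(x in X) \sum_(x' in X) (common x x' < th * n)%R%:R.
Definition nbhd (z : T) : {set T} := [set x in A | E x z].

Lemma sum_nbhd (z : T) (F : T -> R) :
  \sum_(x in nbhd z) F x = \sum_(x in A) (E x z)%:R * F x.
Proof.
rewrite big_mkcond [RHS]big_mkcond; apply: eq_bigr => x _; rewrite inE.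
by case: (x \in A); case: (E x z); rewrite ?mul1r ?mul0r.
Qed.

Lemma bad_ge0 th X : 0 <= bad th X.
Proof. by apply: sumr_ge0 => x _; apply: sumr_ge0 => y _. Qed.

Lemma sum_bad th : 0 <= th -> \sum_(z in A) bad th (nbhd z) <= th * n ^+ 3.
Proof.
move=> th0; rewrite /bad.
under eq_bigr do rewrite sum_nbhd.
rewrite exchange_big /=.
have -> : th * n ^+ 3 = \sum_(x in A) \sum_(x' in A) th * n.
  by rewrite 2!sumr_const -(mulr_natr (th * n)) -mulr_natr -/n; ring.
apply: ler_sum => x _.
under eq_bigr do rewrite sum_nbhd mulr_sumr.
rewrite exchange_big /=; apply: ler_sum => x' _.
under eq_bigr do rewrite mulrA.
rewrite -mulr_suml.
have -> : \sum_(z in A) (E x z)%:R * (E x' z)%:R = common x x'.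
  by apply: eq_bigr => z _; rewrite -natrM mulnb.
case: ltP => [h|_]; first by rewrite mulr1 ltW.
by rewrite mulr0 mulr_ge0 ?ler0n.
Qed.

(** A pair with few common neighbours lies in few neighbourhoods, so bad pairs are rare on average
    over [z], while the mean square size is large by Cauchy-Schwarz. One [z] must serve both
    thresholds, hence a single objective [F]. *)
Lemma dependent_random_choice (eta de : R) : (0 < #|A|)%N -> 0 < eta -> 0 < de ->
  eta * n ^+ 2 <= \sum_(x in A) \sum_(z in A) (E x z)%:R ->
  exists2 z, z \in A & [/\ eta ^+ 2 / 2 * n ^+ 2 <= #|nbhd z|%:R ^+ 2,
    bad (eta ^+ 2 / 8) (nbhd z) <= #|nbhd z|%:R ^+ 2 / 2 &
    bad (de * eta ^+ 2 / 4) (nbhd z) <= de * #|nbhd z|%:R ^+ 2].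
Proof.
move=> A0 eta0 de0 hE; have n0 : 0 < n by rewrite ltr0n.
(* The coefficients make each penalty average at most eta^2 n^2 / 4 against eta^2 n^2 for the main
   term; nonnegativity of [F z] then bounds both counts of bad pairs. *)
pose F z : R := #|nbhd z|%:R ^+ 2 - 2 * bad (eta ^+ 2 / 8) (nbhd z) -
  de^-1 * bad (de * eta ^+ 2 / 4) (nbhd z).
have hF : n * (eta ^+ 2 / 2 * n ^+ 2) <= \sum_(z in A) F z.
  rewrite !sumrB -!mulr_sumr.
  have h1 := @sum_bad (eta ^+ 2 / 8) ltac:(by rewrite divr_ge0// sqr_ge0).
  have h2 := @sum_bad (de * eta ^+ 2 / 4)
    ltac:(by rewrite divr_ge0// mulr_ge0// ?sqr_ge0// ltW).
  have {}h2 : de^-1 * (\sum_(z in A) bad (de * eta ^+ 2 / 4) (nbhd z)) <= eta ^+ 2 / 4 * n ^+ 3.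
    by rewrite mulrC ler_pdivrMr//; apply: le_trans h2 _; lra.
  have h3 := sqr_sum_le A (fun z => #|nbhd z|%:R : R).
  have e : \sum_(z in A) #|nbhd z|%:R = \sum_(x in A) \sum_(z in A) (E x z)%:R :> R.
    rewrite exchange_big; apply: eq_bigr => z _.
    rewrite -sum1_card natr_sum sum_nbhd.
    by apply: eq_bigr => x _; rewrite mulr1.
  have h4 : (eta * n ^+ 2) ^+ 2 <= (\sum_(z in A) #|nbhd z|%:R) ^+ 2.
    have p : 0 <= eta * n ^+ 2 by rewrite mulr_ge0 ?sqr_ge0 ?ltW.
    by rewrite ler_pXn2r ?nnegrE// e// (le_trans p).
  have h5 : eta ^+ 2 * n ^+ 3 <= \sum_(z in A) #|nbhd z|%:R ^+ 2.
    rewrite -(ler_pM2l n0) -/n; apply: le_trans (le_trans h4 h3).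
    by rewrite le_eqVlt; apply/orP; left; apply/eqP; ring.
  by lra.
have [z zA hz] := exists_ge_avg A0 hF.
exists z => //; move: hz; rewrite /F.
have b1 := bad_ge0 (eta ^+ 2 / 8) (nbhd z).
have b2 : 0 <= de^-1 * bad (de * eta ^+ 2 / 4) (nbhd z).
  by rewrite mulr_ge0 ?bad_ge0// invr_ge0 ltW.
have h : 0 <= eta ^+ 2 / 2 * n ^+ 2 by rewrite mulr_ge0 ?divr_ge0 ?sqr_ge0.
move=> hz; split; [lra|lra|].
by rewrite -ler_pdivrMl//; lra.
Qed.

End dependent_random_choice.

Section popular_sums.
Variables (R : realType) (N : nat) (A : {set 'Z_N}).
Let n : R := #|A|%:R.

Definition sumcount (u : 'Z_N) : R := \sum_(x in A) \sum_(z in A) (x + z == u)%:R.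

Lemma sumcount_ge0 u : 0 <= sumcount u.
Proof. by apply: sumr_ge0 => x _; apply: sumr_ge0 => y _. Qed.

Lemma sum_sumcount : \sum_u sumcount u = n ^+ 2.
Proof.
rewrite exchange_big /=; transitivity (\sum_(x in A) n); last first.
  by rewrite sumr_const -mulr_natr -/n expr2.
apply: eq_bigr => x _; rewrite exchange_big /=.
transitivity (\sum_(z in A) (1 : R)); last by rewrite sumr_const.
apply: eq_bigr => z _.
rewrite (bigD1 (x + z))//= eqxx big1 ?addr0// => u.
by rewrite eq_sym => /negbTE ->.
Qed.

(** The number of representations of [d] as x + z - x' - z' with all four elements in [A]. *)
Definition energy4 (d : 'Z_N) : R := \sum_u sumcount u * sumcount (u - d).

Lemma sum_energy4 : \sum_d energy4 d = n ^+ 4.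
Proof.
rewrite exchange_big /= (exprM n 2 2) -sum_sumcount expr2 mulr_suml.
apply: eq_bigr => u _; rewrite -mulr_sumr; congr (_ * _).
by rewrite [RHS](reindex_inj (inv_inj (subKr u))).
Qed.

Definition popular (eta : R) (x z : 'Z_N) : bool := eta * n <= sumcount (x + z).

(** Write x - x' as (x + z) - (x' + z): each common neighbour [z] contributes the product of two
    popular counts. *)
Lemma popular_energy4 eta th x x' : 0 <= eta ->
  th * n <= common R A (popular eta) x x' -> th * eta ^+ 2 * n ^+ 3 <= energy4 (x - x').
Proof.
move=> eta0 h; have n0 : 0 <= n by exact: ler0n.
have -> : th * eta ^+ 2 * n ^+ 3 = th * n * (eta * n) ^+ 2 by ring.
apply: le_trans (ler_wpM2r (sqr_ge0 _) h) _.
rewrite /common /energy4 mulr_suml [leRHS](reindex_inj (addrI x)) /= big_mkcond.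
apply: ler_sum => z _.
have -> : x + z - (x - x') = x' + z by rewrite opprB addrC addrA subrK.
have s0 := sumcount_ge0.
case: (z \in A); rewrite ?mulr_ge0//.
rewrite /popular; case: (boolP (_ <= sumcount (x + z))) => h1; case: (boolP (_ <= sumcount (x' + z))) => h2 /=;
  rewrite ?mul0r ?mulr_ge0//.
by rewrite mul1r expr2 ler_pM// mulr_ge0.
Qed.

Lemma popular_diffs (eta th : R) : (0 < #|A|)%N -> 0 < eta -> 0 < th ->
  #|[set d | th * eta ^+ 2 * n ^+ 3 <= energy4 d]|%:R <= n / (th * eta ^+ 2).
Proof.
move=> A0 eta0 th0; have n0 : 0 < n by rewrite ltr0n.
have c0 : 0 < th * eta ^+ 2 * n ^+ 3 by rewrite !mulr_gt0// exprn_gt0.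
rewrite -(ler_pM2r c0).
have -> : n / (th * eta ^+ 2) * (th * eta ^+ 2 * n ^+ 3) = n ^+ 4.
  by field; rewrite !gt_eqF.
rewrite -sum_energy4 -sum1_card natr_sum mulr_suml [leRHS](bigID [in [set d | th * eta ^+ 2 * n ^+ 3 <= energy4 d]]) /=.
apply: ler_wpDr.
  by apply: sumr_ge0 => d _; apply: sumr_ge0 => u _; rewrite mulr_ge0 ?sumcount_ge0.
by apply: ler_sum => d; rewrite inE mul1r.
Qed.

End popular_sums.

Lemma nat_above (R : archiRealDomainType) (x : R) : exists2 m : nat, (0 < m)%N & x <= m%:R.
Proof. by exists (Num.truncn x).+1 => //; rewrite ltW// truncnS_gt. Qed.

Lemma popular_concentrated (R : realType) (eta eps : R) (M : nat) :
  0 < eta -> 0 < eps -> (0 < M)%N ->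
  exists C : nat, forall N (A : {set 'Z_N}), (1 < N)%N -> (0 < #|A|)%N ->
    (C * #|A| <= N)%N ->
    eta * #|A|%:R ^+ 2 <= \sum_(x in A) \sum_(z in A) (popular A eta x z)%:R ->
    exists X : {set 'Z_N}, [/\ X \subset A, eta / 2 * #|A|%:R <= #|X|%:R &
    exists Xi : {set 'Z_N}, (M <= #|Xi|)%N /\
    {in Xi &, forall xi xi',
       \sum_(x in X) chord2 R ((xi - xi') * x) <= eps * #|X|%:R}].
Proof.
move=> eta0 eps0 M0.
(* [C0] and [C1] are the constant of [Qcard] below, 2 / (th eta^3), at th = eta^2 / 8 and th = de
   eta^2 / 4. Since [C0] depends on [eta] only, [de], then [C1], then [t] and [K] can be chosen so
   that each of three error terms is at most c / 4. *)
pose C0 := 16 / eta ^+ 5; pose c := eps / (8 * C0).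
have C00 : 0 < C0 by rewrite divr_gt0// exprn_gt0.
have c0 : 0 < c by rewrite divr_gt0// mulr_gt0.
pose de := Num.min (2^-1) (c / 160).
have de0 : 0 < de by rewrite lt_min invr_gt0 ltr0n divr_gt0.
have de1 : de <= 2^-1 by rewrite ge_min lexx.
have dec : de <= c / 160 by rewrite ge_min lexx orbT.
pose C1 := 8 / (de * eta ^+ 5).
have C10 : 0 < C1 by rewrite divr_gt0// mulr_gt0// exprn_gt0.
have [t t0 ht] := nat_above (160 * C1 / c).
have [K K0 hK] := nat_above (4 * (20 * C1 ^+ 2 + 4) / c).
have tR : 0 < t%:R :> R by rewrite ltr0n.
have KR : 1 <= K%:R :> R by rewrite ler1n.
have [C _ hC] := nat_above ((M * (2 * K).+1 ^ (t.+1 * 2))%:R * (16 * C0)).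
exists C => N A N1 A0 CN hE; have nR : 0 < #|A|%:R :> R by rewrite ltr0n.
have [z zA [hX bad0 bad1]] := dependent_random_choice A0 eta0 de0 hE.
set X := nbhd A _ z in hX bad0 bad1; exists X.
have XA : X \subset A by apply/fintype.subsetP => x; rewrite inE => /andP[].
have hXn : eta / 2 * #|A|%:R <= #|X|%:R :> R.
  have p : 0 <= eta / 2 * #|A|%:R by rewrite mulr_ge0// ltW// divr_gt0.
  rewrite -(@ler_pXn2r _ 2)// ?nnegrE//; apply: le_trans hX.
  have : 0 <= eta ^+ 2 * #|A|%:R ^+ 2 by rewrite mulr_ge0 ?sqr_ge0.
  by rewrite exprMn expr_div_n; lra.
have XR : 0 < #|X|%:R :> R by apply: lt_le_trans hXn; rewrite mulr_gt0// divr_gt0.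
have X0 : (0 < #|X|)%N by rewrite -(ltr0n R).
split => //.
pose Qt th := [set d | th * eta ^+ 2 * #|A|%:R ^+ 3 <= energy4 R A d].
have Qcard th : 0 < th -> #|Qt th|%:R <= 2 / (th * eta ^+ 3) * #|X|%:R.
  move=> th0; apply: le_trans (popular_diffs A0 eta0 th0) _.
  have -> : #|A|%:R / (th * eta ^+ 2) = 2 / (th * eta ^+ 3) * (eta / 2 * #|A|%:R).
    by field; rewrite !gt_eqF.
  by rewrite ler_wpM2l// divr_ge0// mulr_ge0 ?exprn_ge0 ?ltW.
have notQ th x x' : (x - x' \notin Qt th) ->
    common R A (popular A eta) x x' < th * #|A|%:R.
  apply: contraR; rewrite -leNgt inE => h.
  by apply: popular_energy4 => //; rewrite ltW.
have misth th : \sum_(x in X) missed R X (Qt th) x <= bad A (popular A eta) th X.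
  apply: ler_sum => x _; apply: ler_sum => s _; rewrite ler_nat.
  by case: (boolP (_ \notin _)) => // /notQ ->.
have Q0 : 0 < eta ^+ 2 / 8 by rewrite divr_gt0// exprn_gt0.
have Q1 : 0 < de * eta ^+ 2 / 4 by rewrite divr_gt0// mulr_gt0// exprn_gt0.
have miss1 := le_trans (misth _) bad1.
apply: (@concentrated_frequencies R N X (Qt (eta ^+ 2 / 8)) (Qt (de * eta ^+ 2 / 4))
   C0 C1 de eps t K M) => //.
(* If this set of differences were empty, every pair would be missed, against [de <= 2^-1]. *)
- rewrite card_gt0; apply/eqP => Qe; move: miss1; rewrite Qe.
  have -> : \sum_(x in X) missed R X finset.set0 x = #|X|%:R ^+ 2.
    rewrite expr2 -[in RHS]sum1_card natr_sum mulr_suml.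
    apply: eq_bigr => x _; rewrite mul1r /missed.
    by apply: eq_bigr => s _; rewrite inE.
  have : 0 < #|X|%:R ^+ 2 :> R by rewrite exprn_gt0.
  by move: de1; set y := _ ^+ 2; nra.
- apply: le_trans (Qcard _ Q0) _; rewrite le_eqVlt; apply/orP; left; apply/eqP.
  by rewrite /C0; field; rewrite !gt_eqF.
- have e : \sum_(d in Qt (eta ^+ 2 / 8)) diffcount R X d =
      \sum_(x in X) \sum_(y in X) (x - y \in Qt (eta ^+ 2 / 8))%:R.
    rewrite -(sum_diffcount X (fun d => (d \in Qt (eta ^+ 2 / 8))%:R : R)) big_mkcond.
    by apply: eq_bigr => d _; case: ifP; rewrite ?mulr1 ?mulr0.
  have e2 : \sum_(d in Qt (eta ^+ 2 / 8)) diffcount R X d =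
      #|X|%:R ^+ 2 - \sum_(x in X) missed R X (Qt (eta ^+ 2 / 8)) x.
    apply/eqP; rewrite -subr_eq opprK e -big_split /= expr2.
    rewrite -[in X in _ == X * _]sum1_card natr_sum mulr_suml; apply/eqP.
    apply: eq_bigr => x _; rewrite -big_split /= mul1r -[in RHS]sum1_card natr_sum.
    by apply: eq_bigr => y _; case: (_ \in _); rewrite ?addr0 ?add0r.
  by rewrite e2; have := le_trans (misth _) bad0; lra.
- apply: le_trans (Qcard _ Q1) _; rewrite le_eqVlt; apply/orP; left; apply/eqP.
  by rewrite /C1; field; rewrite !gt_eqF.
- have h1 : C1 / t%:R <= c / 160.
    by move: ht; rewrite ler_pdivrMr// => h; rewrite ler_pdivrMr//; clear -h; lra.
  have h2 : (20 * C1 ^+ 2 + 4) / K%:R ^+ 2 <= c / 4.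
    rewrite ler_pdivrMr ?exprn_gt0 ?(lt_le_trans _ KR)//.
    move: hK; rewrite ler_pdivrMr// => hK.
    by have : K%:R <= K%:R ^+ 2 :> R; [nra|nra].
  have -> : 8 * C0 * (10 * (4 * de + 4 * C1 / t%:R + 2 * C1 ^+ 2 / K%:R ^+ 2) + 4 / K%:R ^+ 2) =
    8 * C0 * (40 * de + 40 * (C1 / t%:R) + (20 * C1 ^+ 2 + 4) / K%:R ^+ 2) by ring.
  have -> : eps = 8 * C0 * c by rewrite /c; field; rewrite gt_eqF.
  have p8 : 0 < 8 * C0 by rewrite pmulr_rgt0.
  rewrite ler_pM2l//; move: dec h1 h2.
  move: (C1 / t%:R) (de) (c) ((20 * C1 ^+ 2 + 4) / K%:R ^+ 2) c0; clear => *; lra.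
- apply: (@le_trans _ _ (C * #|A|)%:R); last by rewrite ler_nat.
  rewrite (natrM _ C) mulrA; apply: ler_pM => //; last by rewrite ler_nat subset_leq_card.
  by rewrite mulr_ge0// pmulr_rge0// ltW.
Qed.

(** * The extremal bound in cyclic groups of prime order *)

Section order_by_sine.
Variables (R : realType) (N : nat).
Hypothesis pN : prime N.
Let N1 := prime_gt1 pN.

Lemma Zp_mul_eq0 (x y : 'Z_N) : (x * y == 0) = (x == 0) || (y == 0).
Proof.
have [->|x0] := eqVneq x 0; first by rewrite mul0r eqxx.
rewrite /= mulrC -{1}(natr_Zp x) mulr_natr Zp_mulrn_eq0// lt0n.
rewrite -[X in val _ != X]/(val (0 : 'Z_N)) val_eqE x0 /=.
by have := ltn_ord x; rewrite {2}Zp_cast.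
Qed.

(** For vectors of equal length in the right half plane, a positive cross product puts the second at
    the larger angle, hence at the larger ordinate. *)
Lemma sine_mono (a b c d : R) : 0 < a -> 0 < c -> a ^+ 2 + b ^+ 2 = c ^+ 2 + d ^+ 2 ->
  0 < d * a - c * b -> b < d.
Proof.
move=> a0 c0 e h; rewrite ltNge; apply/negP => db.
have h1 : (d + b) * (a - c) * (a + c) <= 0.
  have -> : (d + b) * (a - c) * (a + c) = (d + b) ^+ 2 * (d - b).
    have -> : (d + b) * (a - c) * (a + c) = (d + b) * (a ^+ 2 - c ^+ 2) by ring.
    have -> : a ^+ 2 - c ^+ 2 = d ^+ 2 - b ^+ 2 by lra.
    by ring.
  by rewrite mulr_ge0_le0 ?sqr_ge0 ?subr_le0.
have h2 : (d + b) * (a - c) <= 0 by rewrite -(pmulr_lle0 _ (addr_gt0 a0 c0)).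
by nra.
Qed.

Variables (A : {set 'Z_N}) (zeta : 'Z_N).
Hypothesis zeta0 : zeta != 0.
Hypothesis arc : {in A, forall x, chord2 R (zeta * x) <= 1 / 4}.

Lemma arc_step x y : x \in A -> y \in A -> 0 < si R (zeta * (y - x)) ->
  si R (zeta * x) < si R (zeta * y).
Proof.
move=> xA yA; rewrite mulrBr siB//.
have := arc xA; have := arc yA; rewrite /chord2 => hy hx.
have := co2si2 R (zeta * x); have := co2si2 R (zeta * y) => ey ex.
apply: sine_mono; [lra|lra|by rewrite ex ey].
Qed.

(** Sine 0 leaves cosine 1 or -1. The value -1 is a squared chord of 4, while two points of the arc
    are at squared chord at most 2 (1/4 + 1/4) = 1. *)
Lemma arc_sine_neq0 x y : x \in A -> y \in A -> x != y -> si R (zeta * (y - x)) != 0.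
Proof.
move=> xA yA; apply: contra_neq => s0.
have h := co2si2 R (zeta * (y - x)); rewrite s0 in h.
have := chord2D R N1 (zeta * y) (- (zeta * x)); rewrite chord2N// -mulrBr.
have := arc xA; have := arc yA => hy hx hD.
have c1 : co R (zeta * (y - x)) = 1.
  by move: hD h; rewrite {1}/chord2; move: (co R _) => c; nra.
have /eqP := co_eq1 N1 c1; rewrite Zp_mul_eq0 (negbTE zeta0) /= subr_eq0.
by move/eqP => ->.
Qed.

(** All steps of a progression rotate by the same [zeta * b], and the sign of its sine decides
    whether the sine of [zeta * x] increases or decreases along it. *)
Lemma card_aps_in_arc k : (2 <= k)%N -> (k <= N)%N ->
  (k.-1 * #|apset k A| <= #|A| ^ 2 + 2 * k.-1 * #|A|)%N.
Proof.
move=> k2 kN; apply: (@card_monotone_aps R N k A (fun x => si R (zeta * x))) => //.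
  move=> x y xA yA /= e; apply/eqP; apply: contraT => xy.
  have := arc_sine_neq0 xA yA xy.
  case: (ltgtP (si R (zeta * (y - x))) 0) => // h _; last first.
    by have := arc_step xA yA h; rewrite e ltxx.
  have := @arc_step y x yA xA; rewrite -opprB mulrN siN// oppr_gt0 => /(_ h).
  by rewrite e ltxx.
move=> a b /apsetP ap b0.
have step i : a + b *+ i.+1 - (a + b *+ i) = b.
  by rewrite ap_point_sub// subSn// subnn mulr1n.
have s0 : si R (zeta * b) != 0.
  have := @arc_sine_neq0 (a + b *+ 0) (a + b *+ 1) _ _; rewrite step; apply.
  - by apply: ap; lia.
  - by apply: ap; lia.
  - by rewrite mulr0n mulr1n addr0 -subr_eq0 opprD addrA subrr add0r oppr_eq0.
case: (ltgtP (si R (zeta * b)) 0) s0 => // h _; [right|left] => i ik.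
  apply: arc_step; [by apply: ap|by apply: ap; lia|].
  by rewrite -opprB step mulrN siN// oppr_gt0.
by apply: arc_step; [by apply: ap; lia|by apply: ap|rewrite step].
Qed.

End order_by_sine.

Section aps_counting.
Variables (N k : nat).
Hypotheses (pN : prime N) (k3 : (3 <= k)%N) (kN : (k <= N)%N).
Implicit Types A B : {set 'Z_N}.

Lemma card_aps_through A B i : (i < k)%N ->
  (#|[set ab in apset k A | (ab.1 + ab.2 *+ i)%R \in B]| <= #|B| * #|A|)%N.
Proof.
move=> ik; have [j jk ij] : exists2 j, (j < k)%N & i != j.
  by case: (i == 0%N) / eqP => [->|/eqP i0]; [exists 1%N => //; lia|exists 0%N => //; lia].
rewrite -cardsX -(card_in_imset (f := fun ab => (ab.1 + ab.2 *+ i, ab.1 + ab.2 *+ j))).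
  apply: subset_leq_card; apply/fintype.subsetP => z /imsetP[[a b]].
  by rewrite inE => /andP[/apsetP ap aB] ->; rewrite finset.in_setX aB (ap j jk).
by move=> [a b] [a' b'] _ _ /= /pair_equal_spec[]; exact: (ap_inj pN kN ik jk ij).
Qed.

Lemma card_aps_subset A B : B \subset A ->
  (#|apset k A| <= #|apset k B| + k * (#|A :\: B| * #|A|))%N.
Proof.
move=> BA.
have sub : apset k A \subset apset k B :|:
    \bigcup_(i < k) [set ab in apset k A | (ab.1 + ab.2 *+ i)%R \in A :\: B].
  apply/fintype.subsetP => -[a b] abA; rewrite inE.
  have [//|nB] := boolP ((a, b) \in apset k B).
  apply/bigcupP; move: nB; rewrite inE negb_forall => /existsP[i hi].
  exists i => //; rewrite inE abA inE hi.
  by move/apsetP: abA; apply.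
apply: leq_trans (subset_leq_card sub) _.
apply: leq_trans (leq_card_setU _ _) _; rewrite leq_add2l.
apply: (@leq_trans (\sum_(i < k) #|A :\: B| * #|A|)%N); last first.
  by rewrite sum_nat_const card_ord.
elim/big_ind2: _ => [|S x U y h1 h2|i _]; first by rewrite cards0.
  by apply: leq_trans (leq_card_setU _ _) (leq_add h1 h2).
exact: card_aps_through.
Qed.

(** In positions 0, 1, 2 the outer points sum to twice the middle one. Progressions with popular
    outer sum inject into the edges; otherwise the middle point fixes an unpopular sum and thus
    serves fewer than eta |A| progressions, which costs at most half of the hypothesis. *)
Lemma popular_edges (R : realType) (eta : R) A : 0 < eta ->
  2 * eta * #|A|%:R ^+ 2 <= #|apset k A|%:R ->
  eta * #|A|%:R ^+ 2 <= \sum_(x in A) \sum_(z in A) (popular A eta x z)%:R.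
Proof.
move=> eta0 hT.
pose P1 := [set ab in apset k A | popular A eta ab.1 (ab.1 + ab.2 *+ 2)].
pose P2 := apset k A :\: P1.
have eT : #|apset k A|%:R = #|P1|%:R + #|P2|%:R :> R.
  rewrite -natrD -(cardsID P1 (apset k A)); congr (_ + _)%:R.
  by apply: eq_card => z; rewrite !inE andbA andbb.
have in012 a b : (a, b) \in apset k A -> [/\ a \in A, a + b \in A & a + b *+ 2 \in A].
  move/apsetP => ap; split; last by apply: ap; lia.
    by have := ap 0%N ltac:(lia); rewrite mulr0n addr0.
  by have := ap 1%N ltac:(lia); rewrite mulr1n.
have h1 : #|P1|%:R <= \sum_(x in A) \sum_(z in A) (popular A eta x z)%:R :> R.
  rewrite (pair_big (mem A) (mem A) (fun x z => (popular A eta x z)%:R)) /=.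
  rewrite -(card_in_imset (f := fun ab => (ab.1 + ab.2 *+ 0, ab.1 + ab.2 *+ 2))); last first.
    by move=> [a b] [a' b'] _ _ /= /pair_equal_spec[e1 e2]; apply: (ap_inj pN kN _ _ _ e1 e2) => //; lia.
  rewrite -sum1_card natr_sum big_mkcond [leRHS]big_mkcond; apply: ler_sum => -[x z] _ /=.
  case: ifP => [/imsetP[[a b]]|_]; last by case: ifP.
  rewrite inE => /andP[/in012[aA _ a2A] hp] [-> ->]; rewrite mulr0n addr0 aA a2A /=.
  by move: hp => /= ->.
have h2 : #|P2|%:R <= eta * #|A|%:R ^+ 2.
  pose U := [set y in A | ~~ (eta * #|A|%:R <= sumcount R A (y + y))].
  apply: (@le_trans _ _ (\sum_(y in U) eta * #|A|%:R)); last first.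
    rewrite sumr_const -[_ *+ #|U|]mulr_natl expr2 mulrCA ler_pM2l//.
    rewrite ler_wpM2r// ler_nat subset_leq_card//.
    by apply/fintype.subsetP => y; rewrite inE => /andP[].
  apply: (@le_trans _ _ (\sum_(y in U) sumcount R A (y + y))); last first.
    by apply: ler_sum => y; rewrite inE -ltNge => /andP[_ /ltW].
  rewrite -(card_in_imset (f := fun ab => (ab.1 + ab.2 *+ 1, ab.1 + ab.2 *+ 0))); last first.
    by move=> [a b] [a' b'] _ _ /= /pair_equal_spec[e1 e2]; apply: (ap_inj pN kN _ _ _ e1 e2) => //; lia.
  apply: (@le_trans _ _ (\sum_(y in U) \sum_(x in A) (y + y - x \in A)%:R)); last first.
    apply: ler_sum => y _; apply: ler_sum => x _; rewrite big_mkcond /=.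
    rewrite (bigD1 (y + y - x))//= [x + _]addrC subrK eqxx.
    apply: ler_wpDr; first by apply: sumr_ge0 => z _; case: ifP.
    by case: ifP.
  rewrite (pair_big (mem U) (mem A) (fun y x => (y + y - x \in A)%:R)) /=.
  rewrite -sum1_card natr_sum big_mkcond [leRHS]big_mkcond; apply: ler_sum => -[y x] _ /=.
  case: ifP => [/imsetP[[a b]]|_]; last by case: ifP.
  rewrite inE => /andP[np abA] [-> ->].
  have [aA a1A a2A] := in012 _ _ abA.
  have e : a + b *+ 1 + (a + b *+ 1) = a + (a + b *+ 2).
    by rewrite mulr1n mulr2n addrACA -addrA.
  move: np; rewrite inE abA /= /popular => np.
  rewrite e mulr0n addr0 !inE e np mulr1n a1A aA /=.
  by rewrite [a + (a + _)]addrC addrK a2A.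
move: hT; rewrite eT => hT; lra.
Qed.

End aps_counting.

(** * Spreading almost triviality along crossing progressions *)

Section growth.
Variables (R : realType) (N k : nat).
Hypotheses (pN : prime N) (k3 : (3 <= k)%N) (kN : (k <= N)%N).
Let N1 := prime_gt1 pN.
Local Notation chord2 := (@chord2 R N).

(** Differences are what the pigeonhole controls, and they survive passing to a subset of [Xi]; in
    the end two elements of [Xi] suffice to produce a nonzero frequency. *)
Definition nearly_trivial (G : {set 'Z_N}) (tau b : R) (Xi : {set 'Z_N}) : Prop :=
  {in Xi &, forall xi xi',
    #|[set x in G | tau < chord2 ((xi - xi') * x)]|%:R <= b}.

Definition crossing (A G : {set 'Z_N}) : {set 'Z_N * 'Z_N} :=
  apset k A :\: (apset k G :|: apset k (A :\: G)).

Lemma card_crossing (A G : {set 'Z_N}) :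
  (#|apset k A| <= #|crossing A G| + #|apset k G| + #|apset k (A :\: G)|)%N.
Proof.
rewrite -addnA; set U := apset k G :|: apset k (A :\: G).
have h : (#|U| <= #|apset k G| + #|apset k (A :\: G)|)%N by exact: leq_card_setU.
rewrite -(cardsID U (apset k A)) -/(crossing A G) addnC leq_add2l.
apply: leq_trans h; apply: subset_leq_card; exact: finset.subsetIr.
Qed.

(** Averaging over the k^3 |A| choices of positions and [w]; a third position exists because k >= 3.
    With the point at [l] fixed, a progression in [S] is determined by its point at [i], and equally
    by its point at [j]. *)
Lemma crossing_pattern (A G : {set 'Z_N}) (c : R) : 0 < c -> (0 < #|A|)%N ->
  c * #|A|%:R ^+ 2 <= #|crossing A G|%:R ->
  exists i j l, exists w, exists S : {set 'Z_N * 'Z_N},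
    [/\ [/\ (i < k)%N, (j < k)%N & (l < k)%N], [/\ i != l, j != l & w \in A],
      c / k%:R ^+ 3 * #|A|%:R <= #|S|%:R &
      forall a b, (a, b) \in S -> [/\ (a, b) \in apset k A,
        a + b *+ i \in G, a + b *+ j \notin G & a + b *+ l = w]].
Proof.
move=> c0 A0 hc; have nR : 0 < #|A|%:R :> R by rewrite ltr0n.
have kR : 0 < k%:R :> R by rewrite ltr0n; lia.
pose T := ('I_k * 'I_k * 'I_k * 'Z_N)%type.
pose S (z : T) := [set ab in apset k A | [&& z.1.1.1 != z.1.2, z.1.1.2 != z.1.2,
  (ab.1 + ab.2 *+ z.1.1.1)%R \in G, (ab.1 + ab.2 *+ z.1.1.2)%R \notin G &
  (ab.1 + ab.2 *+ z.1.2)%R == z.2]].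
pose Q : {set T} := finset.setX [set: 'I_k * 'I_k * 'I_k] A.
have cQ : #|Q| = (k ^ 3 * #|A|)%N.
  by rewrite cardsX cardsT !card_prod card_ord -!mulnA.
have Q0 : (0 < #|Q|)%N by rewrite cQ muln_gt0 expn_gt0 A0 andbT; lia.
have third (i j : 'I_k) : exists l : 'I_k, (i != l) && (j != l).
  have h0 : (0 < k)%N by lia.
  have h1 : (1 < k)%N by lia.
  have [e0|e0] := boolP ((i != 0%N :> nat) && (j != 0%N :> nat)).
    by exists (Ordinal h0); rewrite -!val_eqE.
  have [e1|e1] := boolP ((i != 1%N :> nat) && (j != 1%N :> nat)).
    by exists (Ordinal h1); rewrite -!val_eqE.
  by exists (Ordinal k3); rewrite -!val_eqE /=; lia.
have hsum : #|Q|%:R * (c / k%:R ^+ 3 * #|A|%:R) <= \sum_(z in Q) #|S z|%:R :> R.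
  have -> : #|Q|%:R * (c / k%:R ^+ 3 * #|A|%:R) = c * #|A|%:R ^+ 2 :> R.
    by rewrite cQ natrM natrX; field; rewrite gt_eqF.
  apply: le_trans hc _.
  rewrite -natr_sum ler_nat -sum1_card.
  under [X in (_ <= X)%N]eq_bigr do rewrite -sum1_card.
  rewrite (exchange_big_dep predT)//= big_mkcond.
  apply: leq_sum => -[a b] _; case: ifP => // hab.
  have [abA nG nAG] : [/\ (a, b) \in apset k A, (a, b) \notin apset k G &
      (a, b) \notin apset k (A :\: G)].
    by move: hab; rewrite !finset.in_setD finset.in_setU negb_or => /andP[/andP[-> ->] ->].
  have ap := apsetP _ _ _ _ abA.
  have [j hj] : exists j : 'I_k, a + b *+ j \notin G.
    by move: nG; rewrite inE negb_forall => /existsP.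
  have [i hi] : exists i : 'I_k, a + b *+ i \in G.
    move: nAG; rewrite inE negb_forall => /existsP[i]; rewrite inE ap// andbT negbK.
    by exists i.
  have [l /andP[il jl]] := third i j.
  rewrite sum1_card; apply/card_gt0P; exists (i, j, l, a + b *+ l).
  rewrite unfold_in /=; apply/andP; split.
    by rewrite !finset.in_setX finset.in_setT /= ap.
  by rewrite inE /= abA il jl hi hj eqxx.
have [[[[i j] l] w] hQ hz] := exists_ge_avg Q0 hsum.
exists i, j, l, w, (S (i, j, l, w)).
have wA : w \in A by move: hQ; rewrite !inE.
have : 0 < #|S (i, j, l, w)|%:R :> R.
  by apply: lt_le_trans hz; rewrite mulr_gt0// divr_gt0// exprn_gt0.
rewrite ltr0n => /card_gt0P[ab]; rewrite inE /= => /andP[_ /and5P[il jl _ _ _]].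
split => //.
by move=> a b; rewrite inE /= => /andP[-> /and5P[_ _ -> -> /eqP ->]].
Qed.

Lemma chord2_scale (x : 'Z_N) i j : (i < k)%N -> (j < k)%N ->
  chord2 (x * (i%:R - j%:R)) <= 4 ^+ k * chord2 x.
Proof.
wlog ij : i j / (j <= i)%N.
  move=> h ik jk; have [/h|/ltnW/h] := leqP j i; first exact.
  by rewrite -(opprB i%:R) mulrN chord2N// => h'; exact: h'.
move=> ik jk; rewrite -natrB// mulr_natr; apply: le_trans (chord2Mn R N1 x (i - j)) _.
apply: ler_wpM2r; first exact: chord2_ge0.
by apply: ler_weXn2l; [rewrite ler1n|lia].
Qed.

Lemma scale_inj i j : (i < k)%N -> (j < k)%N -> i != j ->
  injective (fun x : 'Z_N => x * (i%:R - j%:R)).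
Proof.
move=> ik jk ij x y /eqP; rewrite -subr_eq0 -mulrBl => h; apply/eqP.
rewrite -subr_eq0; move: h; case: (ltngtP i j) ij => // ij _.
  rewrite -(opprB j%:R) mulrN oppr_eq0 -natrB ?(ltnW ij)// mulr_natr.
  by rewrite Zp_mulrn_eq0//; lia.
by rewrite -natrB ?(ltnW ij)// mulr_natr Zp_mulrn_eq0//; lia.
Qed.

(* Many crossing progressions share positions i, j, l and the point a_l = w, with
   a_i in G and a_j outside G. Frequencies that nearly agree at w have a difference
   almost trivial at w and a_i, hence, once scaled by i - l, also at a_j, because
   (i - l) a_j = (i - j) a_l + (j - l) a_i. *)
Lemma growth_step (A G : {set 'Z_N}) (c tau b : R) (Xi : {set 'Z_N}) (M K : nat) :
  0 < c -> 0 < tau -> (0 < #|A|)%N -> (0 < M)%N -> (0 < K)%N -> 2 / K%:R ^+ 2 <= tau ->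
  G \subset A -> c * #|A|%:R ^+ 2 <= #|crossing A G|%:R ->
  (M * (2 * K).+1 ^ 2 <= #|Xi|)%N -> nearly_trivial G tau b Xi ->
  exists G' : {set 'Z_N}, [/\ G' \subset A,
     #|G|%:R + c / k%:R ^+ 3 * #|A|%:R <= #|G'|%:R :> R &
     exists2 Xi' : {set 'Z_N}, (M <= #|Xi'|)%N &
       nearly_trivial G' (4 ^+ k.+1 * tau) (2 * b) Xi'].
Proof.
move=> c0 tau0 A0 M0 K0 hK GA hc hXi triv.
have [i [j [l [w [S [[ik jk lk] [il jl wA] hS hab]]]]]] := crossing_pattern c0 A0 hc.
pose Y := [set (ab.1 + ab.2 *+ j)%R | ab in S].
have YA : Y \subset A.
  apply/fintype.subsetP => y /imsetP[[a d] /hab[/apsetP ap _ _ _] ->]; exact: ap.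
have YG : [disjoint G & Y].
  rewrite disjoint_sym; apply/pred0P => y /=; apply/negbTE; rewrite negb_and.
  have [/imsetP[[a d] /hab[_ _ nG _] ->]|//] := boolP (y \in Y).
  by rewrite nG orbT.
have cY : #|Y| = #|S|.
  apply: card_in_imset => -[a d] [a' d'] /hab[_ _ _ e] /hab[_ _ _ e'] /= e2.
  by apply: (ap_inj pN kN jk lk jl) => //; rewrite e e'.
exists (G :|: Y); split.
- by rewrite finset.subUset GA YA.
- by rewrite cardsU (disjoint_setI0 YG) cards0 subn0 cY natrD lerD2l.
have [||Xi1 [s1 M1 close1]] := @real_pigeonhole R _ bool Xi
    (fun xi e => trig R e (xi * w)) M K M0 K0.
- by move=> x e; exact: trig_le1.
- by rewrite card_bool.
have hw : {in Xi1 &, forall xi xi', chord2 ((xi - xi') * w) <= tau}.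
  move=> xi xi' h h'; apply: le_trans hK; rewrite mulrBl chord2B//.
  have sq (x : R) : `|x| <= K%:R^-1 -> x ^+ 2 <= K%:R ^- 2.
    by rewrite ler_norml -exprVn => /andP[]; nra.
  have := sq _ (close1 _ _ h h' true); have := sq _ (close1 _ _ h h' false).
  by rewrite /trig /=; lra.
have inj := scale_inj ik lk il.
exists [set xi * (i%:R - l%:R) | xi in Xi1]; first by rewrite card_imset.
move=> _ _ /imsetP[xi xi1 ->] /imsetP[xi' xi1' ->].
pose z := xi - xi'.
have tz := triv _ _ (fintype.subsetP s1 _ xi1) (fintype.subsetP s1 _ xi1').
rewrite -/z in tz; set B := [set x in G | _] in tz.
have hB x : x \in G -> x \notin B -> chord2 (z * x) <= tau.
  by move=> xG; rewrite inE xG /= -leNgt.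
have k4 : 1 <= 4 ^+ k :> R by rewrite exprn_ege1// ler1n.
have c4 x : 0 <= chord2 x by exact: chord2_ge0.
rewrite -mulrBl -/z.
(* New exceptional points come only from progressions whose point at [i] is exceptional, at most one
   for each element of [B]; together with [B] itself this doubles the bound. *)
pose BS := [set ab in S | (ab.1 + ab.2 *+ i)%R \in B].
have sub : [set x in G :|: Y | 4 ^+ k.+1 * tau < chord2 (z * (i%:R - l%:R) * x)] \subset
    B :|: [set (ab.1 + ab.2 *+ j)%R | ab in BS].
  apply/fintype.subsetP => x; rewrite inE => /andP[xGY]; apply: contraTT.
  rewrite -leNgt finset.in_setU negb_or => /andP[nB nBS].
  move: xGY; rewrite finset.in_setU => /orP[xG|/imsetP[[a d] abS xe]].
    rewrite mulrAC; apply: le_trans (chord2_scale _ ik lk) _.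
    have := hB _ xG nB; rewrite exprS; have := c4 (z * x); nra.
  have [/apsetP ap aG anG aw] := hab _ _ abS.
  have aB : a + d *+ i \notin B.
    apply: contra nBS => aB; apply/imsetP; exists (a, d) => //.
    by rewrite inE abS.
  have -> : z * (i%:R - l%:R) * x =
      z * w * (i%:R - j%:R) + z * (a + d *+ i) * (j%:R - l%:R).
    by rewrite xe -aw /= -!(mulr_natr d); ring.
  apply: le_trans (chord2D _ N1 _ _) _.
  have h1 := chord2_scale (z * w) ik jk; have h2 := chord2_scale (z * (a + d *+ i)) jk lk.
  have h3 := hw _ _ xi1 xi1'; have h4 := hB _ aG aB.
  rewrite -/z in h3; rewrite exprS.
  have h5 : 4 ^+ k * chord2 (z * w) <= 4 ^+ k * tau by rewrite ler_pM2l//; lra.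
  have h6 : 4 ^+ k * chord2 (z * (a + d *+ i)) <= 4 ^+ k * tau by rewrite ler_pM2l//; lra.
  by lra.
have cBS : (#|BS| <= #|B|)%N.
  rewrite -(card_in_imset (f := fun ab => (ab.1 + ab.2 *+ i)%R) (D := mem BS)).
    by apply: subset_leq_card; apply/fintype.subsetP => y /imsetP[ab]; rewrite inE => /andP[_ h] ->.
  move=> [a d] [a' d']; rewrite !inE => /andP[/hab[_ _ _ e] _] /andP[/hab[_ _ _ e'] _] /= e2.
  by apply: (ap_inj pN kN ik lk il) => //; rewrite e e'.
have h1 := leq_trans (subset_leq_card sub) (leq_card_setU _ _).
have h2 := leq_trans h1 (leq_add (leqnn _) (leq_trans (leq_imset_card _ _) cBS)).
rewrite -(ler_nat R) natrD in h2; apply: le_trans h2 _; lra.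
Qed.

End growth.

(** * Induction from a minimal counterexample *)

Section extremal.
Variables (R : realType) (k : nat) (eps : R).
Hypotheses (k3 : (3 <= k)%N) (eps0 : 0 < eps).

Definition ap_bound (n : nat) : R := (k.-1%:R^-1 + eps) * n%:R ^+ 2 + 2 * n%:R.

Definition minimal_counterexample (N : nat) (A : {set 'Z_N}) : Prop :=
  ap_bound #|A| < #|apset k A|%:R /\
  forall B : {set 'Z_N}, B \proper A -> #|apset k B|%:R <= ap_bound #|B|.

Let q0 : 0 < k.-1%:R^-1 :> R.
Proof. by rewrite invr_gt0 ltr0n; lia. Qed.

(** Both parts obey the bound by minimality; with m = |G| and n = |A|, n^2 - m^2 - (n - m)^2 = 2 m
    (n - m), and the linear terms cancel. *)
Lemma crossing_large N (A G : {set 'Z_N}) : minimal_counterexample A ->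
  G \subset A -> (0 < #|G|)%N -> (#|G| < #|A|)%N ->
  2 * eps * (#|G|%:R * (#|A|%:R - #|G|%:R)) <= #|crossing k A G|%:R.
Proof.
move=> [cex min] GA G0 GltA.
have hG : G \proper A by rewrite properEcard GA.
have hB : A :\: G \proper A.
  by rewrite properEcard finset.subDset finset.subsetUr cardsD (finset.setIidPr GA); lia.
have := card_crossing k A G; rewrite -(ler_nat R) !natrD => h.
have := min _ hG; have := min _ hB; have := cex.
have -> : #|A :\: G| = (#|A| - #|G|)%N by rewrite cardsD (finset.setIidPr GA).
rewrite /ap_bound natrB ?(ltnW GltA)//.
have m0 : 0 < #|G|%:R :> R by rewrite ltr0n.
have nm : #|G|%:R < #|A|%:R :> R by rewrite ltr_nat.
move: h nm m0 q0; move: (#|G|%:R : R) (#|A|%:R : R) (k.-1%:R^-1 : R) => m n q.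
move: (#|crossing k A G|%:R : R) (#|apset k A|%:R : R) (#|apset k G|%:R : R).
move: (#|apset k (A :\: G)|%:R : R) => t1 t2 t3 t4 h nm m0 hq h1 h2 h3.
have : 0 <= q * (m * (n - m)) by rewrite !mulr_ge0 ?ltW// subr_gt0.
lra.
Qed.

Lemma nearly_trivial_mono N (G Xi : {set 'Z_N}) (tau tau' b b' : R) :
  tau <= tau' -> b <= b' -> nearly_trivial G tau b Xi -> nearly_trivial G tau' b' Xi.
Proof.
move=> ht hb h xi xi' x1 x2; apply: le_trans hb; apply: le_trans (h _ _ x1 x2).
rewrite ler_nat subset_leq_card//; apply/fintype.subsetP => x; rewrite !inE => /andP[-> /=].
exact: le_lt_trans.
Qed.

(** A proportion [e0] of A may be given up twice at the end, as 2 k e0 = eps. [c1] is the proportion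
    that [popular_concentrated] guarantees at popularity eps / 2, [c] the density of crossing
    progressions while |G| / |A| lies between [c1] and 1 - e0, and [c4] the gain of one growth
    step. *)
Let e0 := eps / (2 * k%:R).
Let c1 := eps / 4.
Let c := 2 * eps * (c1 * e0).
Let c4 := c / k%:R ^+ 3.

Let kR : 0 < k%:R :> R. Proof. by rewrite ltr0n; lia. Qed.
Let e00 : 0 < e0. Proof. by apply: divr_gt0 => //; apply: mulr_gt0 => //; exact: kR. Qed.
Let c10 : 0 < c1. Proof. by rewrite divr_gt0. Qed.
Let c0 : 0 < c. Proof. exact: mulr_gt0 (mulr_gt0 (ltr0Sn _ _) eps0) (mulr_gt0 c10 e00). Qed.
Let c40 : 0 < c4. Proof. exact: divr_gt0 c0 (exprn_gt0 _ kR). Qed.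

(** Each growth step worsens tau, be and M by the factors 4^(k+1), 2 and (2K + 1)^2. The induction
    therefore quantifies over them, and a stage calls the previous one with stronger demands; [C]
    stays independent of N and A. *)
Lemma extremal_stages (i : nat) (tau be : R) (M : nat) : 0 < tau -> 0 < be -> (0 < M)%N ->
  exists C : nat, forall N (A : {set 'Z_N}), prime N -> (k <= N)%N -> (0 < #|A|)%N ->
    (C * #|A| <= N)%N -> minimal_counterexample A ->
    exists G : {set 'Z_N}, [/\ G \subset A,
      (c1 + i%:R * c4) * #|A|%:R <= #|G|%:R \/ (1 - e0) * #|A|%:R <= #|G|%:R &
      exists2 Xi : {set 'Z_N}, (M <= #|Xi|)%N & nearly_trivial G tau (be * #|A|%:R) Xi].
Proof.
elim: i tau be M => [|i IH] tau be M tau0 be0 M0.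
  have [C hC] := @popular_concentrated R (eps / 2) (tau * be) M
    (divr_gt0 eps0 (ltr0Sn _ _)) (mulr_gt0 tau0 be0) M0.
  exists C => N A pN kN A0 CN [cex _].
  have hT : 2 * (eps / 2) * #|A|%:R ^+ 2 <= #|apset k A|%:R.
    apply: le_trans (ltW cex); rewrite /ap_bound; have -> : 2 * (eps / 2) = eps by field.
    have := ler0n R #|A|; have := sqr_ge0 (#|A|%:R : R); have := q0.
    move: (k.-1%:R^-1 : R) ((#|A|%:R : R) ^+ 2) (#|A|%:R : R) => q n2 n hq hn2 hn.
    by have := mulr_ge0 (ltW hq) hn2; lra.
  have hE := popular_edges pN k3 kN (divr_gt0 eps0 (ltr0Sn _ _)) hT.
  have [X [XA hX [Xi [hM hXi]]]] := hC N A (prime_gt1 pN) A0 CN hE.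
  exists X; split => //.
    by left; rewrite mul0r addr0; apply: le_trans hX; rewrite /c1; lra.
  exists Xi => // xi xi' x1 x2.
  have h := @markov_card R _ X (fun x => chord2 R ((xi - xi') * x)) tau
    (fun x _ => chord2_ge0 _ _).
  have := le_trans h (hXi _ _ x1 x2); rewrite -mulrA ler_pM2l// => h2.
  apply: le_trans h2 _; rewrite ler_pM2l// ler_nat.
  exact: subset_leq_card.
have k4 : 1 <= 4 ^+ k.+1 :> R by rewrite exprn_ege1// ler1n.
have k40 : 0 < 4 ^+ k.+1 :> R by lra.
pose tau' := tau / 4 ^+ k.+1.
have tau'0 : 0 < tau' by rewrite divr_gt0.
have [K K0 hK] := nat_above (2 / tau').
have KR : 1 <= K%:R :> R by rewrite ler1n.
have hK2 : 2 / K%:R ^+ 2 <= tau'.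
  have K1 : 0 < K%:R :> R by lra.
  move: hK; rewrite ler_pdivrMr// => hK; rewrite ler_pdivrMr ?exprn_gt0//.
  by apply: le_trans hK _; rewrite mulrC ler_pM2l// expr2 ler_peMl// ltW.
have be2 : 0 < be / 2 by rewrite divr_gt0.
have M'0 : (0 < M * (2 * K).+1 ^ 2)%N by rewrite muln_gt0 M0 expn_gt0.
have [C hC] := IH tau' (be / 2) _ tau'0 be2 M'0.
exists C => N A pN kN A0 CN cex.
have [G [GA hG [Xi hM triv]]] := hC N A pN kN A0 CN cex.
have nR : 0 < #|A|%:R :> R by rewrite ltr0n.
have M2 : (M <= #|Xi|)%N by apply: leq_trans hM; rewrite leq_pmulr// expn_gt0.
have [big|small] := leP ((1 - e0) * #|A|%:R) #|G|%:R.
  exists G; split => //; first by right.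
  exists Xi => //; apply: nearly_trivial_mono triv.
    by rewrite ler_pdivrMr// ler_peMr// ltW.
  by rewrite ler_pM2r//; lra.
case: hG => [hG|hG]; last by move: small; rewrite ltNge hG.
have hc : c * #|A|%:R ^+ 2 <= #|crossing k A G|%:R.
  have hm : c1 * #|A|%:R <= #|G|%:R.
    apply: le_trans hG; rewrite ler_pM2r// lerDl mulr_ge0// ltW//.
  have ga : (#|G| < #|A|)%N.
    rewrite -(ltr_nat R); apply: lt_le_trans small _.
    by rewrite ler_piMl// ?ler0n//; have := e00; lra.
  have g0 : (0 < #|G|)%N.
    by rewrite -(ltr0n R); apply: lt_le_trans hm; rewrite mulr_gt0.
  apply: le_trans (crossing_large cex GA g0 ga).
  have -> : c * #|A|%:R ^+ 2 = 2 * eps * (c1 * #|A|%:R * (e0 * #|A|%:R)).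
    by rewrite /c; ring.
  rewrite ler_pM2l ?mulr_gt0//; apply: ler_pM => //; try by rewrite mulr_ge0// ltW.
  by move: small; rewrite mulrBl mul1r; lra.
have [G' [GA' hG' [Xi' hM' triv']]] :=
  growth_step pN k3 kN c0 tau'0 A0 M0 K0 hK2 GA hc hM triv.
exists G'; split => //.
  left; apply: le_trans hG'; rewrite -natr1 -/c4.
  by move: hG; rewrite !mulrDl; lra.
exists Xi' => //; apply: nearly_trivial_mono triv'.
  by rewrite /tau' mulrC mulfVK ?gt_eqF.
by rewrite mulrA mulrC; lra.
Qed.

Theorem cyclic_extremal : exists C : nat, forall N (A : {set 'Z_N}), prime N ->
  (C * #|A| <= N)%N -> #|apset k A|%:R <= ap_bound #|A|.
Proof.
have k2 : (2 <= k)%N by lia.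
have qn0 : (0 < k.-1)%N by lia.
have [L _ hL] := nat_above (1 / c4).
have e4 : 0 < 1 / 4 :> R by lra.
(* As L c4 >= 1, both alternatives of the last stage give |G| >= (1 - e0) |A|. The threshold 1/4 is
   the one of the arc, and two frequencies yield one nonzero difference. *)
have [C hC] := extremal_stages L e4 e00 (isT : (0 < 2)%N).
exists (maxn C k) => N A pN; move: {2}#|A| (leqnn #|A|) => n; elim: n A => [|n IH] A An CN.
  move: An; rewrite leqn0 cards_eq0 => /eqP ->.
  have -> : apset k (finset.set0 : {set 'Z_N}) = finset.set0.
    apply/setP => -[a b]; rewrite !inE; apply/negbTE; rewrite negb_forall.
    have k0 : (0 < k)%N by lia.
    by apply/existsP; exists (Ordinal k0); rewrite inE.
  by rewrite /ap_bound !cards0 expr0n /= !mulr0 addr0.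
rewrite leNgt; apply/negP => cex.
have A0 : (0 < #|A|)%N.
  rewrite lt0n; apply/negP => /eqP e; move: cex.
  have : (#|apset k A| <= 0)%N.
    have kpos : (0 < k)%N by lia.
    rewrite leqNgt; apply/negP => /card_gt0P[[a b]] /apsetP /(_ 0%N kpos).
    by move: e => /eqP; rewrite cards_eq0 => /eqP ->; rewrite inE.
  rewrite leqn0 => /eqP ->; rewrite /ap_bound e expr0n /= !mulr0 addr0 ltxx.
  by [].
have nR : 0 < #|A|%:R :> R by rewrite ltr0n.
have kN : (k <= N)%N.
  apply: leq_trans CN; apply: leq_trans (leq_maxr C k) _.
  by rewrite leq_pmulr.
have CN' : (C * #|A| <= N)%N.
  by apply: leq_trans CN; rewrite leq_mul2r leq_maxl orbT.
have min : minimal_counterexample A.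
  split => // B BA; apply: IH.
    by rewrite -ltnS; apply: leq_trans An; exact: proper_card.
  by apply: leq_trans CN; rewrite leq_mul2l (ltnW (proper_card BA)) orbT.
have [G [GA hG [Xi Xi2 triv]]] := hC N A pN kN A0 CN' min.
have {}hG : (1 - e0) * #|A|%:R <= #|G|%:R.
  case: hG => // hG; apply: le_trans hG; rewrite ler_pM2r//.
  move: hL; rewrite ler_pdivrMr// => hL.
  by have := e00; have := c10; lra.
have [xi [xi' [x1 x2 xx]]] : exists xi xi', [/\ xi \in Xi, xi' \in Xi & xi != xi'].
  have : (1 < #|Xi|)%N by [].
  by case/card_gt1P => x [y [hx hy xy]]; exists x, y.
have z0 : xi - xi' != 0 by rewrite subr_eq0.
pose B := [set x in G | 1 / 4 < chord2 R ((xi - xi') * x)].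
pose A' := G :\: B.
have A'A : A' \subset A by apply: fintype.subset_trans GA; exact: finset.subsetDl.
have arc : {in A', forall x, chord2 R ((xi - xi') * x) <= 1 / 4}.
  by move=> x; rewrite !inE => /andP[h xG]; move: h; rewrite xG /= -leNgt.
have hB : #|B|%:R <= e0 * #|A|%:R by exact: triv.
have BG : B \subset G by apply/fintype.subsetP => x; rewrite inE => /andP[].
have hA' : #|A :\: A'|%:R <= 2 * e0 * #|A|%:R.
  rewrite cardsD (finset.setIidPr A'A) natrB ?subset_leq_card//.
  rewrite cardsD (finset.setIidPr BG) natrB ?subset_leq_card//.
  by move: hG hB; rewrite mulrBl mul1r; lra.
have h1 := card_aps_in_arc pN z0 arc k2 kN.
have h2 := card_aps_subset pN k3 kN A'A.
have qR : 0 < k.-1%:R :> R by rewrite ltr0n.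
move: h2; rewrite -(ler_nat R) natrD !natrM => h2.
have h3 : #|apset k A'|%:R <= k.-1%:R^-1 * #|A|%:R ^+ 2 + 2 * #|A|%:R :> R.
  rewrite -(ler_pM2l qR); move: h1; rewrite -(ler_nat R) !natrD !natrM => h1.
  apply: le_trans h1 _.
  have -> : k.-1%:R * (k.-1%:R^-1 * #|A|%:R ^+ 2 + 2 * #|A|%:R) =
     #|A|%:R ^+ 2 + 2 * k.-1%:R * #|A|%:R :> R by field; rewrite gt_eqF.
  have le : #|A'|%:R <= #|A|%:R :> R by rewrite ler_nat subset_leq_card.
  by apply: lerD; [rewrite expr2 ler_pM|rewrite ler_pM2l// mulr_gt0].
move: cex; rewrite ltNge => /negP; apply; rewrite /ap_bound mulrDl.
apply: le_trans h2 _.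
have h4 : k%:R * (#|A :\: A'|%:R * #|A|%:R) <= eps * #|A|%:R ^+ 2.
  have -> : eps * #|A|%:R ^+ 2 = k%:R * (2 * e0 * #|A|%:R * #|A|%:R).
    by rewrite /e0; field; rewrite gt_eqF.
  by rewrite ler_pM2l// ler_pM2r.
by lra.
Qed.

End extremal.

(** * Lower bounds for the relative entropy *)

Section relative_entropy.
Variable R : realType.
Implicit Types p x y t L : R.

Lemma ln_le_sub1 t : 0 < t -> ln t <= t - 1.
Proof. by move=> t0; have := expR_ge1Dx (ln t); rewrite lnK// lerBrDl. Qed.

Lemma ln_ge_sub1V t : 0 < t -> 1 - t^-1 <= ln t.
Proof.
by move=> t0; have := @ln_le_sub1 t^-1; rewrite lnV ?posrE// invr_gt0 => /(_ t0); lra.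
Qed.

(** By log t >= 1 - 1/t the second summand of the entropy is at least p - y. *)
Lemma relent_ge p y : 0 < p < 1 -> 0 <= y <= 1 -> y * ln (y / p) - (y - p) <= relent p y.
Proof.
move=> /andP[p0 p1] /andP[y0 y1]; rewrite /relent lerD2l.
have [->|yn1] := eqVneq y 1; first by rewrite subrr mul0r; lra.
have y1' : 0 < 1 - y by rewrite subr_gt0 lt_neqAle yn1.
have h := ln_ge_sub1V (divr_gt0 y1' (_ : 0 < 1 - p)).
have := ler_wpM2l (ltW y1') (h ltac:(lra)); apply: le_trans.
by rewrite invf_div mulrBr mulr1 mulrC divfK ?gt_eqF//; lra.
Qed.

Lemma relent_ge0 p y : 0 < p < 1 -> 0 <= y <= 1 -> 0 <= relent p y.
Proof.
move=> p01 y01; apply: le_trans (relent_ge p01 y01).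
move: p01 y01 => /andP[p0 p1] /andP[y0 y1].
have [->|yn0] := eqVneq y 0; first by rewrite mul0r; lra.
have y0' : 0 < y by rewrite lt_def yn0.
have := ler_wpM2l y0 (ln_ge_sub1V (divr_gt0 y0' p0)).
by rewrite invf_div mulrBr mulr1 mulrC divfK ?gt_eqF//; lra.
Qed.

Lemma relent_same p : 0 < p < 1 -> relent p p = 0.
Proof.
by move=> /andP[p0 p1]; rewrite /relent !divff ?gt_eqF ?subr_gt0// ln1 !mulr0 addr0.
Qed.

Lemma relent_1 p : 0 < p -> relent p 1 = ln (1 / p).
Proof. by move=> p0; rewrite /relent subrr mul0r addr0 mul1r. Qed.

(** With v the square root of (p + x) / p, the entropy dominates the Hellinger-type quantity p (v -
    1)^2, while x = p (v - 1) (v + 1) and p (v + 1)^2 <= 2 (2 p + x). *)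
Lemma relent_ge_sqr p x : 0 < p < 1 -> 0 <= x -> p + x <= 1 ->
  x ^+ 2 <= 2 * (2 * p + x) * relent p (p + x).
Proof.
move=> p01 x0 px1; have /andP[p0 p1] := p01.
have h := relent_ge p01 (_ : 0 <= p + x <= 1).
have {h} := h ltac:(by rewrite px1 andbT; lra).
set v := Num.sqrt ((p + x) / p).
have q0 : 0 < (p + x) / p by rewrite divr_gt0//; lra.
have v0 : 0 < v by rewrite sqrtr_gt0.
have v2 : v ^+ 2 = (p + x) / p by rewrite sqr_sqrtr// ltW.
have pv : p + x = p * v ^+ 2 by rewrite v2 mulrC divfK ?gt_eqF.
have lnv : ln ((p + x) / p) = 2 * ln v by rewrite -v2 lnXn// mulr_natl.
rewrite lnv; set I := relent _ _ => hI.
have h1 := ln_ge_sub1V v0.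
have h2 : p * v ^+ 2 * (2 * (1 - v^-1)) <= (p + x) * (2 * ln v).
  by rewrite -pv ler_wpM2l//; lra.
have h3 : p * v ^+ 2 * (2 * (1 - v^-1)) = 2 * p * (v ^+ 2 - v).
  by field; rewrite gt_eqF.
have ex : x = p * (v ^+ 2 - 1) by lra.
have h4 : p * (v - 1) ^+ 2 <= I.
  by rewrite h3 in h2; apply: le_trans hI; rewrite (_ : p + x - p = x); [nra|ring].
have h5 : p * (v + 1) ^+ 2 <= 2 * (2 * p + x).
  have -> : 2 * (2 * p + x) = p * (2 * v ^+ 2 + 2) by rewrite ex; ring.
  by rewrite ler_pM2l//; have := sqr_ge0 (v - 1); nra.
have -> : x ^+ 2 = p * (v + 1) ^+ 2 * (p * (v - 1) ^+ 2) by rewrite ex; ring.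
by apply: ler_pM => //; rewrite mulr_ge0 ?sqr_ge0 ?ltW.
Qed.

Lemma relent_ge_lin p x : 0 < p < 1 -> 0 < x -> p + x <= 1 ->
  x * (ln (1 / p) + ln x - 1) <= relent p (p + x).
Proof.
move=> p01 x0 px1; have /andP[p0 p1] := p01.
have h := relent_ge p01 (_ : 0 <= p + x <= 1).
have {h} h := h ltac:(by rewrite px1 andbT; lra).
apply: le_trans h; rewrite (_ : p + x - p = x); last by ring.
have h1 : ln (1 / p) + ln x <= ln ((p + x) / p).
  rewrite -lnM ?posrE// ?divr_gt0//.
  have q1 : 0 < p^-1 by rewrite invr_gt0.
  have q2 : 0 < (p + x) / p by rewrite mulr_gt0//; lra.
  rewrite ler_ln ?posrE//; last by rewrite mul1r mulr_gt0.
  by rewrite mul1r mulrC ler_pM2r ?invr_gt0//; lra.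
have h2 : 0 <= ln ((p + x) / p).
  by rewrite ln_ge0// ler_pdivlMr// mul1r; lra.
by nra.
Qed.

(* With p = r^8 every power of log (1/p) is absorbed by powers of r. *)
Variables (r p L : R).
Hypotheses (r0 : 0 < r) (r1 : r <= 1 / 24) (pE : p = r ^+ 8) (LE : L = ln (1 / p)).

Lemma p_lt1 : 0 < p < 1.
Proof.
have hr0 := r0; have hr1 := r1.
have r1' : r < 1 by lra.
by rewrite pE exprn_gt0//= exprn_ilt1// ltW.
Qed.

Lemma L_lnr : L = - (8 * ln r).
Proof. by rewrite LE pE div1r lnV ?posrE ?exprn_gt0// lnXn// mulr_natl. Qed.

Lemma rL_le : r * L <= 8.
Proof.
have hr0 := r0; have hr1 := r1.
rewrite L_lnr; have := ln_le_sub1 (_ : 0 < r^-1); rewrite invr_gt0 lnV ?posrE// => /(_ r0) h.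
have h2 : r * - ln r <= r * (r^-1 - 1) by rewrite ler_pM2l.
by move: h2; rewrite mulrBr mulfV ?gt_eqF//; lra.
Qed.

Lemma L_ge : 4 <= L.
Proof.
have hr0 := r0; have hr1 := r1.
rewrite L_lnr; have := ln_le_sub1 r0; lra.
Qed.

Let p01 := p_lt1.
Let L4 := L_ge.

(** [r ^+ 4] is the square root of p: above it log x >= - L / 2, which leaves L / 2 - 1 >= L / 4. *)
Lemma relent_ge_half x : r ^+ 4 <= x -> p + x <= 1 -> x * L / 4 <= relent p (p + x).
Proof.
have hr0 := r0; have hr1 := r1; have hL4 := L4.
move=> rx px; have r40 : 0 < r ^+ 4 by exact: exprn_gt0.
have x0 : 0 < x by lra.
apply: le_trans (relent_ge_lin p01 x0 px); rewrite -mulrA ler_pM2l// -LE.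
have : ln (r ^+ 4) <= ln x by rewrite ler_ln ?posrE.
by rewrite lnXn// -mulr_natl; have := L_lnr; lra.
Qed.

(** Above r^4 the linear entropy bound carries the factor L. Below it x^2 is at most 6 r^4 times the
    entropy, and one power of r absorbs L. *)
Lemma sqr_le_relent (s x : R) : 0 < s -> 12 * r <= s ->
  0 <= x <= s -> p + x <= 1 -> x ^+ 2 * L <= 4 * s * relent p (p + x).
Proof.
have hr0 := r0; have hr1 := r1; have hL4 := L4.
move=> s0 rs /andP[x0 xs] px; have I0 := relent_ge0 p01 (_ : 0 <= p + x <= 1).
have /andP[pp0 pp1] := p01.
have {}I0 := I0 ltac:(by rewrite px andbT; lra).
have [h|h] := leP (r ^+ 4) x.
  have h1 := relent_ge_half h px.
  have h2 : x ^+ 2 * L <= s * (x * L).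
    by rewrite expr2 -mulrA ler_wpM2r// mulr_ge0//; lra.
  have h3 : s * (x * L / 4) <= s * relent p (p + x) by rewrite ler_pM2l.
  by lra.
have h1 := relent_ge_sqr p01 x0 px.
have pr : p <= r ^+ 4.
  rewrite pE (_ : r ^+ 8 = r ^+ 4 * r ^+ 4); last by ring.
  by apply: ler_piMl; [rewrite exprn_ge0// ltW|apply: exprn_ile1; [exact: ltW|lra]].
have h2 : x ^+ 2 <= 6 * r ^+ 4 * relent p (p + x).
  by apply: le_trans h1 _; rewrite ler_wpM2r//; lra.
have h3 : x ^+ 2 * L <= 6 * r ^+ 4 * relent p (p + x) * L by rewrite ler_wpM2r//; lra.
apply: le_trans h3 _.
have -> : 6 * r ^+ 4 * relent p (p + x) * L = 6 * r ^+ 3 * (r * L) * relent p (p + x) by ring.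
rewrite ler_wpM2r//.
have h4 : r ^+ 3 <= r / 24.
  have : r ^+ 2 <= 1 / 24 by rewrite expr2; nra.
  by rewrite exprS => h5; have := ler_wpM2l (ltW r0) h5; lra.
have h5 : r ^+ 3 * (r * L) <= r / 24 * 8.
  by apply: ler_pM => //; [rewrite exprn_ge0// ltW|rewrite mulr_ge0//; lra|exact: rL_le].
by lra.
Qed.

(** The linear entropy bound serves above r^4, the quadratic one below, with 2 p + x <= 3 x if x >=
    p and <= 3 p otherwise. In the last range the claim amounts to sqrt x >= 3 p L / (2 rho), which
    is the lower cutoff on x. *)
Lemma pow32_le_relent (rho x : R) : 0 < rho -> 12 * r <= rho ->
  9 / 4 * p ^+ 2 * L ^+ 2 / rho ^+ 2 <= x -> 0 <= x <= rho ^+ 2 -> p + x <= 1 ->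
  x * Num.sqrt x * L <= 4 * rho * relent p (p + x).
Proof.
have hr0 := r0; have hr1 := r1; have hL4 := L4.
move=> s0 rs kx /andP[x0 xs] px; have I0 := relent_ge0 p01 (_ : 0 <= p + x <= 1).
have /andP[pp0 pp1] := p01.
have {}I0 := I0 ltac:(by rewrite px andbT; lra).
have sx0 : 0 <= Num.sqrt x by exact: sqrtr_ge0.
have sx : Num.sqrt x <= rho.
  by rewrite -(ger0_norm (ltW s0)) -sqrtr_sqr ler_wsqrtr.
have [h|h] := leP (r ^+ 4) x.
  have h1 := relent_ge_half h px.
  have h2 : x * Num.sqrt x * L <= rho * (x * L).
    by rewrite mulrAC [leRHS]mulrC ler_wpM2l// mulr_ge0//; lra.
  have h3 : rho * (x * L / 4) <= rho * relent p (p + x) by rewrite ler_pM2l.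
  by lra.
have h1 := relent_ge_sqr p01 x0 px.
have [hp|hp] := leP p x.
  have sxr : Num.sqrt x <= r ^+ 2.
    have -> : r ^+ 2 = Num.sqrt (r ^+ 4).
      by rewrite (_ : r ^+ 4 = (r ^+ 2) ^+ 2); [rewrite sqrtr_sqr ger0_norm// sqr_ge0|ring].
    by rewrite ler_wsqrtr// ltW.
  have h2 : x <= 6 * relent p (p + x).
    have xpos : 0 < x by lra.
    by rewrite -(ler_pM2l xpos) -expr2; apply: le_trans h1 _; nra.
  have h3 : Num.sqrt x * L <= 2 / 3 * rho.
    apply: (@le_trans _ _ (r * (r * L))).
      by rewrite mulrA -expr2 ler_wpM2r//; lra.
    have : r * (r * L) <= r * 8 by rewrite ler_pM2l// rL_le.
    by lra.
  have h4 : x * (Num.sqrt x * L) <= x * (2 / 3 * rho) by rewrite ler_wpM2l.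
  by rewrite mulrA in h4; nra.
have h2 : x ^+ 2 <= 6 * p * relent p (p + x).
  by apply: le_trans h1 _; rewrite ler_wpM2r//; lra.
have h3 : 3 / 2 * p * L / rho <= Num.sqrt x.
  have p0' : 0 <= 3 / 2 * p * L / rho by rewrite divr_ge0 ?mulr_ge0//; lra.
  rewrite -(ger0_norm p0') -sqrtr_sqr ler_wsqrtr//; apply: le_trans kx.
  by rewrite le_eqVlt; apply/orP; left; apply/eqP; field; rewrite gt_eqF.
have h4 : L * p * 3 / 2 <= rho * Num.sqrt x by move: h3; rewrite ler_pdivrMr//; lra.
have h5 : x * Num.sqrt x * (L * p * 3 / 2) <= x * Num.sqrt x * (rho * Num.sqrt x).
  by rewrite ler_wpM2l// mulr_ge0.
have h6 : x * Num.sqrt x * (rho * Num.sqrt x) = rho * x ^+ 2.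
  transitivity (rho * x * Num.sqrt x ^+ 2); first by ring.
  by rewrite sqr_sqrtr//; ring.
rewrite h6 in h5.
have h7 : rho * x ^+ 2 <= rho * (6 * p * relent p (p + x)) by rewrite ler_pM2l.
have := le_trans h5 h7.
rewrite (_ : x * Num.sqrt x * (L * p * 3 / 2) = 3 / 2 * p * (x * Num.sqrt x * L)); last by field.
rewrite (_ : rho * (6 * p * relent p (p + x)) = 3 / 2 * p * (4 * rho * relent p (p + x))); last by field.
by rewrite ler_pM2l// mulr_gt0.
Qed.

Lemma small_le_relent x : 0 <= x <= p -> p + x <= 1 -> x ^+ 2 <= 6 * p * relent p (p + x).
Proof.
have hr0 := r0; have hr1 := r1; have hL4 := L4.
move=> /andP[x0 xp] px; have /andP[p0 p1] := p01.
have I0 := relent_ge0 p01 (_ : 0 <= p + x <= 1).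
have {}I0 := I0 ltac:(by rewrite px andbT; lra).
by apply: le_trans (relent_ge_sqr p01 x0 px) _; rewrite ler_wpM2r//; lra.
Qed.

Lemma large_le_relent x : p <= x -> p + x <= 1 -> x <= 6 * relent p (p + x).
Proof.
have hr0 := r0; have hr1 := r1; have hL4 := L4.
move=> xp px; have /andP[p0 p1] := p01.
have I0 := relent_ge0 p01 (_ : 0 <= p + x <= 1).
have {}I0 := I0 ltac:(by rewrite px andbT; lra).
have x0 : 0 < x by lra.
rewrite -(ler_pM2l x0) -expr2.
by apply: le_trans (relent_ge_sqr p01 (ltW x0) px) _; nra.
Qed.

Lemma top_le_relent (e s x : R) : 0 < s -> 1 - ln s <= e * L -> s <= x -> p + x <= 1 ->
  (1 - e) * (x * L) <= relent p (p + x).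
Proof.
have hr0 := r0; have hr1 := r1; have hL4 := L4.
move=> s0 hs sx px; have x0 : 0 < x by lra.
apply: le_trans (relent_ge_lin p01 x0 px); rewrite -LE.
have : ln s <= ln x by rewrite ler_ln ?posrE.
move=> h; rewrite mulrCA ler_pM2l//; lra.
Qed.

End relative_entropy.

(** * Weighted configurations *)

Section weighted_counts.
Variables (R : realFieldType) (I J : finType) (k : nat) (pi_ : 'I_k -> J -> I).
(** Besides the extremal bound, the only property of progressions that is used: two positions
    determine the configuration. *)
Hypothesis pi_inj : forall i j, i != j -> injective (fun P => (pi_ i P, pi_ j P)).
Implicit Types g u v : I -> R.

Definition weight g : R := \sum_P \prod_(i < k) g (pi_ i P).

Definition inside (A : {set I}) : {set J} := [set P | [forall i, pi_ i P \in A]].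

Lemma pair_sum (i j : 'I_k) u v : i != j -> (forall x, 0 <= u x) -> (forall x, 0 <= v x) ->
  \sum_P u (pi_ i P) * v (pi_ j P) <= (\sum_x u x) * \sum_x v x.
Proof.
move=> ij u0 v0; rewrite mulr_suml; under [leRHS]eq_bigr do rewrite mulr_sumr.
rewrite pair_big /=.
have -> : \sum_P u (pi_ i P) * v (pi_ j P) =
    \sum_(z in [set (pi_ i P, pi_ j P) | P in [set: J]]) u z.1 * v z.2.
  rewrite big_imset /=; last by move=> P P' _ _; exact: pi_inj.
  by apply: eq_bigl => P; rewrite finset.in_setT.
rewrite [leRHS](bigID [in [set (pi_ i P, pi_ j P) | P in [set: J]]]) /=.
by rewrite lerDl sumr_ge0// => z _; rewrite mulr_ge0.
Qed.

Lemma single_sum (i j : 'I_k) u : i != j -> (forall x, 0 <= u x) ->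
  \sum_P u (pi_ i P) <= #|I|%:R * \sum_x u x.
Proof.
move=> ij u0; have := @pair_sum i j u (fun=> 1) ij u0 (fun=> ler01).
by under eq_bigr do rewrite mulr1; rewrite sumr_const mulrC.
Qed.

Section rounding.
Variables (al ga : R).
Hypotheses (al0 : 0 <= al) (ext : forall A : {set I}, #|A|%:R <= ga ->
  #|inside A|%:R <= al * #|A|%:R ^+ 2 + 2 * #|A|%:R).

(* [majorant] is affine in each coordinate, and [weight] is at most its affine
   interpolation in each coordinate, so comparing them reduces to indicators. *)
Definition majorant g : R :=
  al * ((\sum_x g x) ^+ 2 + \sum_x (g x - g x ^+ 2)) + 2 * \sum_x g x.

Definition upd g (x : I) (t : R) : I -> R := fun y => if y == x then t else g y.

Lemma sum_upd (F : R -> R) g x t :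
  \sum_y F (upd g x t y) = F t + \sum_(y | y != x) F (g y).
Proof.
rewrite (bigD1 x)//= /upd eqxx; congr (_ + _).
by apply: eq_bigr => y /negbTE ->.
Qed.

Lemma majorant_upd g x :
  majorant g = g x * majorant (upd g x 1) + (1 - g x) * majorant (upd g x 0).
Proof.
have e : g = upd g x (g x).
  by apply/funext => y; rewrite /upd; case: eqP => [->|].
rewrite {1}e /majorant !(sum_upd id) !(sum_upd (fun t => t - t ^+ 2)); ring.
Qed.

(** [weight] need not be affine in [g x], as a configuration may meet [x] several times; raising the
    repeated factors to 1 only increases the product. *)
Lemma weight_upd g x : (forall y, 0 <= g y <= 1) ->
  weight g <= g x * weight (upd g x 1) + (1 - g x) * weight (upd g x 0).
Proof.
move=> g01; rewrite /weight !mulr_sumr -big_split; apply: ler_sum => P _ /=.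
have /andP[gx0 gx1] := g01 x.
have [/existsP[i0 /eqP hi]|] := boolP [exists i, pi_ i P == x]; last first.
  rewrite negb_exists => /forallP h.
  have e t : \prod_(i < k) upd g x t (pi_ i P) = \prod_(i < k) g (pi_ i P).
    by apply: eq_bigr => i _; rewrite /upd (negbTE (h i)).
  by rewrite !e; lra.
have -> : \prod_(i < k) upd g x 0 (pi_ i P) = 0.
  by rewrite (bigD1 i0)//= /upd hi eqxx mul0r.
rewrite mulr0 addr0 (bigD1 i0)//= [X in _ <= _ * X](bigD1 i0)//= hi.
rewrite /upd eqxx mul1r ler_wpM2l//; apply: ler_prod => i _.
have /andP[a b] := g01 (pi_ i P); rewrite a /=.
by case: eqP => [->|].
Qed.

(** Induction on the number of values strictly between 0 and 1. Rounding one of them does not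
    enlarge the support, so [ext] stays applicable. *)
Lemma weight_le_majorant g : (forall x, 0 <= g x <= 1) ->
  #|[set x | g x != 0]|%:R <= ga -> weight g <= majorant g.
Proof.
move: {2}#|_| (leqnn #|[set x | 0 < g x < 1]|) => n.
elim: n g => [|n IH] g hn g01 supp.
  have g01' x : g x = (g x != 0)%:R.
    have [->|gx] := eqVneq (g x) 0; first by [].
    have := g01 x; rewrite le0r (negbTE gx) /= => /andP[g0 g1].
    apply/eqP; rewrite eq_le g1 /= leNgt; apply/negP => lt.
    have : x \in [set x | 0 < g x < 1] by rewrite inE g0 lt.
    by move: hn; rewrite leqn0 cards_eq0 => /eqP ->; rewrite inE.
  set A := [set x | g x != 0] in supp.
  have gA x : g x = (x \in A)%:R by rewrite inE -g01'.
  have W : \sum_x g x = #|A|%:R.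
    rewrite -sum1_card natr_sum [RHS]big_mkcond; apply: eq_bigr => x _.
    by rewrite gA; case: ifP.
  have Z : \sum_x (g x - g x ^+ 2) = 0.
    rewrite big1// => x _; rewrite gA.
    by case: (x \in A); rewrite ?expr1n ?expr0n ?subrr.
  have T : weight g = #|inside A|%:R.
    rewrite -sum1_card natr_sum [RHS]big_mkcond; apply: eq_bigr => P _.
    rewrite inE; case: ifP => [/forallP h|/negbT].
      by rewrite big1// => i _; rewrite gA h.
    rewrite negb_forall => /existsP[i hi].
    by rewrite (bigD1 i)//= gA (negbTE hi) mul0r.
  by rewrite T /majorant W Z addr0; exact: ext.
have [/existsP[x hx]|] := boolP [exists x, 0 < g x < 1]; last first.
  rewrite negb_exists => /forallP h; apply: IH => //.
  rewrite (eq_card0 (A := [set x | 0 < g x < 1]))// => x.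
  by rewrite inE (negbTE (h x)).
have /andP[gx0 gx1] := hx.
have lo t : t = 0 \/ t = 1 -> weight (upd g x t) <= majorant (upd g x t).
  move=> t01; apply: IH.
  - rewrite -ltnS; apply: leq_trans hn; apply: proper_card; apply/properP; split.
      apply/fintype.subsetP => y; rewrite !inE /upd.
      by case: eqP => // _; case: t01 => ->; rewrite ltxx ?andbF.
    exists x; rewrite !inE ?hx// /upd eqxx.
    by case: t01 => ->; rewrite ltxx ?andbF.
  - by move=> y; rewrite /upd; case: eqP => // _; case: t01 => ->; rewrite lexx ler01.
  - apply: le_trans supp; rewrite ler_nat; apply: subset_leq_card.
    apply/fintype.subsetP => y; rewrite !inE /upd.
    by case: (eqVneq y x) => [-> _|//]; rewrite gt_eqF.
apply: le_trans (weight_upd x g01) _.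
rewrite (majorant_upd g x); apply: lerD; apply: ler_wpM2l.
- exact: ltW.
- by apply: lo; right.
- by rewrite subr_ge0 ltW.
- by apply: lo; left.
Qed.

Lemma weight_extremal g : (forall x, 0 <= g x <= 1) ->
  #|[set x | g x != 0]|%:R <= ga ->
  weight g <= al * (\sum_x g x) ^+ 2 + (al + 2) * \sum_x g x.
Proof.
move=> g01 supp; apply: le_trans (weight_le_majorant g01 supp) _.
have h : \sum_x (g x - g x ^+ 2) <= \sum_x g x.
  by apply: ler_sum => x _; rewrite lerBlDr lerDl sqr_ge0.
by rewrite /majorant; have := ler_wpM2l al0 h; lra.
Qed.

End rounding.

Section expansion.
Variable g : I -> R.
Hypothesis g01 : forall x, 0 <= g x <= 1.
Let g0 x : 0 <= g x. Proof. by case/andP: (g01 x). Qed.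
Let g1 x : g x <= 1. Proof. by case/andP: (g01 x). Qed.
Let G1 := \sum_x g x.
Let G2 := \sum_x g x ^+ 2.

Lemma G1_ge0 : 0 <= G1. Proof. exact: sumr_ge0. Qed.
Lemma G2_ge0 : 0 <= G2. Proof. by apply: sumr_ge0 => x _; exact: sqr_ge0. Qed.

Definition partial_weight (S : {set 'I_k}) : R := \sum_P \prod_(i in S) g (pi_ i P).

Lemma prod_sub_le (S : {set 'I_k}) (s : seq 'I_k) (P : J) : uniq s -> {subset s <= S} ->
  \prod_(i in S) g (pi_ i P) <= \prod_(i <- s) g (pi_ i P).
Proof.
move=> us sS; rewrite big_uniq//= (bigID [in s]) /=.
have -> : \prod_(i in S | i \in s) g (pi_ i P) = \prod_(i in s) g (pi_ i P).
  apply: eq_bigl => i; rewrite andbC; case: (boolP (i \in s)) => //= h.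
  exact: sS.
rewrite ler_piMr//; first by apply: prodr_ge0 => i _; exact: g0.
by apply: prodr_ile1 => i _; rewrite g0 g1.
Qed.

Lemma partial_weight1 (S : {set 'I_k}) : #|S| = 1%N -> (1 < k)%N ->
  partial_weight S <= #|I|%:R * G1.
Proof.
move=> /eqP/cards1P[i ->] k1.
have [j ij] : exists j : 'I_k, i != j.
  have [e|e] := eqVneq (val i) 0%N.
    by exists (Ordinal k1); rewrite -val_eqE /= e.
  by exists (Ordinal (ltnW k1)); rewrite -val_eqE.
rewrite /partial_weight; under eq_bigr do rewrite big_set1.
exact: single_sum ij g0.
Qed.

Lemma partial_weight2 (S : {set 'I_k}) : #|S| = 2 -> partial_weight S <= G1 ^+ 2.
Proof.
move=> /eqP/cards2P[i [j [ij ->]]]; rewrite expr2.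
apply: le_trans (pair_sum ij g0 g0); apply: ler_sum => P _.
by rewrite big_setU1 ?inE//= big_set1.
Qed.

(** x y z <= x (y^2 + z^2) / 2 reduces three factors to pairs. *)
Lemma partial_weight3 (S : {set 'I_k}) : (2 < #|S|)%N -> partial_weight S <= G1 * G2.
Proof.
move=> /card_gt2P[i [j [l [[iS jS lS] [ij jl li]]]]].
have g2 x : 0 <= g x ^+ 2 by exact: sqr_ge0.
have h1 := pair_sum ij g0 g2; have h2 := pair_sum (i := i) (j := l) _ g0 g2.
have {}h2 := h2 ltac:(by rewrite eq_sym).
have : partial_weight S <= \sum_P (2^-1 * (g (pi_ i P) * g (pi_ j P) ^+ 2) +
    2^-1 * (g (pi_ i P) * g (pi_ l P) ^+ 2)).
  apply: ler_sum => P _; apply: le_trans (@prod_sub_le S [:: i; j; l] P _ _) _.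
  - by rewrite /= !inE negb_or ij jl eq_sym li.
  - by move=> x; rewrite !inE => /or3P[] /eqP ->.
  rewrite !big_cons big_nil mulr1 -!mulrDr.
  have := g0 (pi_ i P); have := sqr_ge0 (g (pi_ j P) - g (pi_ l P)).
  by move: (g _) (g _) (g _) => x y z h x0; nra.
by rewrite big_split -!mulr_sumr /= /G1 /G2; lra.
Qed.

Lemma card_gt3_uniq (S : {set 'I_k}) : (3 < #|S|)%N ->
  exists i j l m, uniq [:: i; j; l; m] /\ {subset [:: i; j; l; m] <= S}.
Proof.
move=> h; have := enum_uniq S; have sz := cardE S; have := mem_enum S.
case: (enum S) sz => [|i [|j [|l [|m s]]]] /= sz; rewrite ?sz// in h * => mem us.
exists i, j, l, m; split.
  by have := us; rewrite -[_ && _]/(uniq ([:: i; j; l; m] ++ s)) cat_uniq => /andP[].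
by move=> x hx; rewrite -mem !inE; move: hx; rewrite !inE => /or4P[] ->; rewrite ?orbT.
Qed.

Lemma partial_weight4 (S : {set 'I_k}) : (3 < #|S|)%N -> partial_weight S <= G2 ^+ 2.
Proof.
move=> /card_gt3_uniq[i [j [l [m [us sS]]]]].
have g2 x : 0 <= g x ^+ 2 by exact: sqr_ge0.
have ij : i != j by move: us; rewrite /= !inE !negb_or; case/and4P => /and3P[].
have lm : l != m by move: us; rewrite /= !inE !negb_or; case/and4P.
have h1 := pair_sum ij g2 g2; have h2 := pair_sum lm g2 g2.
have : partial_weight S <= \sum_P (2^-1 * (g (pi_ i P) ^+ 2 * g (pi_ j P) ^+ 2) +
    2^-1 * (g (pi_ l P) ^+ 2 * g (pi_ m P) ^+ 2)).
  apply: ler_sum => P _; apply: le_trans (@prod_sub_le S [:: i; j; l; m] P us sS) _.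
  rewrite !big_cons big_nil mulr1.
  have := sqr_ge0 (g (pi_ i P) * g (pi_ j P) - g (pi_ l P) * g (pi_ m P)).
  by move: (g _) (g _) (g _) (g _) => x y z t; lra.
by rewrite big_split -!mulr_sumr /= expr2 /G2; lra.
Qed.

Lemma weight_expand p : 0 <= p -> weight (fun x => p + g x) =
  \sum_(S : {set 'I_k}) p ^+ (k - #|S|) * partial_weight S.
Proof.
move=> p0; rewrite /weight; under eq_bigr => P _.
  have -> : \prod_(i < k) (p + g (pi_ i P)) = \sum_(S : {set 'I_k}) p ^+ (k - #|S|) * \prod_(i in S) g (pi_ i P).
    rewrite (eq_bigr (fun i => g (pi_ i P) + p)); last by move=> i _; rewrite addrC.
    rewrite bigA_distr; apply: eq_bigr => S _.
    rewrite (bigID [in S]) /= mulrC; congr (_ * _).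
      rewrite (eq_bigr (fun=> p)); last by move=> i /negbTE ->.
      rewrite prodr_const; congr (_ ^+ _).
      have := cardC S; rewrite card_ord => e; rewrite -[X in (X - _)%N]e addKn.
      by apply: eq_card => i; rewrite !inE.
    by apply: eq_bigr => i ->.
  over.
by rewrite exchange_big; apply: eq_bigr => S _; rewrite mulr_sumr.
Qed.

End expansion.
End weighted_counts.

Lemma card_powerset_type (T : finType) : #|{set T}| = (2 ^ #|T|)%N.
Proof.
transitivity #|powerset [set: T]|; last by rewrite card_powerset cardsT.
by apply: eq_card => A; rewrite !inE finset.subsetT.
Qed.

(** * Bounds for the expansion and for products with a small factor *)

Section bounds.
Variables (R : rcfType) (I J : finType) (k : nat) (pi_ : 'I_k -> J -> I).
Hypothesis pi_inj : forall i j, i != j -> injective (fun P => (pi_ i P, pi_ j P)).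
Hypothesis k3 : (3 <= k)%N.
Variable g : I -> R.
Hypothesis g01 : forall x, 0 <= g x <= 1.
Let g0 x : 0 <= g x. Proof. by case/andP: (g01 x). Qed.
Let g1 x : g x <= 1. Proof. by case/andP: (g01 x). Qed.
Local Notation G1 := (\sum_x g x).
Local Notation G2 := (\sum_x g x ^+ 2).

(** Proper nonempty subsets of size 1, 2, 3 and at least 4 give the four terms, the last by
    [p ^+ (k - #|S|) <= p]; each of the 2^k subsets is charged the whole bracket. A subset of size 3
    is proper only if [3 < k]. *)
Lemma weight_expand_le (p : R) : 0 < p -> p <= 1 ->
  weight pi_ (fun x => p + g x) <= p ^+ k * #|J|%:R + (2 ^ k)%:R *
    (p ^+ (k - 1) * (#|I|%:R * G1) + p ^+ (k - 2) * G1 ^+ 2 +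
     (3 < k)%:R * (p ^+ (k - 3) * (G1 * G2)) + p * G2 ^+ 2) + weight pi_ g.
Proof.
move=> p0 p1; rewrite weight_expand; last exact: ltW.
set E := (X in _ <= _ + (2 ^ k)%:R * X + _).
have G10 : 0 <= G1 by exact: G1_ge0.
have G20 : 0 <= G2 by exact: G2_ge0.
have pS n : 0 <= p ^+ n by apply: exprn_ge0; exact: ltW.
have p0' := ltW p0.
have e1 : 0 <= p ^+ (k - 1) * (#|I|%:R * G1) by rewrite !mulr_ge0.
have e2 : 0 <= p ^+ (k - 2) * G1 ^+ 2 by rewrite mulr_ge0 ?exprn_ge0.
have e3 : 0 <= (3 < k)%:R * (p ^+ (k - 3) * (G1 * G2)).
  by rewrite !mulr_ge0.
have e4 : 0 <= p * G2 ^+ 2 by rewrite mulr_ge0 ?exprn_ge0.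
have [E0 [E1 E2 E3 E4]] : 0 <= E /\ [/\ p ^+ (k - 1) * (#|I|%:R * G1) <= E,
    p ^+ (k - 2) * G1 ^+ 2 <= E, (3 < k)%:R * (p ^+ (k - 3) * (G1 * G2)) <= E
    & p * G2 ^+ 2 <= E].
  rewrite /E; move: e1 e2 e3 e4.
  move: (p ^+ (k - 1) * _) (p ^+ (k - 2) * _) ((3 < k)%:R * _) (p * G2 ^+ 2) => a1 a2 a3 a4.
  by move=> *; split; [|split]; lra.
have term (S : {set 'I_k}) : S != finset.set0 -> S != [set: 'I_k] ->
    p ^+ (k - #|S|) * partial_weight pi_ g S <= E.
  move=> S0 ST.
  have Sk : (#|S| < k)%N.
    by rewrite -[X in (_ < X)%N]card_ord -cardsT; apply: proper_card; rewrite finset.properT.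
  have Spos : (0 < #|S|)%N by rewrite card_gt0.
  case: (ltngtP #|S| 2) => S2.
  - have S1 : #|S| = 1%N by apply/eqP; rewrite eqn_leq Spos andbT -ltnS.
    have h := partial_weight1 pi_inj g01 S1 (ltnW k3).
    by apply: le_trans E1; rewrite S1; exact: ler_wpM2l.
  - have [S3|S3] := leqP #|S| 3.
      have e : #|S| = 3 by apply/eqP; rewrite eqn_leq S3 S2.
      have h := partial_weight3 pi_inj g01 S2.
      have k4 : (3 < k)%N by rewrite e in Sk.
      by apply: le_trans E3; rewrite e k4 mul1r; exact: ler_wpM2l.
    have h := partial_weight4 pi_inj g01 S3.
    have h2 : p ^+ (k - #|S|) <= p.
      rewrite -[X in _ <= X]expr1; by apply: ler_wiXn2l; rewrite // subn_gt0.
    have h3 : 0 <= partial_weight pi_ g S.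
      by apply: sumr_ge0 => P _; apply: prodr_ge0 => i _; exact: g0.
    by apply: le_trans E4; exact: ler_pM.
  - have h := partial_weight2 pi_inj g01 S2.
    by apply: le_trans E2; rewrite S2; exact: ler_wpM2l.
have T0 : [set: 'I_k] != finset.set0.
  by rewrite -card_gt0 cardsT card_ord; exact: leq_trans k3.
rewrite (bigD1 finset.set0)//= (bigD1 [set: 'I_k])//=.
have -> : partial_weight pi_ g finset.set0 = #|J|%:R.
  rewrite /partial_weight; under eq_bigr do rewrite big_set0.
  by rewrite sumr_const.
have -> : partial_weight pi_ g [set: 'I_k] = weight pi_ g.
  by apply: eq_bigr => P _; apply: eq_bigl => i; rewrite finset.in_setT.
rewrite cards0 subn0 cardsT card_ord subnn expr0 mul1r -addrA lerD2l addrC lerD2r.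
apply: (@le_trans _ _ (\sum_(S : {set 'I_k}) E)).
  rewrite [leRHS](bigID (fun S => (S != finset.set0) && (S != [set: 'I_k]))) /=.
  apply: ler_wpDr; first by apply: sumr_ge0.
  by apply: ler_sum => S /andP[]; exact: term.
by rewrite sumr_const card_powerset_type card_ord mulr_natl.
Qed.

Definition above (s : R) (x : I) : R := if s <= g x then g x else 0.
Definition below (s : R) (x : I) : R := if g x < s then g x else 0.

Lemma weight_above s : weight pi_ g <= weight pi_ (above s) +
  \sum_(j < k) \sum_P (g (pi_ j P) < s)%R%:R * \prod_(i < k) g (pi_ i P).
Proof.
rewrite exchange_big /weight -big_split; apply: ler_sum => P _ /=.
have pr0 : 0 <= \prod_(i < k) g (pi_ i P) by apply: prodr_ge0 => i _; exact: g0.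
have [/existsP[j hj]|] := boolP [exists j, g (pi_ j P) < s].
  apply: ler_wpDl.
    by apply: prodr_ge0 => i _; rewrite /above; case: ifP.
  rewrite [leRHS](bigD1 j)//= hj mul1r lerDl; apply: sumr_ge0 => i _.
  by rewrite mulr_ge0.
rewrite negb_exists => /forallP h; apply: ler_wpDr.
  by apply: sumr_ge0 => j _; rewrite mulr_ge0.
rewrite le_eqVlt; apply/orP; left; apply/eqP; apply: eq_bigr => i _.
by rewrite /above leNgt h.
Qed.

Lemma below_indicator s x y : (g x < s)%R%:R * (g x * y) = below s x * y.
Proof. by rewrite /below; case: ifP; rewrite ?mul1r ?mul0r. Qed.

(** x y z t <= (la x^2 y^2 + z^2 t^2 / la) / 2 with x the small value: only the first pair gains
    from smallness, and [la] shares the gain. *)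
Lemma small_part4 s (la : R) j : (3 < k)%N -> 0 < la ->
  \sum_P (g (pi_ j P) < s)%R%:R * \prod_(i < k) g (pi_ i P) <=
  2^-1 * (la * ((\sum_x below s x ^+ 2) * G2) + la^-1 * G2 ^+ 2).
Proof.
move=> k4 la0.
have : (2 < #|[set~ j]|)%N by rewrite cardsC1 card_ord; lia.
move=> /card_gt2P[i [l [m [[iS lS mS] [il lm mi]]]]].
rewrite !inE in iS lS mS.
have g2 x : 0 <= g x ^+ 2 by exact: sqr_ge0.
have b2 x : 0 <= below s x ^+ 2 by exact: sqr_ge0.
have h1 := pair_sum pi_inj (i := j) (j := i) ltac:(by rewrite eq_sym) b2 g2.
have h2 := pair_sum pi_inj lm g2 g2.
have : \sum_P (g (pi_ j P) < s)%R%:R * \prod_(i < k) g (pi_ i P) <=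
   \sum_P (2^-1 * la * (below s (pi_ j P) ^+ 2 * g (pi_ i P) ^+ 2) +
     2^-1 * la^-1 * (g (pi_ l P) ^+ 2 * g (pi_ m P) ^+ 2)).
  apply: ler_sum => P _.
  have h := @prod_sub_le _ _ _ _ pi_ g g01 [set: 'I_k] [:: j; i; l; m] P.
  have {}h := h ltac:(by rewrite /= !inE !negb_or ![j == _]eq_sym iS lS mS il lm (eq_sym i m) mi)
    ltac:(by move=> x; rewrite finset.in_setT).
  have e : \prod_(i in [set: 'I_k]) g (pi_ i P) = \prod_(i < k) g (pi_ i P).
    by apply: eq_bigl => x; rewrite finset.in_setT.
  rewrite e !big_cons big_nil mulr1 in h.
  apply: le_trans (ler_wpM2l (ler0n _ _) h) _.
  rewrite below_indicator.
  have := sqr_ge0 (la * (below s (pi_ j P) * g (pi_ i P)) - g (pi_ l P) * g (pi_ m P)).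
  move: (below s (pi_ j P)) (g (pi_ i P)) (g (pi_ l P)) (g (pi_ m P)) => x y z t hh.
  rewrite -(ler_pM2l la0).
  have -> : la * (2^-1 * la * (x ^+ 2 * y ^+ 2) + 2^-1 * la^-1 * (z ^+ 2 * t ^+ 2)) =
    2^-1 * (la ^+ 2 * (x ^+ 2 * y ^+ 2) + z ^+ 2 * t ^+ 2) by field; rewrite gt_eqF.
  by lra.
rewrite big_split -!mulr_sumr /=.
have h3 := ler_wpM2l (ltW la0) h1; have la1 : 0 <= la^-1 by rewrite invr_ge0 ltW.
have h4 := ler_wpM2l la1 h2; rewrite expr2; lra.
Qed.

(** A product of three values is to be bounded by products over pairs of the same total degree, so
    each value enters with exponent 3/2; below a cutoff the entropy does not control this power. *)
Definition pow32 (ka : R) (x : I) : R := if ka <= g x then g x * Num.sqrt (g x) else 0.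
Definition pow32_below (ka s : R) (x : I) : R :=
  if (ka <= g x) && (g x < s) then g x * Num.sqrt (g x) else 0.

Lemma pow32_ge0 ka x : 0 <= pow32 ka x.
Proof. by rewrite /pow32; case: ifP => // _; rewrite mulr_ge0 ?sqrtr_ge0. Qed.

Lemma pow32_below_ge0 ka s x : 0 <= pow32_below ka s x.
Proof. by rewrite /pow32_below; case: ifP => // _; rewrite mulr_ge0 ?sqrtr_ge0. Qed.

(* AM-GM for (mu u v)^3, (mu u w)^3 and (v w / mu^2)^3, where u, v, w are the
   square roots of x, y, z. *)
Lemma amgm_pow32 (mu x y z : R) : 0 < mu -> 0 <= x -> 0 <= y -> 0 <= z ->
  x * y * z <= 3^-1 * (mu ^+ 3 * (x * Num.sqrt x * (y * Num.sqrt y) + x * Num.sqrt x * (z * Num.sqrt z))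
     + mu ^- 6 * (y * Num.sqrt y * (z * Num.sqrt z))).
Proof.
move=> mu0 x0 y0 z0.
have ex := sqr_sqrtr x0; have ey := sqr_sqrtr y0; have ez := sqr_sqrtr z0.
have u0 := sqrtr_ge0 x; have v0 := sqrtr_ge0 y; have w0 := sqrtr_ge0 z.
set u := Num.sqrt x in ex u0 *; set v := Num.sqrt y in ey v0 *; set w := Num.sqrt z in ez w0 *.
rewrite -ex -ey -ez; set a := mu * u * v; set b := mu * u * w; set c := v * w / mu ^+ 2.
have a0 : 0 <= a by rewrite /a !mulr_ge0// ltW.
have b0 : 0 <= b by rewrite /b !mulr_ge0// ltW.
have c0 : 0 <= c by rewrite /c mulr_ge0 ?mulr_ge0// invr_ge0 exprn_ge0// ltW.
have -> : u ^+ 2 * v ^+ 2 * w ^+ 2 = a * b * c by rewrite /a /b /c; field; rewrite gt_eqF.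
have -> : mu ^+ 3 * (u ^+ 2 * u * (v ^+ 2 * v) + u ^+ 2 * u * (w ^+ 2 * w)) +
   mu ^- 6 * (v ^+ 2 * v * (w ^+ 2 * w)) = a ^+ 3 + b ^+ 3 + c ^+ 3.
  by rewrite /a /b /c; field; rewrite gt_eqF.
have : 0 <= (a + b + c) * ((a - b) ^+ 2 + (b - c) ^+ 2 + (a - c) ^+ 2).
  by rewrite mulr_ge0 ?addr_ge0 ?sqr_ge0.
have -> : (a + b + c) * ((a - b) ^+ 2 + (b - c) ^+ 2 + (a - c) ^+ 2) =
  2 * (a ^+ 3 + b ^+ 3 + c ^+ 3 - 3 * (a * b * c)) by ring.
by lra.
Qed.

(** If some value is below [ka], the product is at most [ka] times the other two. Otherwise AM-GM
    applies, [mu] weighing the two pairs with the small value against the third. *)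
Lemma small_part3 (s ka mu : R) j : k = 3 -> 0 < mu -> 0 <= ka ->
  \sum_P (g (pi_ j P) < s)%R%:R * \prod_(i < k) g (pi_ i P) <=
  3 * ka * G1 ^+ 2 +
  3^-1 * (2 * mu ^+ 3 * ((\sum_x pow32_below ka s x) * \sum_x pow32 ka x) +
    mu ^- 6 * (\sum_x pow32 ka x) ^+ 2).
Proof.
move=> k3' mu0 ka0.
have : #|[set~ j]| = 2 by rewrite cardsC1 card_ord k3'.
move=> /eqP/cards2P[i [l [il eS]]].
have iS : i != j by have : i \in [set~ j]; [rewrite eS !inE eqxx|rewrite !inE].
have lS : l != j by have : l \in [set~ j]; [rewrite eS !inE eqxx orbT|rewrite !inE].
have ji : j != i by rewrite eq_sym.
have jl : j != l by rewrite eq_sym.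
have p1 := pair_sum pi_inj il g0 g0.
have p2 := pair_sum pi_inj ji g0 g0.
have p3 := pair_sum pi_inj jl g0 g0.
have hb := pow32_below_ge0 ka s; have hh := pow32_ge0 ka.
have p4 := pair_sum pi_inj ji hb hh.
have p5 := pair_sum pi_inj jl hb hh.
have p6 := pair_sum pi_inj il hh hh.
have m3 : 0 <= mu ^+ 3 by rewrite exprn_ge0 ?ltW.
have m6 : 0 <= mu ^- 6 by rewrite invr_ge0 exprn_ge0 ?ltW.
have : \sum_P (g (pi_ j P) < s)%R%:R * \prod_(i < k) g (pi_ i P) <=
   \sum_P (ka * (g (pi_ i P) * g (pi_ l P)) + ka * (g (pi_ j P) * g (pi_ i P)) +
     ka * (g (pi_ j P) * g (pi_ l P)) +
     3^-1 * mu ^+ 3 * (pow32_below ka s (pi_ j P) * pow32 ka (pi_ i P)) +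
     3^-1 * mu ^+ 3 * (pow32_below ka s (pi_ j P) * pow32 ka (pi_ l P)) +
     3^-1 * mu ^- 6 * (pow32 ka (pi_ i P) * pow32 ka (pi_ l P))).
  apply: ler_sum => P _.
  have h := @prod_sub_le _ _ _ _ pi_ g g01 [set: 'I_k] [:: j; i; l] P.
  have {}h := h ltac:(by rewrite /= !inE !negb_or ji jl il)
    ltac:(by move=> x; rewrite finset.in_setT).
  have e : \prod_(i in [set: 'I_k]) g (pi_ i P) = \prod_(i < k) g (pi_ i P).
    by apply: eq_bigl => x; rewrite finset.in_setT.
  rewrite e !big_cons big_nil mulr1 in h.
  apply: le_trans (ler_wpM2l (ler0n _ _) h) _ => {h}.
  have am := amgm_pow32 mu0 (g0 (pi_ j P)) (g0 (pi_ i P)) (g0 (pi_ l P)).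
  have h1 := hb (pi_ j P); have h2 := hh (pi_ i P); have h3 := hh (pi_ l P).
  have x0 := g0 (pi_ j P); have y0 := g0 (pi_ i P); have z0 := g0 (pi_ l P).
  have t1 := mulr_ge0 ka0 (mulr_ge0 y0 z0); have t2 := mulr_ge0 ka0 (mulr_ge0 x0 y0).
  have t3 := mulr_ge0 ka0 (mulr_ge0 x0 z0).
  have t4 := mulr_ge0 m3 (mulr_ge0 h1 h2); have t5 := mulr_ge0 m3 (mulr_ge0 h1 h3).
  have t6 := mulr_ge0 m6 (mulr_ge0 h2 h3).
  have [xs|_] := ltP (g (pi_ j P)) s; last by rewrite mul0r; lra.
  rewrite mul1r; have [xk|xk] := ltP (g (pi_ j P)) ka.
    by have := ler_wpM2r (mulr_ge0 y0 z0) (ltW xk); lra.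
  have [yk|yk] := ltP (g (pi_ i P)) ka.
    by have := ler_wpM2r (mulr_ge0 x0 z0) (ltW yk); lra.
  have [zk|zk] := ltP (g (pi_ l P)) ka.
    by have := ler_wpM2r (mulr_ge0 x0 y0) (ltW zk); lra.
  move: am t4 t5 t6; rewrite /pow32_below /pow32 xk yk zk xs /=; lra.
rewrite !big_split -!mulr_sumr /= => hsum.
have q1 := ler_wpM2l ka0 p1; have q2 := ler_wpM2l ka0 p2; have q3 := ler_wpM2l ka0 p3.
have q4 := ler_wpM2l m3 p4; have q5 := ler_wpM2l m3 p5; have q6 := ler_wpM2l m6 p6.
by rewrite !expr2 in q6 *; apply: le_trans hsum _; lra.
Qed.

End bounds.

Lemma exprB_mul (R : pzSemiRingType) (x : R) m k : (m <= k)%N -> x ^+ (k - m) * x ^+ m = x ^+ k.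
Proof. by move=> mk; rewrite -exprD subnK. Qed.

(** * Moments of the perturbation under an entropy budget *)

Section moments.
Variables (R : realType) (I J : finType) (k : nat) (pi_ : 'I_k -> J -> I).
Hypothesis pi_inj : forall i j, i != j -> injective (fun P => (pi_ i P, pi_ j P)).
Hypothesis k3 : (3 <= k)%N.
Variables (g : I -> R) (r p L : R).
Hypotheses (r0 : 0 < r) (r1 : r <= 1 / 24) (pE : p = r ^+ 8) (LE : L = ln (1 / p)).
Hypotheses (g0 : forall x, 0 <= g x) (pg1 : forall x, p + g x <= 1).
Variables (B M0 : R).
Hypotheses (B0 : 0 < B) (M00 : 0 <= M0).
Local Notation cost := (\sum_x relent p (p + g x)).
Hypothesis cost_le : cost <= B * M0 * L.
Local Notation G1 := (\sum_x g x).
Local Notation G2 := (\sum_x g x ^+ 2).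
Local Notation n := (#|I|%:R : R).

Let L4 : 4 <= L. Proof. exact: (L_ge r0 r1 pE LE). Qed.
Let p01 : 0 < p < 1. Proof. exact: (p_lt1 r0 r1 pE). Qed.
Let L0 : 0 < L. Proof. by have := L4; lra. Qed.
Let p0 : 0 < p. Proof. by case/andP: p01. Qed.
Let g1 x : g x <= 1. Proof. by have := pg1 x; have := p0; lra. Qed.
Let g01 x : 0 <= g x <= 1. Proof. by rewrite g0 g1. Qed.
Let I0 x : 0 <= relent p (p + g x).
Proof. by apply: relent_ge0 => //; rewrite pg1 andbT addr_ge0// ltW. Qed.

Lemma sum_le_cost (F : I -> R) (c : R) : 0 <= c ->
  (forall x, F x * L <= c * relent p (p + g x)) -> \sum_x F x <= c * (B * M0).
Proof.
move=> c0 h; rewrite -(ler_pM2r L0) mulr_suml.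
apply: le_trans (ler_sum _ (fun x _ => h x)) _.
by rewrite -mulr_sumr -mulrA ler_wpM2l.
Qed.

Lemma moment2 : G2 <= 4 * (B * M0).
Proof.
apply: sum_le_cost => // x; rewrite -[4 in leRHS]mulr1.
by apply: (sqr_le_relent r0 r1 pE LE) => //; have := r1; lra.
Qed.

Lemma moment2_below s : 0 < s -> 12 * r <= s ->
  \sum_x below g s x ^+ 2 <= 4 * s * (B * M0).
Proof.
move=> s0 hs; have c0 : 0 <= 4 * s by rewrite mulr_ge0// ltW.
apply: sum_le_cost => // x; rewrite /below; case: ltP => h.
  by apply: (sqr_le_relent r0 r1 pE LE) => //; rewrite g0 ltW.
by rewrite expr0n mul0r mulr_ge0.
Qed.

Definition tiny (rho : R) : R := 9 / 4 * p ^+ 2 * L ^+ 2 / rho ^+ 2.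

Lemma moment32_below rho : 0 < rho -> 12 * r <= rho ->
  \sum_x pow32_below g (tiny rho) (rho ^+ 2) x <= 4 * rho * (B * M0).
Proof.
move=> s0 hs; have c0 : 0 <= 4 * rho by rewrite mulr_ge0// ltW.
apply: sum_le_cost => // x; rewrite /pow32_below; case: ifP => [/andP[h1 h2]|_].
  by apply: (pow32_le_relent r0 r1 pE LE) => //; rewrite g0 ltW.
by rewrite mul0r mulr_ge0.
Qed.

Lemma moment32 rho : 0 < rho -> rho <= 1 ->
  \sum_x pow32 g (tiny rho) x <= 4 * (B * M0).
Proof.
move=> s0 s1; apply: sum_le_cost => // x; rewrite /pow32; case: ifP => h; last first.
  by rewrite mul0r mulr_ge0.
rewrite -[4 in leRHS]mulr1; apply: (pow32_le_relent r0 r1 pE LE) => //.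
- by have := r1; lra.
- apply: le_trans h; rewrite /tiny expr1n divr1.
  have c94 : 0 <= 9 / 4 :> R by lra.
  have h0 : 0 <= 9 / 4 * p ^+ 2 * L ^+ 2 by exact: mulr_ge0 (mulr_ge0 c94 (sqr_ge0 _)) (sqr_ge0 _).
  rewrite ler_pdivlMr ?exprn_gt0// ler_piMr// expr2.
  by rewrite -[1]mulr1; apply: ler_pM => //; exact: ltW.
- by rewrite expr1n.
Qed.

(** Values up to p are summed by Cauchy-Schwarz with the quadratic entropy bound, larger ones by the
    linear bound; each part gets z / 2. *)
Lemma moment1 (z : R) : 0 <= z -> 6 * p * n * (B * M0 * L) <= (z / 2) ^+ 2 ->
  6 * (B * M0 * L) <= z / 2 -> G1 <= z.
Proof.
move=> z0 ha hb.
have -> : G1 = \sum_(x in [set x | g x <= p]) g x + \sum_(x in ~: [set x | g x <= p]) g x.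
  rewrite (bigID [in [set x | g x <= p]]) /=; congr (_ + _).
  by apply: eq_bigl => x; rewrite !inE.
have s1 : \sum_(x in [set x | g x <= p]) g x <= z / 2.
  have z2 : 0 <= z / 2 by rewrite divr_ge0.
  rewrite -(@ler_pXn2r _ 2)// ?nnegrE ?sumr_ge0//.
  apply: le_trans (sqr_sum_le _ _) _; apply: le_trans ha.
  apply: (@le_trans _ _ (n * (6 * p * cost))); last first.
    rewrite (_ : 6 * p * n * (B * M0 * L) = n * (6 * p * (B * M0 * L))); last by ring.
    by apply: ler_wpM2l => //; apply: ler_wpM2l => //; rewrite mulr_ge0// ltW.
  apply: ler_pM => //; first by apply: sumr_ge0 => x _; exact: sqr_ge0.
    by rewrite ler_nat max_card.
  rewrite mulr_sumr big_mkcond; apply: ler_sum => x _; rewrite inE; case: ifP => h.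
    by apply: (small_le_relent r0 r1 pE LE) => //; rewrite g0.
  by rewrite !mulr_ge0// ltW.
have s2 : \sum_(x in ~: [set x | g x <= p]) g x <= z / 2.
  apply: le_trans hb; apply: (@le_trans _ _ (6 * cost)); last by rewrite ler_wpM2l.
  rewrite mulr_sumr big_mkcond; apply: ler_sum => x _; rewrite !inE -ltNge; case: ifP => h.
    by apply: (large_le_relent r0 r1 pE LE) => //; exact: ltW.
  by rewrite mulr_ge0.
by lra.
Qed.

Variables (de De ga mu : R).
Hypotheses (de0 : 0 < de) (deDe : de <= De) (De1 : 1 <= De) (ga0 : 0 < ga) (ga1 : ga <= 1).
Hypothesis M0E : M0 ^+ 2 = de * p ^+ k * n ^+ 2.
Hypothesis G1_le : G1 <= ga * (de * p * n).
Hypotheses (mu1 : 1 <= mu) (rmu : 12 * r <= mu ^- 18).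
Let X := M0 ^+ 2.

Definition expansion_error : R := (2 ^ k)%:R * (ga + ga ^+ 2 * De + 4 * B * ga * De + 16 * B ^+ 2 * p).

Let n0 : 0 <= n. Proof. exact: ler0n. Qed.
Let G10 : 0 <= G1. Proof. exact: sumr_ge0. Qed.
Let G20 : 0 <= G2. Proof. by apply: sumr_ge0 => x _; exact: sqr_ge0. Qed.
Let pS m : 0 <= p ^+ m. Proof. by apply: exprn_ge0; exact: ltW. Qed.

Lemma expansion_bound :
  weight pi_ (fun x => p + g x) <= p ^+ k * #|J|%:R + expansion_error * X + weight pi_ g.
Proof.
have hG1 := G1_le; have hG2 := moment2.
have p1 : p <= 1 by case/andP: p01 => _ /ltW.
apply: le_trans (weight_expand_le pi_inj k3 g01 p0 p1) _.
rewrite lerD2r lerD2l /expansion_error -mulrA ler_wpM2l//.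
have k1 : p ^+ (k - 1) * p = p ^+ k by exact: (exprB_mul p (m := 1) (leq_trans _ k3)).
have k2 : p ^+ (k - 2) * p ^+ 2 = p ^+ k by exact: exprB_mul (ltnW k3).
have t1 : p ^+ (k - 1) * (n * G1) <= ga * X.
  have h := ler_wpM2l (mulr_ge0 (pS (k - 1)) n0) hG1.
  have -> : ga * X = p ^+ (k - 1) * n * (ga * (de * p * n)).
    by rewrite /X M0E -k1; ring.
  by rewrite mulrA.
have t2 : p ^+ (k - 2) * G1 ^+ 2 <= ga ^+ 2 * De * X.
  have h : G1 ^+ 2 <= (ga * (de * p * n)) ^+ 2.
    by rewrite ler_pXn2r ?nnegrE// (le_trans G10).
  apply: le_trans (ler_wpM2l (pS _) h) _.
  have -> : p ^+ (k - 2) * (ga * (de * p * n)) ^+ 2 = ga ^+ 2 * de * X.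
    by rewrite /X M0E -k2; ring.
  by rewrite ler_wpM2r ?sqr_ge0// ler_wpM2l ?sqr_ge0.
have t4 : p * G2 ^+ 2 <= 16 * B ^+ 2 * p * X.
  have h : G2 ^+ 2 <= (4 * (B * M0)) ^+ 2.
    by rewrite ler_pXn2r ?nnegrE// (le_trans G20).
  apply: le_trans (ler_wpM2l (ltW p0) h) _.
  by rewrite le_eqVlt; apply/orP; left; apply/eqP; rewrite /X; ring.
have D0 : 0 <= De by have := De1; lra.
have t3 : (3 < k)%:R * (p ^+ (k - 3) * (G1 * G2)) <= 4 * B * ga * De * X.
  have X0 : 0 <= X by exact: sqr_ge0.
  have [k4|_] := boolP (3 < k)%N; last first.
    by rewrite mul0r; exact: mulr_ge0 (mulr_ge0 (mulr_ge0 (mulr_ge0 (ler0n _ 4) (ltW B0)) (ltW ga0)) D0) X0.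
  rewrite mul1r.
  have h := ler_pM G10 G20 hG1 hG2; have h' := ler_wpM2l (pS (k - 3)) h.
  apply: le_trans h' _.
  have k3' : p ^+ (k - 3) * p = p ^+ (k - 2).
    by rewrite -exprSr; congr (_ ^+ _); rewrite -subSn ?subSS.
  have -> : p ^+ (k - 3) * (ga * (de * p * n) * (4 * (B * M0))) =
    4 * B * ga * (de * p ^+ (k - 2) * n * M0) by rewrite -k3'; ring.
  have b0 : 0 <= 4 * B * ga by exact: mulr_ge0 (mulr_ge0 (ler0n _ 4) (ltW B0)) (ltW ga0).
  rewrite -[leRHS]mulrA ler_wpM2l//.
  rewrite /X expr2 [leRHS]mulrA ler_wpM2r//.
  have d0 : 0 <= de * p ^+ (k - 2) * n by exact: mulr_ge0 (mulr_ge0 (ltW de0) (pS _)) n0.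
  have d1 : 0 <= De * M0 by exact: mulr_ge0.
  (* Squared, the claim reads de p^(k-4) M0^2 <= De^2 M0^2; this is where k >= 4 is used. *)
  rewrite -(@ler_pXn2r _ 2)// ?nnegrE//.
  have -> : (de * p ^+ (k - 2) * n) ^+ 2 = de * p ^+ (k - 4) * (de * p ^+ k * n ^+ 2).
    have -> : p ^+ k = p ^+ (k - 4) * p ^+ 4 by rewrite exprB_mul.
    have -> : p ^+ (k - 2) = p ^+ (k - 4) * p ^+ 2.
      by rewrite -(@exprB_mul _ p 2 (k - 2)) ?subnBA// ?leq_subRL ?(ltnW k3)//; case: (k) k4 => [|[|[|[|]]]].
    by ring.
  rewrite -M0E exprMn ler_wpM2r ?sqr_ge0//.
  apply: (@le_trans _ _ (De * 1)).
    by apply: ler_pM => //; [exact: ltW|exact: exprn_ile1 (ltW p0) p1].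
  by rewrite expr2 ler_wpM2l.
by apply: le_trans (lerD (lerD (lerD t1 t2) t3) t4) _; rewrite -!mulrDl.
Qed.

Definition small_error : R := 16 * mu ^- 6 * B ^+ 2 + 7 * ga ^+ 2 * mu ^+ 18 * De * r.
(** With rho = mu^-9 the square root of s, the AM-GM weights give mu^3 rho = mu^-6 for pairs with
    the small value and mu^-6 for the third pair: the exponent 18 balances them. *)
Let s := mu ^- 18.

Lemma small_bound j :
  \sum_P (g (pi_ j P) < s)%R%:R * \prod_(i < k) g (pi_ i P) <= small_error * X.
Proof.
have X0 : 0 <= X by exact: sqr_ge0.
have mu0 : 0 < mu by have := mu1; lra.
pose rho := mu ^- 9.
have rho0 : 0 < rho by rewrite invr_gt0 exprn_gt0.
have rho1 : rho <= 1 by rewrite invf_le1 ?exprn_gt0// exprn_ege1.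
have sE : s = rho ^+ 2 by rewrite /s /rho -exprVn -exprVn -exprM.
have rhomu : rho <= mu ^- 6.
  by rewrite lef_pV2 ?posrE ?exprn_gt0//; apply: ler_weXn2l.
have D0 : 0 <= De by have := De1; lra.
have err0 : 0 <= 7 * ga ^+ 2 * mu ^+ 18 * De * r.
  exact: mulr_ge0 (mulr_ge0 (mulr_ge0 (mulr_ge0 (ler0n _ 7) (sqr_ge0 _)) (exprn_ge0 _ (ltW mu0))) D0) (ltW r0).
have BM : 0 <= B * M0 by rewrite mulr_ge0 ?(ltW B0).
have srho : s <= rho by rewrite sE expr2 ler_piMr// ltW.
have H (x y : R) : 0 <= x -> x <= y * (B * M0) -> x ^+ 2 <= y ^+ 2 * B ^+ 2 * X.
  move=> x0 xy; rewrite -mulrA /X -!exprMn ler_pXn2r ?nnegrE//.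
  exact: le_trans xy.
have [k4|k4] := ltnP 3 k.
  (* The weight 1 / rho balances the two terms: s / rho = rho. *)
  apply: le_trans (small_part4 pi_inj k3 g01 s j k4 (_ : 0 < rho^-1)) _.
    by rewrite invr_gt0.
  have hb := moment2_below (lt_le_trans (mulr_gt0 (ltr0Sn _ _) r0) rmu) rmu.
  have bb0 : 0 <= \sum_x below g s x ^+ 2 by apply: sumr_ge0 => x _; exact: sqr_ge0.
  have h1 := ler_pM bb0 G20 hb moment2.
  have h2 := H _ _ G20 moment2.
  have r'0 : 0 <= rho^-1 by rewrite invr_ge0 ltW.
  have h3 := ler_wpM2l r'0 h1.
  have e1 : rho^-1 * (4 * s * (B * M0) * (4 * (B * M0))) = 16 * rho * B ^+ 2 * X.
    by rewrite sE /X; field; rewrite gt_eqF.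
  rewrite e1 in h3.
  have h4 : rho^-1^-1 * G2 ^+ 2 <= rho * (4 ^+ 2 * B ^+ 2 * X).
    by rewrite invrK ler_wpM2l// ltW.
  have h5 : 16 * rho * B ^+ 2 * X <= 16 * mu ^- 6 * B ^+ 2 * X.
    by rewrite ler_wpM2r// ler_wpM2r ?sqr_ge0// ler_pM2l.
  rewrite /small_error mulrDl; apply: ler_wpDr; first by rewrite mulr_ge0.
  apply: le_trans h5; move: h3 h4.
  have -> : rho * (4 ^+ 2 * B ^+ 2 * X) = 16 * rho * B ^+ 2 * X by ring.
  by move: (rho^-1 * _) (_ * G2 ^+ 2) (16 * rho * B ^+ 2 * X) => a b c; lra.
have k3e : k = 3 by apply/eqP; rewrite eqn_leq k4.
have t0 : 0 <= tiny rho.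
  have c94 : 0 <= 9 / 4 :> R by lra.
  exact: divr_ge0 (mulr_ge0 (mulr_ge0 c94 (sqr_ge0 _)) (sqr_ge0 _)) (sqr_ge0 _).
apply: le_trans (small_part3 pi_inj g01 s j k3e mu0 t0) _.
have rr : 12 * r <= rho by exact: le_trans srho.
have h1 := moment32_below rho0 rr; have h2 := moment32 rho0 rho1.
rewrite -sE in h1; set H1 := \sum_x pow32_below _ _ _ _ in h1 *.
set H2 := \sum_x pow32 _ _ _ in h2 *.
have H10 : 0 <= H1 by apply: sumr_ge0 => x _; exact: pow32_below_ge0.
have H20 : 0 <= H2 by apply: sumr_ge0 => x _; exact: pow32_ge0.
have h3 := ler_pM H10 H20 h1 h2; have h4 := H _ _ H20 h2.
have m3 : 0 <= mu ^+ 3 by rewrite exprn_ge0// ltW.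
have h5 := ler_wpM2l m3 h3.
have e1 : mu ^+ 3 * (4 * rho * (B * M0) * (4 * (B * M0))) = 16 * mu ^- 6 * B ^+ 2 * X.
  by rewrite /rho /X; field; rewrite gt_eqF.
rewrite e1 in h5.
have m6 : 0 <= mu ^- 6 by rewrite invr_ge0 exprn_ge0// ltW.
have h6 := ler_wpM2l m6 h4.
have e2 : mu ^- 6 * (4 ^+ 2 * B ^+ 2 * X) = 16 * mu ^- 6 * B ^+ 2 * X by ring.
rewrite e2 in h6.
have h7 : 3 * tiny rho * G1 ^+ 2 <= 7 * ga ^+ 2 * mu ^+ 18 * De * r * X.
  have g1z : G1 ^+ 2 <= (ga * (de * p * n)) ^+ 2.
    by rewrite ler_pXn2r ?nnegrE// (le_trans G10).
  apply: le_trans (ler_wpM2l (mulr_ge0 (ler0n _ 3) t0) g1z) _.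
  have -> : 3 * tiny rho * (ga * (de * p * n)) ^+ 2 =
      27 / 4 * (ga ^+ 2 * mu ^+ 18) * (de * (p * L ^+ 2) * X).
    rewrite /tiny /rho /X M0E k3e; field; rewrite gt_eqF//.
  have hL : p * L ^+ 2 <= r.
    have := rL_le r0 r1 pE LE => hrL.
    have -> : p * L ^+ 2 = r ^+ 6 * (r * L) ^+ 2 by rewrite pE; ring.
    have q1 : (r * L) ^+ 2 <= 8 ^+ 2.
      by rewrite ler_pXn2r ?nnegrE// mulr_ge0 ?ltW.
    apply: le_trans (ler_wpM2l (exprn_ge0 6 (ltW r0)) q1) _.
    have q2 : r ^+ 5 <= 64^-1.
      apply: (@le_trans _ _ (r ^+ 2)).
        apply: ler_wiXn2l => //; [exact: ltW|have := r1; lra].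
      by have := r0; have := r1; rewrite expr2; nra.
    by rewrite exprS -mulrA ler_piMr ?(ltW r0)//; lra.
  have q3 : de * (p * L ^+ 2) <= De * r.
    by apply: ler_pM => //; [exact: ltW|rewrite mulr_ge0 ?sqr_ge0// ltW].
  have q4 := ler_wpM2r X0 q3.
  have gm : 0 <= ga ^+ 2 * mu ^+ 18 by rewrite mulr_ge0 ?sqr_ge0// exprn_ge0// ltW.
  have q5 := ler_wpM2l gm q4.
  have q6 : 0 <= De * r * X by rewrite !mulr_ge0// ltW.
  have q7 := mulr_ge0 gm q6.
  by move: q5 q7; lra.
rewrite /small_error [leRHS]mulrDl [leRHS]addrC; apply: lerD => //.
by move: h5 h6; move: (mu ^- 6 * _) => z; lra.
Qed.

End moments.

Lemma pos_lower (R : realDomainType) (s : seq R) : all (fun y => 0 < y) s ->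
  exists2 x : R, 0 < x & forall y, y \in s -> x <= y.
Proof.
elim: s => [|y s IH] /=; first by exists 1.
case/andP => y0 /IH[x x0 hx]; exists (Num.min x y); first by rewrite lt_min x0.
by move=> z; rewrite inE => /orP[/eqP ->|/hx h]; rewrite ge_min ?lexx ?orbT// h.
Qed.

(** * Assembly of the lower bound *)

Section budget.
Variables (R : realType) (k : nat) (eps De c0 gaE : R).
Hypotheses (k3 : (3 <= k)%N) (eps0 : 0 < eps) (eps1 : eps <= 1 / 2) (De1 : 1 <= De).
Hypotheses (c00 : 0 < c0) (gaE0 : 0 < gaE).
Let q : R := k.-1%:R.
Let al := q^-1 + eps / (4 * q).
Let q0 : 0 < q. Proof. by rewrite ltr0n; lia. Qed.

(** If the cost were below (1 - 2 eps) M L, the mass W of the values above s would be at most (1 -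
    eps) M. The extremal bound then allows a weight of at most ((1 + eps/4)(1 - eps) + eps/4) M^2 /
    q, less than the (1 - eps/4) M^2 / q that remains to be supplied after the errors. *)
Lemma budget_implies_large (I J : finType) (pi_ : 'I_k -> J -> I)
    (g : I -> R) (r p L de ga mu M0 M : R) :
  (forall i j, i != j -> injective (fun P => (pi_ i P, pi_ j P))) ->
  0 < r -> r <= 1 / 24 -> p = r ^+ 8 -> L = ln (1 / p) ->
  (forall x, 0 <= g x) -> (forall x, p + g x <= 1) ->
  0 <= M0 -> 0 < M -> 0 < de -> de <= De -> 0 < ga -> ga <= 1 -> 1 <= mu ->
  12 * r <= mu ^- 18 ->
  M0 ^+ 2 = de * p ^+ k * #|I|%:R ^+ 2 -> M ^+ 2 = q * (de * p ^+ k * #|J|%:R) ->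
  c0 * #|I|%:R ^+ 2 <= #|J|%:R :> R ->
  6 * p * #|I|%:R * (q * M0 * L) <= (ga * (de * p * #|I|%:R) / 2) ^+ 2 ->
  6 * (q * M0 * L) <= ga * (de * p * #|I|%:R) / 2 ->
  expansion_error k p q De ga + k%:R * small_error r q De ga mu <= c0 * (eps / 4) ->
  1 - ln (mu ^- 18) <= eps * L ->
  2 * (q * M0) <= mu ^- 18 * (gaE * #|I|%:R) ->
  (al + 2) * M <= eps / (4 * q) * M ^+ 2 ->
  (forall A : {set I}, #|A|%:R <= gaE * #|I|%:R ->
     #|inside pi_ A|%:R <= al * #|A|%:R ^+ 2 + 2 * #|A|%:R) ->
  (1 + de) * p ^+ k * #|J|%:R <= weight pi_ (fun x => p + g x) ->
  \sum_x relent p (p + g x) <= q * M0 * L ->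
  (1 - 2 * eps) * (M * L) <= \sum_x relent p (p + g x).
Proof.
move=> inj r0 r1 pE LE g0 pg1 M00 Mpos de0 deDe ga0 ga1 mu1 rmu M0E ME hc0 ha hb herr hs hsupp hM ext hf hcost.
have L4 := L_ge r0 r1 pE LE.
have /andP[p0 p1] := p_lt1 r0 r1 pE.
have L0 : 0 < L by lra.
have n0 : 0 <= #|I|%:R :> R by exact: ler0n.
have z0 : 0 <= ga * (de * p * #|I|%:R).
  exact: mulr_ge0 (ltW ga0) (mulr_ge0 (mulr_ge0 (ltW de0) (ltW p0)) n0).
have hG1 := moment1 r0 r1 pE LE g0 pg1 hcost z0 ha hb.
have hexp := expansion_bound inj k3 r0 r1 pE LE g0 pg1 q0 M00 hcost de0 deDe De1 ga0 M0E hG1.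
have hsm := small_bound inj k3 r0 r1 pE LE g0 pg1 q0 M00 hcost de0 deDe De1 M0E hG1 mu1 rmu.
have g01 x : 0 <= g x <= 1 by rewrite g0; have := pg1 x; lra.
set s := mu ^- 18 in rmu hs hsupp hsm.
have mu0 : 0 < mu by lra.
have s0 : 0 < s by rewrite invr_gt0 exprn_gt0.
have habv := weight_above pi_ g01 s.
have hsum : \sum_(j < k) \sum_P (g (pi_ j P) < s)%R%:R * \prod_(i < k) g (pi_ i P) <=
    k%:R * small_error r q De ga mu * M0 ^+ 2.
  apply: le_trans (ler_sum _ (fun j _ => hsm j)) _.
  by rewrite sumr_const card_ord -[leLHS]mulr_natl mulrA.
set W := \sum_x above g s x.
have W0 : 0 <= W by apply: sumr_ge0 => x _; rewrite /above; case: ifP.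
have hW : (1 - eps) * (W * L) <= \sum_x relent p (p + g x).
  rewrite /W mulr_suml mulr_sumr; apply: ler_sum => x _; rewrite /above.
  case: ifP => h; first exact: (top_le_relent r0 r1 pE LE s0 hs h (pg1 x)).
  by rewrite mul0r mulr0; apply: relent_ge0; rewrite ?p0 ?p1// pg1 andbT addr_ge0// ltW.
have hW2 : W <= 2 * (q * M0).
  rewrite -(ler_pM2r L0); have := le_trans hW hcost.
  have : 2^-1 * (W * L) <= (1 - eps) * (W * L).
    by rewrite ler_wpM2r ?(mulr_ge0 W0 (ltW L0))//; have := eps1; lra.
  by move: (W * L) (q * M0) => w t; lra.
(* The extremal bound is for sparse sets only; each point of the support carries at least s, so W /
   s bounds its size. *)
have supp : #|[set x | above g s x != 0]|%:R <= gaE * #|I|%:R.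
  rewrite -(ler_pM2l s0); apply: le_trans hsupp; apply: le_trans hW2.
  rewrite -sum1_card natr_sum mulr_sumr big_mkcond; apply: ler_sum => x _.
  rewrite inE /above; have [h|h] := leP s (g x); last by rewrite eqxx.
  by case: ifP; rewrite ?mulr1.
have a01 x : 0 <= above g s x <= 1.
  by rewrite /above; case: ifP => _ //; rewrite lexx ler01.
have al0 : 0 <= al.
  by rewrite /al addr_ge0 ?invr_ge0 ?(ltW q0)// divr_ge0 ?(ltW eps0)// mulr_ge0// ltW.
have hext := weight_extremal al0 ext a01 supp.
rewrite -/W in hext.
rewrite leNgt; apply/negP => hlt.
have hWM : W <= (1 - eps) * M.
  have h := le_lt_trans hW hlt.
  have h2 : (1 - eps) * W < (1 - 2 * eps) * M.
    by rewrite -(ltr_pM2r L0) -!mulrA.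
  have e1 : 0 < 1 - eps by have := eps1; lra.
  rewrite -(ler_pM2l e1); apply: le_trans (ltW h2) _.
  by rewrite mulrA ler_pM2r//; have := sqr_ge0 eps; nra.
have hlow : (1 - eps / 4) * (M ^+ 2 / q) <= al * W ^+ 2 + (al + 2) * W.
  apply: le_trans hext.
  have -> : M ^+ 2 / q = de * p ^+ k * #|J|%:R by rewrite ME mulrC mulKf// gt_eqF.
  have hX : c0 * M0 ^+ 2 <= de * p ^+ k * #|J|%:R.
    rewrite M0E mulrCA ler_pM2l// mulr_gt0// exprn_gt0//.
  have hE : (expansion_error k p q De ga + k%:R * small_error r q De ga mu) * M0 ^+ 2
      <= eps / 4 * (de * p ^+ k * #|J|%:R).
    apply: le_trans (ler_wpM2r (sqr_ge0 M0) herr) _.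
    rewrite (_ : c0 * (eps / 4) * M0 ^+ 2 = eps / 4 * (c0 * M0 ^+ 2)); last by ring.
    by apply: ler_wpM2l hX; rewrite divr_ge0// ltW.
  have ef : (1 + de) * p ^+ k * #|J|%:R = p ^+ k * #|J|%:R + de * p ^+ k * #|J|%:R by ring.
  rewrite ef in hf; have := le_trans hf hexp; move: habv hsum hE; rewrite mulrDl.
  move: (weight pi_ g) (weight pi_ (above g s)) (\sum_(j < k) _) => w1 w2 w3.
  move: (expansion_error k p q De ga * M0 ^+ 2) (k%:R * small_error r q De ga mu * M0 ^+ 2) => e1 e2.
  by move: (p ^+ k * #|J|%:R) (de * p ^+ k * #|J|%:R) => x y; lra.
have e1 : 0 <= 1 - eps by have := eps1; lra.
have hW3 : W ^+ 2 <= ((1 - eps) * M) ^+ 2.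
  by rewrite ler_pXn2r ?nnegrE// (le_trans W0).
have hW4 : W ^+ 2 <= (1 - eps) * M ^+ 2.
  apply: le_trans hW3 _; rewrite exprMn ler_wpM2r ?sqr_ge0//.
  by rewrite expr2 ler_piMr//; have := eps0; lra.
have hW5 : (al + 2) * W <= (al + 2) * M.
  apply: ler_wpM2l; first by rewrite addr_ge0.
  by apply: le_trans hWM _; rewrite ler_piMl ?(ltW Mpos)//; have := eps0; lra.
have M2 : 0 < M ^+ 2 / q by rewrite divr_gt0// exprn_gt0.
have h6 := ler_wpM2l al0 hW4.
have e6 : al * ((1 - eps) * M ^+ 2) = (1 + eps / 4) * (1 - eps) * (M ^+ 2 / q).
  by rewrite /al; field; rewrite gt_eqF.
have e7 : eps / (4 * q) * M ^+ 2 = eps / 4 * (M ^+ 2 / q) by field; rewrite gt_eqF.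
rewrite e6 in h6; rewrite e7 in hM.
have h8 : (1 - eps / 4) * (M ^+ 2 / q) <=
   (1 + eps / 4) * (1 - eps) * (M ^+ 2 / q) + eps / 4 * (M ^+ 2 / q).
  by apply: le_trans hlow _; apply: lerD h6 _; apply: le_trans hW5 hM.
move: h8; rewrite -mulrDl ler_pM2r// => h8.
by have := eps0; have := sqr_ge0 eps; nra.
Qed.

End budget.

(** The constants are fixed in the order [mu], [ga], the bound [r0] on r = p^(1/8), and [eta]. The
    error c0 eps / 4 is split into four summands of c0 eps / 16. *)
Theorem abstract_lower_bound (R : realType) (k : nat) (eps De c0 gaE : R) :
  (3 <= k)%N -> 0 < eps -> eps <= 1 / 2 -> 1 <= De -> 0 < c0 -> 0 < gaE ->
  exists2 eta : R, 0 < eta & forall (I J : finType) (pi_ : 'I_k -> J -> I) (p de : R),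
  (forall i j, i != j -> injective (fun P => (pi_ i P, pi_ j P))) ->
  0 < p -> p <= eta -> 0 < de -> de <= De ->
  eta^-1 <= de * p ^+ k * #|I|%:R ^+ 2 ->
  p ^+ (k - 2) * ln (1 / p) ^+ 2 <= eta * de ^+ 3 ->
  c0 * #|I|%:R ^+ 2 <= #|J|%:R ->
  (forall A : {set I}, #|A|%:R <= gaE * #|I|%:R ->
     #|inside pi_ A|%:R <= (k.-1%:R^-1 + eps / (4 * k.-1%:R)) * #|A|%:R ^+ 2 + 2 * #|A|%:R) ->
  forall f : I -> R, (forall x, 0 <= f x <= 1) ->
    (1 + de) * p ^+ k * #|J|%:R <= weight pi_ f ->
    (1 - 2 * eps) * (Num.sqrt (k.-1%:R * (de * p ^+ k * #|J|%:R)) * ln (1 / p)) <=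
    \sum_x relent p (f x).
Proof.
move=> k3 eps0 eps1 De1 c00 gaE0.
set q : R := k.-1%:R; have q1 : 1 <= q by rewrite ler1n; lia.
have q0 : 0 < q by lra.
have kR : 0 < k%:R :> R by rewrite ltr0n; lia.
have De0 : 0 < De by lra.
have e2le : 1 - 2 * eps <= 1 by lra.
have i4 : 0 <= 4^-1 :> R by lra.
have i16 : 0 <= 16^-1 :> R by lra.
set al := q^-1 + eps / (4 * q).
have al0 : 0 < al by rewrite addr_gt0 ?invr_gt0// divr_gt0// mulr_gt0.
have [mn mn0 hmn] := nat_above (256 * k%:R * q ^+ 2 / (c0 * eps)).
pose mu : R := mn%:R; have mu1 : 1 <= mu by rewrite ler1n.
have mu0 : 0 < mu by lra.
have ce0 : 0 < c0 * eps by rewrite mulr_gt0.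
have k2 : 0 < (2 ^ k)%:R :> R by rewrite ltr0n expn_gt0.
have D1 : 0 < 1 + De + 4 * q * De by rewrite !addr_gt0// !mulr_gt0.
pose ga0 := c0 * eps / (16 * (2 ^ k)%:R * (1 + De + 4 * q * De)).
have ga0p : 0 < ga0 by apply: divr_gt0 => //; rewrite mulr_gt0// mulr_gt0.
have [|ga ga_gt0 hga] := @pos_lower R [:: 1; ga0]; first by rewrite /= ltr01 ga0p.
have ga1 : ga <= 1 by apply: hga; rewrite !inE eqxx.
have hga0 : ga <= ga0 by apply: hga; rewrite !inE eqxx orbT.
pose s := mu ^- 18; have s0 : 0 < s by rewrite invr_gt0 exprn_gt0.
(* Bounds imposed on r: [a1] and [a2] serve two error summands, [a3] serves [hs] through L = - 8 ln
   r, and [a4] the sparsity [hsupp]. *)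
pose a1 := c0 * eps / (16 * ((2 ^ k)%:R * (16 * q ^+ 2))).
pose a2 := c0 * eps / (16 * (k%:R * (7 * mu ^+ 18 * De))).
pose a3 := expR (- ((1 - ln s) / (8 * eps))).
pose a4 := s ^+ 2 * gaE ^+ 2 / (4 * q ^+ 2 * De).
have mu18 : 0 < mu ^+ 18 by rewrite exprn_gt0.
have q20 : 0 < q ^+ 2 by rewrite exprn_gt0.
have a1p : 0 < a1 by rewrite divr_gt0// mulr_gt0// mulr_gt0// mulr_gt0.
have a2p : 0 < a2 by rewrite divr_gt0// mulr_gt0// mulr_gt0// mulr_gt0// mulr_gt0.
have a3p : 0 < a3 by exact: expR_gt0.
have a4p : 0 < a4.
  by apply: divr_gt0; [rewrite mulr_gt0 ?exprn_gt0|rewrite mulr_gt0// mulr_gt0].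
have s12 : 0 < s / 12 by rewrite divr_gt0.
have c24 : 0 < 1 / 24 :> R by lra.
have [|r0 r00 hr0] := @pos_lower R [:: 1 / 24; s / 12; a1; a2; a3; a4].
  by rewrite /= c24 s12 a1p a2p a3p a4p.
pose T := (al + 2) * (4 * q / eps).
have T0 : 0 < T by apply: mulr_gt0; [rewrite addr_gt0|rewrite divr_gt0// mulr_gt0].
(* [b1] and [b2] are what [hb] and [ha] require once squared, with 144 = 36 times 4 and 576 = 36
   times 16; [b3] ensures [T <= M]. *)
pose b1 := ga ^+ 2 / (144 * q ^+ 2 * De ^+ 2).
pose b2 := ga ^+ 4 / (576 * q ^+ 2).
pose b3 := q * c0 / T ^+ 2.
have c576 : 0 < 576 * q ^+ 2 by rewrite pmulr_rgt0 ?ltr0n.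
have c144 : 0 < 144 * q ^+ 2 * De ^+ 2.
  by apply: mulr_gt0; [rewrite pmulr_rgt0 ?ltr0n|rewrite exprn_gt0].
have c144' : 0 < 144 * q ^+ 2 by rewrite pmulr_rgt0 ?ltr0n.
have b1p : 0 < b1 by apply: divr_gt0 => //; rewrite exprn_gt0.
have b2p : 0 < b2 by apply: divr_gt0 => //; rewrite exprn_gt0.
have b3p : 0 < b3 by apply: divr_gt0; [rewrite mulr_gt0|rewrite exprn_gt0].
have r08 : 0 < r0 ^+ 8 by rewrite exprn_gt0.
have [|eta eta0 heta] := @pos_lower R [:: r0 ^+ 8; b1; b2; b3].
  by rewrite /= r08 b1p b2p b3p.
exists eta => // I J pi_ p de inj p0 pe de0 deDe hX hL hJ ext f f01 hf.
set L := ln (1 / p) in hL *.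
pose r := Num.sqrt (Num.sqrt (Num.sqrt p)).
have r_gt0 : 0 < r by rewrite !sqrtr_gt0.
have pE : p = r ^+ 8.
  rewrite (_ : r ^+ 8 = ((r ^+ 2) ^+ 2) ^+ 2); last by ring.
  by rewrite !sqr_sqrtr ?sqrtr_ge0// ltW.
have rr0 : r <= r0.
  rewrite -(@ler_pXn2r _ 8)// ?nnegrE ?(ltW r_gt0) ?(ltW r00)// -pE.
  by apply: le_trans pe _; apply: heta; rewrite !inE eqxx.
have r24 : r <= 1 / 24 by apply: le_trans rr0 _; apply: hr0; rewrite !inE eqxx.
have rs : r <= s / 12 by apply: le_trans rr0 _; apply: hr0; rewrite !inE eqxx orbT.
have ra1 : r <= a1 by apply: le_trans rr0 _; apply: hr0; rewrite !inE eqxx !orbT.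
have ra2 : r <= a2 by apply: le_trans rr0 _; apply: hr0; rewrite !inE eqxx !orbT.
have ra3 : r <= a3 by apply: le_trans rr0 _; apply: hr0; rewrite !inE eqxx !orbT.
have ra4 : r <= a4 by apply: le_trans rr0 _; apply: hr0; rewrite !inE eqxx !orbT.
have eb1 : eta <= b1 by apply: heta; rewrite !inE eqxx !orbT.
have eb2 : eta <= b2 by apply: heta; rewrite !inE eqxx !orbT.
have eb3 : eta <= b3 by apply: heta; rewrite !inE eqxx !orbT.
have L4 := L_ge r_gt0 r24 pE (erefl L).
have /andP[_ p1] := p_lt1 r_gt0 r24 pE.
have L0 : 0 < L by apply: lt_le_trans L4; rewrite ltr0n.
have pr : p <= r.
  rewrite pE -[leRHS]expr1; apply: ler_wiXn2l => //; [exact: ltW|].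
  by apply: le_trans r24 _; rewrite ler_pdivrMr ?mul1r ?ler1n ?ltr0n.
set n : R := #|I|%:R in hX hJ ext *; have n0 : 0 <= n by exact: ler0n.
pose M0 := Num.sqrt (de * p ^+ k * n ^+ 2).
have X0 : 0 <= de * p ^+ k * n ^+ 2.
  by rewrite mulr_ge0 ?sqr_ge0// mulr_ge0 ?exprn_ge0// ltW.
have M00 : 0 <= M0 by exact: sqrtr_ge0.
have M0E : M0 ^+ 2 = de * p ^+ k * n ^+ 2 by rewrite sqr_sqrtr.
set MM := q * (de * p ^+ k * #|J|%:R).
have dp0 : 0 < de * p ^+ k by rewrite mulr_gt0// exprn_gt0.
have MM0 : q * c0 / eta <= MM.
  rewrite /MM -mulrA ler_pM2l//; apply: (@le_trans _ _ (c0 * (de * p ^+ k * n ^+ 2))).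
    by rewrite ler_pM2l.
  by rewrite mulrCA ler_pM2l.
have qce : 0 < q * c0 / eta by rewrite divr_gt0// mulr_gt0.
have MM1 : 0 < MM by apply: lt_le_trans MM0.
pose M := Num.sqrt MM; have M_gt0 : 0 < M by rewrite sqrtr_gt0.
have ME : M ^+ 2 = MM by rewrite sqr_sqrtr// ltW.
have Jn : #|J|%:R <= n ^+ 2.
  have h0 : (0 < k)%N by exact: leq_trans k3.
  have h1 : (1 < k)%N by exact: ltnW.
  rewrite -natrX ler_nat -mulnn -card_prod.
  by apply: (leq_card _ (inj (Ordinal h0) (Ordinal h1) _)).
have MM_le : M <= q * M0.
  rewrite -(@ler_pXn2r _ 2)// ?nnegrE ?(ltW M_gt0) ?mulr_ge0 ?(ltW q0)//.
  rewrite ME exprMn M0E /MM (_ : q ^+ 2 * _ = q * (q * (de * p ^+ k * n ^+ 2))); last by ring.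
  rewrite ler_pM2l//.
  apply: (@le_trans _ _ (1 * (de * p ^+ k * n ^+ 2))).
    by rewrite mul1r ler_pM2l.
  by rewrite ler_wpM2r.
pose g x := Num.max (f x) p - p.
have gE x : p + g x = Num.max (f x) p by rewrite /g addrC subrK.
have g0 x : 0 <= g x by rewrite subr_ge0 le_max lexx orbT.
have pg1 x : p + g x <= 1.
  by rewrite gE ge_max (ltW p1) andbT; case/andP: (f01 x).
have p01 : 0 < p < 1 by rewrite p0.
have cost_le : \sum_x relent p (p + g x) <= \sum_x relent p (f x).
  apply: ler_sum => x _; rewrite gE; case: (leP (f x) p) => h.
    by rewrite relent_same// relent_ge0.
  by [].
(* Above the crude budget the claim is immediate from M <= q M0; below it the moment bounds are
   available. *)
have [big|small] := leP (q * M0 * L) (\sum_x relent p (f x)).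
  apply: le_trans big; rewrite -/M.
  apply: (@le_trans _ _ (1 * (M * L))).
    by apply: ler_wpM2r e2le; rewrite mulr_ge0 ?(ltW M_gt0) ?(ltW L0).
  by rewrite mul1r ler_pM2r.
apply: (le_trans _ cost_le); rewrite -/M.
have de3 : 0 < de ^+ 3 by rewrite exprn_gt0.
have k2E : p ^+ (k - 2) * p ^+ 2 = p ^+ k by apply: exprB_mul; exact: ltnW.
(* Through this identity the hypothesis on p^(k-2) L^2 enters: [ha] uses the full power de^3, while
   [hb] has powers of de to spare and bounds them by De. *)
have sqM0L : (q * M0 * L) ^+ 2 = q ^+ 2 * de * p ^+ 2 * n ^+ 2 * (p ^+ (k - 2) * L ^+ 2).
  rewrite !exprMn M0E -k2E; ring.
have c_ge0 : 0 <= q ^+ 2 * de * p ^+ 2 * n ^+ 2.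
  by rewrite !mulr_ge0 ?sqr_ge0// ltW.
have hLq := ler_wpM2l c_ge0 hL.
rewrite -sqM0L in hLq.
have qML0 : 0 <= q * M0 * L by rewrite !mulr_ge0 ?(ltW q0) ?(ltW L0).
have z0 : 0 <= ga * (de * p * n) by rewrite !mulr_ge0 ?(ltW ga_gt0) ?(ltW de0) ?(ltW p0).
have hb : 6 * (q * M0 * L) <= ga * (de * p * n) / 2.
  have nn1 : 0 <= 6 * (q * M0 * L) by exact: mulr_ge0.
  have nn2 : 0 <= ga * (de * p * n) / 2 by exact: divr_ge0.
  rewrite -(@ler_pXn2r _ 2)// ?nnegrE//.
  rewrite exprMn; apply: le_trans (ler_wpM2l (sqr_ge0 6) hLq) _.
  have h : eta * (144 * q ^+ 2 * De ^+ 2) <= ga ^+ 2.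
    by move: eb1; rewrite ler_pdivlMr.
  have h2 : eta * (144 * q ^+ 2 * de ^+ 2) <= ga ^+ 2.
    apply: le_trans h; rewrite ler_pM2l// ler_pM2l//.
    by rewrite ler_pXn2r ?nnegrE// ltW.
  have h3 : 0 <= 4^-1 * (de ^+ 2 * p ^+ 2 * n ^+ 2).
    exact: mulr_ge0 i4 (mulr_ge0 (mulr_ge0 (sqr_ge0 _) (sqr_ge0 _)) (sqr_ge0 _)).
  have := ler_wpM2l h3 h2.
  rewrite (_ : 6 ^+ 2 * _ = 4^-1 * (de ^+ 2 * p ^+ 2 * n ^+ 2) * (eta * (144 * q ^+ 2 * de ^+ 2))); last by field.
  by have -> : (ga * (de * p * n) / 2) ^+ 2 = 4^-1 * (de ^+ 2 * p ^+ 2 * n ^+ 2) * ga ^+ 2 by field.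
have ha : 6 * p * n * (q * M0 * L) <= (ga * (de * p * n) / 2) ^+ 2.
  have h4 : 6 * (q * M0 * L) <= ga ^+ 2 / 4 * de ^+ 2 * p * n.
    have nn1 : 0 <= 6 * (q * M0 * L) by exact: mulr_ge0.
    have nn2 : 0 <= ga ^+ 2 / 4 * de ^+ 2 * p * n.
      exact: mulr_ge0 (mulr_ge0 (mulr_ge0 (mulr_ge0 (sqr_ge0 _) i4) (sqr_ge0 _)) (ltW p0)) n0.
    rewrite -(@ler_pXn2r _ 2)// ?nnegrE//.
    rewrite exprMn; apply: le_trans (ler_wpM2l (sqr_ge0 6) hLq) _.
    have h : eta * (576 * q ^+ 2) <= ga ^+ 4.
      by move: eb2; rewrite ler_pdivlMr.
    have h3 : 0 <= 16^-1 * (de ^+ 4 * p ^+ 2 * n ^+ 2).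
      exact: mulr_ge0 i16 (mulr_ge0 (mulr_ge0 (exprn_ge0 _ (ltW de0)) (sqr_ge0 _)) (sqr_ge0 _)).
    have := ler_wpM2l h3 h.
    rewrite (_ : 6 ^+ 2 * _ = 16^-1 * (de ^+ 4 * p ^+ 2 * n ^+ 2) * (eta * (576 * q ^+ 2))); last by field.
    by have -> : (ga ^+ 2 / 4 * de ^+ 2 * p * n) ^+ 2 = 16^-1 * (de ^+ 4 * p ^+ 2 * n ^+ 2) * ga ^+ 4 by field.
  have h5 := ler_wpM2l (mulr_ge0 (ltW p0) n0) h4.
  rewrite (_ : 6 * p * n * _ = p * n * (6 * (q * M0 * L))); last by ring.
  apply: le_trans h5 _.
  by rewrite le_eqVlt; apply/orP; left; apply/eqP; field.
have rmu : 12 * r <= mu ^- 18 by rewrite -/s; clear -rs; lra.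
have herr : expansion_error k p q De ga + k%:R * small_error r q De ga mu <= c0 * (eps / 4).
  have ga2 : ga ^+ 2 <= ga by rewrite expr2 ler_piMr// ltW.
  have e1 : (2 ^ k)%:R * (ga * (1 + De + 4 * q * De)) <= c0 * eps / 16.
    move: hga0; rewrite /ga0 ler_pdivlMr ?mulr_gt0// => h; clear -h; lra.
  have e2 : (2 ^ k)%:R * (16 * q ^+ 2) * r <= c0 * eps / 16.
    move: ra1; rewrite /a1 ler_pdivlMr ?mulr_gt0 ?exprn_gt0// => h; clear -h; lra.
  have e3 : k%:R * (7 * mu ^+ 18 * De) * r <= c0 * eps / 16.
    move: ra2; rewrite /a2 ler_pdivlMr ?mulr_gt0 ?exprn_gt0// => h; clear -h; lra.
  have e4 : k%:R * (16 * mu ^- 6 * q ^+ 2) <= c0 * eps / 16.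
    have h : 256 * k%:R * q ^+ 2 <= mu * (c0 * eps) by move: hmn; rewrite ler_pdivrMr.
    have h2 : mu <= mu ^+ 6 by rewrite -[leLHS]expr1; apply: ler_weXn2l.
    have h3 := ler_wpM2r (ltW ce0) h2.
    have m6 : 0 < mu ^+ 6 by rewrite exprn_gt0.
    rewrite (_ : k%:R * (16 * mu ^- 6 * q ^+ 2) = 16 * k%:R * q ^+ 2 / mu ^+ 6); last by field; rewrite gt_eqF.
    rewrite ler_pdivrMr//; clear -h h3; lra.
  have e5 : expansion_error k p q De ga <=
      (2 ^ k)%:R * (ga * (1 + De + 4 * q * De)) + (2 ^ k)%:R * (16 * q ^+ 2) * r.
    rewrite /expansion_error (_ : _ + (2 ^ k)%:R * (16 * q ^+ 2) * r = (2 ^ k)%:R * (ga * (1 + De + 4 * q * De) + 16 * q ^+ 2 * r)); last by ring.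
    rewrite ler_pM2l//.
    have t1 : ga ^+ 2 * De <= ga * De by rewrite ler_pM2r.
    have t2 : 16 * q ^+ 2 * p <= 16 * q ^+ 2 * r by rewrite ler_pM2l ?mulr_gt0 ?exprn_gt0.
    by clear -t1 t2; lra.
  have e6 : k%:R * small_error r q De ga mu <=
      k%:R * (16 * mu ^- 6 * q ^+ 2) + k%:R * (7 * mu ^+ 18 * De) * r.
    rewrite /small_error mulrDr lerD2l -[leRHS]mulrA ler_pM2l//.
    have g21 : ga ^+ 2 <= 1 by apply: le_trans ga2 ga1.
    have t0 : 0 <= 7 * mu ^+ 18 * De * r by rewrite !mulr_ge0 ?(ltW De0) ?(ltW r_gt0)// exprn_ge0// ltW.
    by have := ler_wpM2r t0 g21; clear => h; lra.
  by move: e1 e2 e3 e4 e5 e6; clear => *; lra.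
have hs : 1 - ln (mu ^- 18) <= eps * L.
  rewrite -/s (L_lnr r_gt0 pE (erefl L)).
  have : ln r <= - ((1 - ln s) / (8 * eps)).
    by rewrite -[leRHS]expRK ler_ln ?posrE ?expR_gt0.
  rewrite lerNr ler_pdivrMr ?mulr_gt0//; clear => h; lra.
have hsupp : 2 * (q * M0) <= mu ^- 18 * (gaE * n).
  have nn1 : 0 <= 2 * (q * M0) by exact: mulr_ge0 (ler0n _ 2) (mulr_ge0 (ltW q0) M00).
  have nn2 : 0 <= s * (gaE * n) by exact: mulr_ge0 (ltW s0) (mulr_ge0 (ltW gaE0) n0).
  rewrite -/s -(@ler_pXn2r _ 2)// ?nnegrE//.
  have h : r * (4 * q ^+ 2 * De) <= s ^+ 2 * gaE ^+ 2.
    by move: ra4; rewrite ler_pdivlMr// !mulr_gt0 ?exprn_gt0.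
  have h1 : de * p ^+ k <= De * r.
    apply: ler_pM => //; rewrite ?exprn_ge0 ?(ltW de0) ?(ltW p0)//.
    apply: le_trans pr; rewrite -[leRHS]expr1; apply: ler_wiXn2l; [exact: ltW|exact: ltW|exact: leq_trans k3].
  rewrite !exprMn M0E.
  have h2 := ler_wpM2r (sqr_ge0 n) h1.
  have h3 : 0 <= 4 * q ^+ 2 by rewrite mulr_ge0 ?sqr_ge0.
  have h4 := ler_wpM2l h3 h2; have h5 := ler_wpM2r (sqr_ge0 n) h.
  by rewrite (_ : 2 ^+ 2 = 4); [clear -h4 h5; lra|ring].
have hM : (al + 2) * M <= eps / (4 * q) * M ^+ 2.
  have TM : T <= M.
    rewrite -(@ler_pXn2r _ 2)// ?nnegrE ?(ltW T0) ?(ltW M_gt0)// ME.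
    apply: le_trans MM0; rewrite ler_pdivlMr//.
    by move: eb3; rewrite ler_pdivlMr ?exprn_gt0// mulrC.
  rewrite (_ : (al + 2) * M = eps / (4 * q) * (T * M)); last first.
    by rewrite /T; field; rewrite !gt_eqF.
  by rewrite ler_pM2l ?divr_gt0 ?mulr_gt0// expr2 ler_pM2r.
have hf2 : (1 + de) * p ^+ k * #|J|%:R <= weight pi_ (fun x => p + g x).
  apply: le_trans hf _; apply: ler_sum => P _; apply: ler_prod => i _.
  by rewrite gE le_max lexx; case/andP: (f01 (pi_ i P)) => ->.
have cost2 : \sum_x relent p (p + g x) <= q * M0 * L by apply: le_trans cost_le (ltW small).
exact: (budget_implies_large k3 eps0 eps1 De1 c00 gaE0 inj r_gt0 r24 pE (erefl L) g0 pg1 M00 M_gt0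
  de0 deDe ga_gt0 ga1 mu1 rmu M0E ME hJ ha hb herr hs hsupp hM ext hf2 cost2).
Qed.

(** * Progressions in [N] and in Z/NZ *)

Section PointConfigurations.
Local Open Scope classical_set_scope.
Variables (G : zmodType) (k : nat) (Om : {fset G}).
Hypothesis k2 : (1 < k)%N.

Lemma finite_progressions : finite_set (progressions k [set` Om]).
Proof.
apply: (@sub_finite_set _ _ ((fun xy : G * G => (xy.1, xy.2 - xy.1)) @` ([set` Om] `*` [set` Om]))); last first.
  by apply: finite_image; apply: finite_setX.
move=> [a b] /= h; exists (a, a + b) => /=; last by rewrite addrAC subrr add0r.
by have := h 0%N (ltnW k2); have := h 1%N k2; rewrite /= mulr0n mulr1n addr0.
Qed.

Definition aps : {fset G * G} := fset_set (progressions k [set` Om]).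

Lemma apsP ab : reflect (forall i, (i < k)%N -> ab.1 + ab.2 *+ i \in Om) (ab \in aps).
Proof. by rewrite in_fset_set ?inE; [exact: asboolP|exact: finite_progressions]. Qed.

Lemma point_proof (i : 'I_k) (P : aps) : (val P).1 + (val P).2 *+ i \in Om.
Proof. by case: P => ab /= /apsP; exact. Qed.

Definition point (i : 'I_k) (P : aps) : Om := [` point_proof i P]%fset.

Lemma Tset_aps : Tset k [set` Om] = #|{: aps}|.
Proof. by rewrite /Tset -cardfE. Qed.

Lemma Tfun_aps (R : realType) (f : G -> R) :
  Tfun k [set` Om] f = weight point (fun x => f (val x)).
Proof.
rewrite /Tfun fsbig_finite /=; last exact: finite_progressions.
exact: big_seq_fsetE.
Qed.

Lemma fsum_fset (R : realType) (F : G -> R) :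
  \sum_(a \in [set` Om]) F a = \sum_(x : Om) F (val x).
Proof. by rewrite fsbig_finite//= set_fsetK big_seq_fsetE. Qed.

Hypothesis torsionfree : forall (b : G) d, (0 < d < k)%N -> b *+ d = 0 -> b = 0.

Lemma point_inj (i j : 'I_k) : i != j -> injective (fun P => (point i P, point j P)).
Proof.
move=> ij [[a b] ab] [[a' b'] ab'] [e1 e2]; apply: val_inj => /=.
have key : forall d e : nat, (d < e)%N -> (e < k)%N ->
    a + b *+ d = a' + b' *+ d -> a + b *+ e = a' + b' *+ e -> (a, b) = (a', b').
  move=> d e de ek h1 h2.
  have bb : b = b'.
    apply/eqP; rewrite -subr_eq0; apply/eqP; apply: (torsionfree (d := (e - d)%N)).
      by rewrite subn_gt0 de (leq_ltn_trans (leq_subr _ _)).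
    rewrite mulrnBl !mulrnBr ?(ltnW de)//.
    apply/eqP; rewrite subr_eq0 -(inj_eq (addrI (a + b *+ d))) {2}h1.
    rewrite -!addrA [_ *+ d + (_ - _)]addrC [b' *+ d + (_ - _)]addrC !subrK; exact/eqP.
  by move: h1; rewrite bb => /addIr ->.
have /orP[h|h] : (i < j)%N || (j < i)%N by rewrite -neq_ltn.
  exact: key h (ltn_ord j) e1 e2.
exact: key h (ltn_ord i) e2 e1.
Qed.

Lemma card_aps_le : (#|{: aps}| <= #|{: Om}| ^ 2)%N.
Proof.
rewrite -mulnn -card_prod; apply: (leq_card (fun P => (point (Ordinal (ltnW k2)) P, point (Ordinal k2) P))).
exact: point_inj.
Qed.

(** Progressions stay distinct because their first two points lie in [Om]; the integers do not embed
    in a cyclic group, so injectivity is asked on [Om] only. *)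
Lemma card_inside_image M (psi : G -> 'Z_M) (A : {set Om}) :
  {morph psi : x y / x + y} -> {in Om &, injective psi} ->
  (#|inside point A| <= #|apset k [set psi (val x) | x in A]|)%N.
Proof.
move=> psiD psi_inj.
have psi0 : psi 0 = 0 by apply: (addrI (psi 0)); rewrite -psiD !addr0.
have psiM b i : psi (b *+ i) = psi b *+ i.
  by elim: i => [|i IH]; rewrite ?mulr0n// !mulrS psiD IH.
pose F (P : aps) := (psi (val P).1, psi (val P).2).
rewrite -(card_in_imset (f := F)); last first.
  move=> P P' _ _ [] e1 e2; apply: (point_inj (i := Ordinal (ltnW k2)) (j := Ordinal k2)) => //.
  congr (_, _); apply: val_inj; apply: psi_inj; rewrite ?(valP (point _ _)) //= !psiD !psiM.
    by rewrite e1 !mulr0n.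
  by rewrite e1 e2.
apply: subset_leq_card; apply/fintype.subsetP => _ /imsetP[P hP ->].
have {}hP : forall i, point i P \in A by move: hP; rewrite inE => /forallP.
apply/apsetP => i ik.
apply/imsetP; exists (point (Ordinal ik) P); first exact: hP.
by rewrite /= psiD psiM.
Qed.

End PointConfigurations.

(** Up to the shift by 1, q steps lead from q X + r to q j + r, again in the interval, and the other
    points lie in between. So every start has [m %/ q] steps. *)
Lemma interval_progression (q m x j i : nat) : (0 < q)%N -> (x < m)%N -> (j < m %/ q)%N ->
  (i <= q)%N -> 1 <= x.+1%:Z + (j%:Z - (x %/ q)%:Z) *+ i <= m%:Z.
Proof.
move=> q0 xm jm iq.
have ex := divn_eq x q; have rx := ltn_pmod x q0.
have em := leq_divM m q.
set X := (x %/ q)%N in ex *; set r := (x %% q)%N in ex rx; set K := (m %/ q)%N in jm em.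
have h1 : (j.+1 * q <= m)%N by apply: leq_trans em; rewrite leq_mul2r jm orbT.
rewrite -mulr_natr; clearbody X r K.
have hXi : (X * i <= X * q)%N by rewrite leq_mul2l iq orbT.
have [jX|jX] := leqP j X.
  have h : (j * i <= X * i)%N by rewrite leq_mul2r jX orbT.
  by move: xm ex h hXi rx; clear; lia.
have h : ((j - X) * i <= (j - X) * q)%N by rewrite leq_mul2l iq orbT.
have h' : (X * q <= j * q)%N by rewrite leq_mul2r (ltnW jX) orbT.
have h3 : (X * i <= j * i)%N by rewrite leq_mul2r (ltnW jX) orbT.
move: h; rewrite !mulnBl; move: h1 h3 xm ex h' hXi rx; rewrite mulSn; clear; lia.
Qed.

(** * Intervals with many progressions *)

Section IntervalModel.
Variables (G : zmodType) (k N : nat) (e : int -> G).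
Hypothesis k2 : (1 < k)%N.
Hypothesis eD : {morph e : x y / x + y}.
Hypothesis e_inj : forall x y : int, 1 <= x <= N%:Z -> 1 <= y <= N%:Z -> e x = e y -> x = y.

(** A common model of both domains: 1, ..., N under the identity, or under reduction modulo N. *)
Definition interval_image : {fset G} := [fset e (nat_of_ord z).+1%:Z | z in 'I_N]%fset.
Local Notation Om := interval_image.

Lemma mem_interval_image (x : int) : 1 <= x <= N%:Z -> e x \in Om.
Proof.
move=> hx; case: x hx => // -[//|n] hx.
have nN : (n < N)%N by move: hx; clear; lia.
by apply/imfsetP; exists (Ordinal nN).
Qed.

Lemma card_interval_image : #|{: Om}| = N.
Proof.
rewrite -cardfE card_imfset /= ?size_enum_ord//.
move=> x y /e_inj h; apply: val_inj; move: (ltn_ord x) (ltn_ord y) => hx hy /=.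
by have /eqP : x.+1%:Z = y.+1%:Z by [apply: h; move: hx hy; clear; lia]; rewrite eqz_nat eqSS => /eqP.
Qed.

Lemma interval_progressions m : (m <= N)%N ->
  exists2 S : {set Om}, (#|S| <= m)%N & (m * (m %/ k.-1) <= #|inside (@point G k Om k2) S|)%N.
Proof.
move=> mN.
have q0 : (0 < k.-1)%N by lia.
have e0 : e 0 = 0 by apply: (addrI (e 0)); rewrite -eD !addr0.
have eM b i : e (b *+ i) = e b *+ i.
  by elim: i => [|i IH]; rewrite ?mulr0n// !mulrS eD IH.
have memS (z : 'I_m) : e z.+1%:Z \in Om.
  by apply: mem_interval_image; have := ltn_ord z; lia.
pose S : {set Om} := [set [` memS z]%fset | z : 'I_m].
exists S; first by rewrite (leq_trans (leq_imset_card _ _))// card_ord.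
pose b (x : 'I_m) (j : 'I_(m %/ k.-1)) : int := j%:Z - (x %/ k.-1)%:Z.
have bP (x : 'I_m) (j : 'I_(m %/ k.-1)) i : (i < k)%N -> 1 <= x.+1%:Z + b x j *+ i <= m%:Z.
  by move=> ik; apply: interval_progression => //; lia.
have memP (x : 'I_m) (j : 'I_(m %/ k.-1)) : (e x.+1%:Z, e (b x j)) \in aps k Om.
  apply/(apsP _ k2) => i ik /=; rewrite -eM -eD; apply: mem_interval_image.
  by have := bP x j i ik; lia.
pose F (u : 'I_m * 'I_(m %/ k.-1)) : aps k Om := [` memP u.1 u.2]%fset.
have Finj : injective F.
  move=> [x j] [x' j'] /(congr1 val) [] /= e1 e2.
  have xx : x = x'.
    apply: val_inj => /=; move: (ltn_ord x) (ltn_ord x') => hx hx'.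
    have /eqP : x.+1%:Z = x'.+1%:Z by apply: e_inj => //; lia.
    by rewrite eqz_nat eqSS => /eqP.
  rewrite -xx in e2 *; congr pair; apply: val_inj => /=.
  have h1 := bP x j 1%N k2; have h2 := bP x j' 1%N k2.
  have : x.+1%:Z + b x j = x.+1%:Z + b x j'.
    move: h1 h2; rewrite !mulr1n => h1 h2.
    apply: e_inj; last by rewrite (eD _ (b x j)) (eD _ (b x j')) e2.
      by move: h1 mN; clear; lia.
    by move: h2 mN; clear; lia.
  by rewrite /b; clear; lia.
have <- : #|[set: 'I_m * 'I_(m %/ k.-1)]| = (m * (m %/ k.-1))%N by rewrite cardsT card_prod !card_ord.
rewrite -(card_imset _ Finj); apply: subset_leq_card; apply/fintype.subsetP => _ /imsetP[[x j] _ ->].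
rewrite inE; apply/forallP => i; apply/imsetP.
have /andP[h1 h2] := bP x j i (ltn_ord i).
have [n nE nm] : exists2 n : nat, x.+1%:Z + b x j *+ i = n.+1%:Z & (n < m)%N.
  by exists (absz (x.+1%:Z + b x j *+ i - 1)%R); move: h1 h2; clear; lia.
by exists (Ordinal nm) => //; apply: val_inj => /=; rewrite -eM -eD nE.
Qed.

End IntervalModel.

Lemma Zp_intr_inj M N (x y : int) : (1 < M)%N -> (N <= M)%N ->
  1 <= x <= N%:Z -> 1 <= y <= N%:Z -> x%:~R = y%:~R :> 'Z_M -> x = y.
Proof.
move=> M1 NM; case: x => // -[|n]; case: y => // -[|n'] //= hx hy.
rewrite -!pmulrn => /(congr1 val); rewrite /= !val_Zp_nat// => /eqP.
rewrite -(addn1 n) -(addn1 n') eqn_modDr !modn_small; [by move=> /eqP ->|lia|lia].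
Qed.

Section Domains.
Local Open Scope classical_set_scope.
Variables (k : nat).

Definition domain_map (D : domain) (N : nat) : int -> ambient D N :=
  match D return int -> ambient D N with
  | Defs.Interval => fun x => x
  | Cyclic => fun x => x%:~R
  end.

Lemma domain_mapD D N : {morph @domain_map D N : x y / x + y}.
Proof. by case: D => //= x y; rewrite rmorphD. Qed.

Lemma domain_map_inj D N (x y : int) : admissible D N ->
  1 <= x <= N%:Z -> 1 <= y <= N%:Z -> @domain_map D N x = @domain_map D N y -> x = y.
Proof.
case: D => //= pN; apply: Zp_intr_inj => //; exact: prime_gt1.
Qed.

Lemma domain_image D N : admissible D N ->
  [set` interval_image N (@domain_map D N)] = @Omega D N.
Proof.
move=> aN; apply/seteqP; split => x /=.
  case/imfsetP => /= z _ ->; case: D aN x => //= _ _; have := ltn_ord z; lia.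
case: D aN x => /= [_ x hx|pN x _]; first exact: (mem_interval_image (@domain_map Defs.Interval N)).
have N1 := prime_gt1 pN.
(* The residue 0 is represented by N, as the interval starts at 1. *)
pose n := if val x == 0%N then N else val x.
have xn : x = n%:R.
  apply: val_inj; rewrite /= val_Zp_nat// /n.
  have xN : (val x < N)%N by have := ltn_ord x; rewrite [X in (_ < X)%N]Zp_cast.
  by have [->|_] := eqVneq (val x) 0%N; rewrite ?modnn// modn_small.
rewrite xn pmulrn; apply: mem_interval_image.
have xN : (val x < N)%N by have := ltn_ord x; rewrite [X in (_ < X)%N]Zp_cast.
by rewrite /n; have [e0|e0] := eqVneq (val x) 0%N; move: xN e0 N1; clear; lia.
Qed.

Lemma domain_torsionfree D N : admissible D N -> (k <= N)%N ->
  forall (b : ambient D N) d, (0 < d < k)%N -> b *+ d = 0 -> b = 0.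
Proof.
case: D => /= [_ _ b d /andP[d0 _] /eqP|pN kN b d /andP[d0 dk] /eqP].
  by rewrite mulrn_eq0 (gtn_eqF d0) => /eqP.
by rewrite Zp_mulrn_eq0// ?d0 ?(leq_trans dk)// => /eqP.
Qed.

(** Any prime above N will do for the interval: the image may acquire progressions by wrapping
    around, which does not harm an upper bound. *)
Lemma domain_embedding D N : admissible D N ->
  exists M (psi : ambient D N -> 'Z_M), [/\ prime M, (N <= M)%N, {morph psi : x y / x + y} &
    {in interval_image N (@domain_map D N) &, injective psi}].
Proof.
case: D => /= [_|pN]; last by exists N, id; split.
have [M NM pM] := prime_above N.
exists M, (fun x => x%:~R); split; [exact: pM|exact: ltnW|by move=> x y; rewrite rmorphD|].
move=> _ _ /imfsetP[x _ ->] /imfsetP[y _ ->].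
apply: (@Zp_intr_inj M N); [exact: prime_gt1|exact: ltnW| |].
  by have := ltn_ord x; clear; lia.
by have := ltn_ord y; clear; lia.
Qed.

End Domains.

Lemma planted_function (R : realType) (G : zmodType) (k N m : nat) (e : int -> G) (p de : R) :
  (1 < k)%N -> {morph e : x y / x + y} ->
  (forall x y : int, 1 <= x <= N%:Z -> 1 <= y <= N%:Z -> e x = e y -> x = y) ->
  (m <= N)%N -> 0 < p < 1 ->
  de * p ^+ k * #|{: aps k (interval_image N e)}|%:R <= (1 - p ^+ k) * (m * (m %/ k.-1))%:R ->
  exists f : G -> R, [/\ forall a, 0 <= f a <= 1,
    (1 + de) * p ^+ k * (Tset k [set` interval_image N e]%classic)%:R
      <= Tfun k [set` interval_image N e]%classic f &
    \sum_(a \in [set` interval_image N e]%classic) relent p (f a) <= m%:R * ln (1 / p)].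
Proof.
move=> k2 eD e_inj mN p01; have /andP[p0 p1] := p01.
have [S Sm hS] := interval_progressions k2 eD e_inj mN.
set Om := interval_image N e in S Sm hS *.
move=> hde.
pose f (a : G) : R := if [exists x in S, val x == a] then 1 else p.
have fE (x : Om) : f (val x) = if x \in S then 1 else p.
  rewrite /f; congr (if _ then _ else _); apply/existsP/idP => [[y /andP[yS /eqP/val_inj <-]]//|xS].
  by exists x; rewrite xS eqxx.
have f01 a : 0 <= f a <= 1 by rewrite /f; case: ifP; rewrite ?ler01 ?lexx ?(ltW p0) ?(ltW p1).
have pk1 : p ^+ k <= 1 by rewrite exprn_ile1// ltW.
exists f; split => //.
  rewrite Tset_aps// Tfun_aps//.
  (* The product is 1 on progressions inside [S] and at least p^k on all others. *)
  have key (P : aps k Om) : p ^+ k + (1 - p ^+ k) * (P \in inside (point k2) S)%:R <=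
      \prod_(i < k) f (val (point k2 i P)).
    case: (boolP (P \in _)) => [|_] /=.
      rewrite inE => /forallP h.
      by rewrite mulr1 addrC subrK big1// => i _; rewrite (fE (point k2 i P)) h.
    rewrite mulr0 addr0 -[X in _ ^+ X](card_ord k) -prodr_const.
    apply: ler_prod => i _; rewrite (ltW p0)/= (fE (point k2 i P)); case: ifP => _; [exact: ltW|exact: lexx].
  apply: (@le_trans _ _ (\sum_(P : aps k Om) (p ^+ k + (1 - p ^+ k) * (P \in inside (point k2) S)%:R))); last first.
    by apply: ler_sum => P _; exact: key.
  rewrite big_split /= sumr_const -mulr_sumr -[X in _ <= X + _]mulr_natr.
  have -> : \sum_P (P \in inside (point k2) S)%:R = #|inside (point k2) S|%:R :> R.
    by rewrite -sum1_card natr_sum [RHS]big_mkcond; apply: eq_bigr => P _; case: (P \in _).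
  have hS' : (m * (m %/ k.-1))%:R <= #|inside (point k2) S|%:R :> R by rewrite ler_nat.
  have h0 : 0 <= 1 - p ^+ k by rewrite subr_ge0.
  have := ler_wpM2l h0 hS'; move: hde.
  lra.
rewrite fsum_fset (bigID (mem S)) /= [X in _ + X]big1 ?addr0; last first.
  by move=> x /negbTE xS; rewrite fE xS relent_same.
rewrite (eq_bigr (fun=> ln (1 / p))); last by move=> x xS; rewrite fE xS relent_1.
rewrite sumr_const -[X in X <= _]mulr_natl ler_wpM2r ?ler_nat//.
by rewrite ln_ge0// ler_pdivlMr// mul1r ltW.
Qed.

Lemma domain_extremal (R : realType) (k : nat) (eps : R) (k2 : (1 < k)%N) :
  (3 <= k)%N -> 0 < eps ->
  exists2 gaE : R, 0 < gaE & forall D N, admissible D N -> (k <= N)%N ->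
  forall A : {set interval_image N (@domain_map D N)}, #|A|%:R <= gaE * N%:R ->
    #|inside (point k2) A|%:R <= (k.-1%:R^-1 + eps) * #|A|%:R ^+ 2 + 2 * #|A|%:R.
Proof.
move=> k3 eps0; have [C hC] := cyclic_extremal k3 eps0.
exists C.+1%:R^-1; first by rewrite invr_gt0.
move=> D N aN kN A; rewrite [_^-1 * _]mulrC ler_pdivlMr ?ltr0n//.
move=> hA0; have hA : (#|A| * C.+1 <= N)%N by rewrite -(ler_nat R) natrM.
have [M [psi [pM NM psiD psi_inj]]] := domain_embedding aN.
have := card_inside_image k2 (domain_torsionfree aN kN) A psiD psi_inj.
rewrite -(ler_nat R) => /le_trans; apply.
have cA : #|[set psi (val x) | x in A]| = #|A|.
  by apply: card_imset => x y h; apply: val_inj; apply: psi_inj h; exact: valP.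
rewrite -cA; apply: hC => //; rewrite cA; apply: (leq_trans _ NM).
by apply: leq_trans hA; rewrite mulnC leq_mul2l leqnSn orbT.
Qed.

Definition rate (R : realType) (k : nat) (D : domain) (N : nat) (p de : R) : R :=
  Num.sqrt (k.-1%:R * (de * p ^+ k * (Tset k (@Omega D N))%:R)) * ln (1 / p).

Lemma Tset_ge (k : nat) (D : domain) (N : nat) : (2 <= k)%N -> admissible D N -> (k <= N)%N ->
  (N * (N %/ k.-1) <= Tset k (@Omega D N))%N.
Proof.
move=> k2 aN kN; rewrite -(domain_image aN) Tset_aps//.
have dinj := domain_map_inj aN.
have [S _] := interval_progressions k2 (@domain_mapD D N) dinj (leqnn N).
by move=> /leq_trans; apply; exact: max_card.
Qed.

Lemma Tset_bounds (R : realType) (k : nat) (D : domain) (N : nat) :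
  (2 <= k)%N -> admissible D N -> (2 * k <= N)%N ->
  1 / (2 * k.-1%:R) * N%:R ^+ 2 <= (Tset k (@Omega D N))%:R :> R /\
  (Tset k (@Omega D N))%:R <= N%:R ^+ 2 :> R.
Proof.
move=> k2 aN kN.
have kN' : (k <= N)%N by lia.
have dinj := domain_map_inj aN.
have tf : forall (b : ambient D N) d, (0 < d < k)%N -> b *+ d = 0 -> b = 0.
  by apply: domain_torsionfree => //; lia.
rewrite -(domain_image aN) Tset_aps//; split; last first.
  rewrite -natrX ler_nat; have := card_aps_le (interval_image N (@domain_map D N)) k2 tf.
  by rewrite (card_interval_image dinj).
have h := Tset_ge k2 aN kN'; rewrite -(domain_image aN) Tset_aps// in h.
have q2 : 0 < 2 * k.-1%:R :> R by rewrite mulr_gt0 ?ltr0n//; lia.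
rewrite mul1r mulrC ler_pdivrMr//.
rewrite -natrM -natrX -natrM ler_nat -mulnn.
have q0 : (0 < k.-1)%N by lia.
have h1 : (N <= N %/ k.-1 * (2 * k.-1))%N.
  by have := divn_eq N k.-1; have := ltn_pmod N q0; lia.
apply: (leq_trans (n := (N * (N %/ k.-1) * (2 * k.-1))%N)).
  by rewrite -mulnA leq_mul2l h1 orbT.
by rewrite leq_mul2r h orbT.
Qed.

(** [m] is (1 + 2 eps) M rounded down. One eps pays for rounding [m] and [m %/ q], as q + 1 <= eps
    M; the other beats 1 - t, as (1 - eps/2)(1 + eps)^2 >= 1. *)
Lemma planted_size (R : realType) (q : nat) (eps M : R) (N : nat) (t : R) :
  (0 < q)%N -> 0 < eps -> eps <= 1 / 2 -> q.+1%:R / eps <= M -> 2 * M <= N%:R ->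
  0 <= t -> t <= eps / 2 ->
  exists2 m : nat, (m <= N)%N /\ m%:R <= (1 + 2 * eps) * M &
    M ^+ 2 <= (1 - t) * (q%:R * (m * (m %/ q))%:R).
Proof.
move=> q0 eps0 eps1 hM MN t0 t1.
have qq : 0 < q.+1%:R :> R by rewrite ltr0n.
have M0 : 0 < M by apply: lt_le_trans hM; rewrite divr_gt0.
have x0 : 0 <= (1 + 2 * eps) * M by rewrite mulr_ge0//; lra.
have /andP[m1 m2] := truncn_itv x0.
set m := Num.truncn _ in m1 m2 *.
have xN : (1 + 2 * eps) * M <= N%:R.
  by apply: le_trans MN; rewrite ler_wpM2r ?(ltW M0)//; lra.
exists m; first by split => //; rewrite -(ler_nat R) (le_trans m1).
have e1 : q.+1%:R <= eps * M by move: hM; rewrite ler_pdivrMr// mulrC.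
have h1 : (1 + eps) * M <= m%:R - q%:R by move: e1 m2; rewrite -[m.+1]addn1 -[q.+1]addn1 !natrD; lra.
have h2 : m%:R - q%:R <= q%:R * (m %/ q)%:R :> R.
  rewrite lerBlDr -natrM -natrD ler_nat.
  by move: (divn_eq m q) (ltn_pmod m q0); clear; move: (m %/ q)%N (m %% q)%N; lia.
have h3 : (1 + eps) * M <= m%:R by apply: (le_trans h1); rewrite lerBlDr lerDl ler0n.
have h0 : 0 <= (1 + eps) * M by rewrite mulr_ge0 ?(ltW M0)//; lra.
have h4 : ((1 + eps) * M) ^+ 2 <= q%:R * (m * (m %/ q))%:R.
  rewrite natrM mulrCA expr2; apply: ler_pM => //.
  exact: le_trans h2.
have h5 : M ^+ 2 <= (1 - eps / 2) * ((1 + eps) * M) ^+ 2.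
  rewrite exprMn mulrA ler_peMl ?sqr_ge0//.
  have : 0 <= eps * (1 / 2 - eps) by rewrite mulr_ge0//; lra.
  have : 0 <= eps * eps * (1 - eps) by rewrite !mulr_ge0//; lra.
  by rewrite expr2; nra.
apply: (le_trans h5); apply: ler_pM => //; rewrite ?sqr_ge0//; lra.
Qed.

Theorem rate_sandwich (R : realType) (k : nat) (eps De : R) :
  (3 <= k)%N -> 0 < eps -> eps <= 1 / 2 -> 1 <= De ->
  exists2 eta : R, 0 < eta & forall D N p de, admissible D N -> (2 * k <= N)%N ->
  0 < p -> p <= eta -> 0 < de -> de <= De ->
  eta^-1 <= de * p ^+ k * N%:R ^+ 2 ->
  p ^+ (k - 2) * ln (1 / p) ^+ 2 <= eta * de ^+ 3 ->
  (((1 - 2 * eps) * rate k D N p de)%:E <= phi k (@Omega D N) p de)%E /\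
  (phi k (@Omega D N) p de <= ((1 + 2 * eps) * rate k D N p de)%:E)%E.
Proof.
move=> k3 eps0 eps1 De1.
have k2 : (1 < k)%N by exact: ltnW.
have qn0 : (0 < k.-1)%N by rewrite -ltnS prednK// ltnW.
set q : R := k.-1%:R; have q0 : 0 < q by rewrite ltr0n.
have De0 : 0 < De by lra.
have ep0 : 0 < eps / (4 * q) by rewrite divr_gt0// mulr_gt0.
have [gaE gaE0 hext] := domain_extremal k2 k3 ep0.
have c00 : 0 < 1 / (2 * q) by rewrite divr_gt0// mulr_gt0.
have [eta1 eta1_0 hlow] := abstract_lower_bound k3 eps0 eps1 De1 c00 gaE0.
(* [T] is the least M that [planted_size] accepts, guaranteed by [b2]; [b1] ensures that the planted
   interval fits, 2 M <= N. *)
pose T := k.-1.+1%:R / eps; have T0 : 0 < T by rewrite divr_gt0// ltr0n.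
pose b1 := (4 * q * De)^-1; have b10 : 0 < b1 by rewrite invr_gt0 !mulr_gt0.
pose b2 := (2 * T ^+ 2)^-1; have b20 : 0 < b2 by rewrite invr_gt0 mulr_gt0// exprn_gt0.
have [|eta eta0 he] := @pos_lower R [:: eta1; b1; b2; eps / 2].
  by rewrite /= eta1_0 b10 b20 divr_gt0.
have he1 : eta <= eta1 by apply: he; rewrite !inE eqxx.
have he2 : eta <= b1 by apply: he; rewrite !inE eqxx orbT.
have he3 : eta <= b2 by apply: he; rewrite !inE eqxx !orbT.
have he4 : eta <= eps / 2 by apply: he; rewrite !inE eqxx !orbT.
exists eta => // D N p de aN kN p0 peta de0 deDe hbig hsmall.
have kN' : (k <= N)%N by apply: (leq_trans _ kN); rewrite leq_pmull.
have p1 : p < 1 by lra.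
have p01 : 0 < p < 1 by rewrite p0.
have pk0 : 0 < p ^+ k by rewrite exprn_gt0.
have dp0 : 0 < de * p ^+ k by rewrite mulr_gt0.
have pkp : p ^+ k <= p.
  by rewrite -[leRHS]expr1; apply: ler_wiXn2l; rewrite ?(ltW p0) ?(ltW p1)// ltnW.
have tf : forall (b : ambient D N) d, (0 < d < k)%N -> b *+ d = 0 -> b = 0.
  exact: domain_torsionfree.
have dinj := domain_map_inj aN.
have eI := card_interval_image dinj.
have [Tlow Tup] := Tset_bounds R k2 aN kN.
have L0 : 0 <= ln (1 / p) by rewrite ln_ge0// ler_pdivlMr// mul1r ltW.
split.
  apply: le_ereal_inf_tmp => _ [f [f01 hf] <-]; rewrite lee_fin /rate.
  rewrite -(domain_image aN) in f01 hf *.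
  rewrite fsum_fset//; move: hf; rewrite Tset_aps// Tfun_aps// => hf.
  apply: (hlow _ _ (point k2) p de) => //.
  - exact: point_inj.
  - exact: le_trans he1.
  - rewrite eI; apply: le_trans hbig; rewrite lef_pV2 ?posrE//.
  - by apply: le_trans hsmall _; rewrite ler_wpM2r// exprn_ge0// ltW.
  - by rewrite eI -Tset_aps// (domain_image aN).
  - by rewrite eI; exact: hext.
  by move=> x; apply: f01; exact: valP.
pose M := Num.sqrt (q * (de * p ^+ k * (Tset k (@Omega D N))%:R)).
have arg0 : 0 <= q * (de * p ^+ k * (Tset k (@Omega D N))%:R).
  by rewrite mulr_ge0 ?(ltW q0)// mulr_ge0 ?(ltW dp0).
have M0 : 0 <= M by exact: sqrtr_ge0.
have ME : M ^+ 2 = q * (de * p ^+ k * (Tset k (@Omega D N))%:R) by exact: sqr_sqrtr.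
have TM : T <= M.
  rewrite -(@ler_pXn2r _ 2)// ?nnegrE ?(ltW T0)// ME.
  have h1 : 2 * T ^+ 2 <= eta^-1.
    by rewrite -[leLHS]invrK lef_pV2 ?posrE.
  have h2 := ler_wpM2l (ltW dp0) Tlow.
  have h3 : de * p ^+ k * N%:R ^+ 2 = q * (2 * (de * p ^+ k * (1 / (2 * q) * N%:R ^+ 2))).
    by field; rewrite gt_eqF.
  have h4 := ler_wpM2l (ltW q0) h2.
  move: h1 hbig h3 h4; clear; rewrite -/q => h1 hbig h3 h4; lra.
have MN : 2 * M <= N%:R.
  rewrite -(@ler_pXn2r _ 2)// ?nnegrE ?mulr_ge0// exprMn ME.
  have h1 : 4 * q * De * p <= 1.
    have : p <= b1 by exact: le_trans he2.
    by rewrite /b1 -[_^-1]mul1r ler_pdivlMr ?mulr_gt0// mulrC.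
  have h2 : de * p ^+ k <= De * p by apply: ler_pM => //; exact: ltW.
  have h3 : de * p ^+ k * (Tset k (@Omega D N))%:R <= De * p * N%:R ^+ 2.
    by apply: ler_pM => //; exact: ltW.
  have h4 : 0 <= 4 * q by rewrite mulr_ge0 ?(ltW q0).
  have h5 := ler_wpM2l h4 h3; have h6 := ler_wpM2r (sqr_ge0 (N%:R : R)) h1.
  move: h5 h6; rewrite (_ : 2 ^+ 2 = 4 :> R); last by ring.
  clear => h5 h6; lra.
have pke : p ^+ k <= eps / 2 by apply: (le_trans pkp); apply: (le_trans peta).
have [m [mN mM] hm] := planted_size qn0 eps0 eps1 TM MN (ltW pk0) pke.
have hde : de * p ^+ k * #|{: aps k (interval_image N (@domain_map D N))}|%:R <=
    (1 - p ^+ k) * (m * (m %/ k.-1))%:R.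
  rewrite -Tset_aps// (domain_image aN) -(ler_pM2l q0) -ME; apply: (le_trans hm).
  by rewrite mulrCA.
have [f [f01 hf hcost]] := planted_function k2 (@domain_mapD D N) dinj mN p01 hde.
rewrite (domain_image aN) in hf hcost.
apply: ge_ereal_inf; exists (\sum_(a \in (@Omega D N)) relent p (f a))%:E; last first.
  rewrite lee_fin; apply: (le_trans hcost); rewrite /rate [leRHS]mulrA; exact: ler_wpM2r.
by exists f.
Qed.

(** * Asymptotics *)

Local Open Scope classical_set_scope.
Local Open Scope ring_scope.

Lemma sandwich_asymptotic (R : realType) (F : set_system nat) {FF : Filter F}
    (u : nat -> \bar R) (v : nat -> R) :
  (\forall N \near F, 0 < v N) ->
  (forall eps : R, 0 < eps -> \forall N \near F,
     (((1 - eps) * v N)%:E <= u N)%E /\ (u N <= ((1 + eps) * v N)%:E)%E) ->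
  asymptotic F u v.
Proof.
move=> v0 huv; exists (fun N => fine (u N) / v N - 1).
  apply/cvgr0Pnorm_le => eps eps0; near=> N.
  have vN0 : 0 < v N by near: N.
  have [h1 h2] : (((1 - eps) * v N)%:E <= u N)%E /\ (u N <= ((1 + eps) * v N)%:E)%E.
    by near: N; exact: huv.
  have fu : u N \is a fin_num.
    by rewrite fin_numE; apply/andP; split; apply/eqP => uE; move: h1 h2; rewrite uE.
  move: h1 h2; rewrite -(fineK fu) !lee_fin /= => h1 h2.
  by rewrite ler_norml lerBrDr lerBlDr ler_pdivlMr// ler_pdivrMr// [- eps + 1]addrC [eps + 1]addrC h1.
near=> N.
have vN0 : 0 < v N by near: N.
(* Error 1 already shows that [u N] is finite, so [fine] loses nothing. *)
have [h1 h2] : (((1 - 1) * v N)%:E <= u N)%E /\ (u N <= ((1 + 1) * v N)%:E)%E.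
  by near: N; apply: huv.
have fu : u N \is a fin_num.
  by rewrite fin_numE; apply/andP; split; apply/eqP => uE; move: h1 h2; rewrite uE.
by rewrite addrC subrK divfK ?fineK// gt_eqF.
Unshelve. all: by end_near. Qed.

Lemma near_admissible D : \forall N \near size_to_infty D, admissible D N.
Proof. by rewrite near_withinE; exact: nearW. Qed.

Lemma near_size_ge D n : \forall N \near size_to_infty D, (n <= N)%N.
Proof. by apply: cvg_within; exact: nbhs_infty_ge. Qed.

Lemma inside_setT (k : nat) (I J : finType) (pi_ : 'I_k -> J -> I) : inside pi_ [set: I]%SET = [set: J]%SET.
Proof. by apply/setP => P; rewrite !inE; apply/forallP => i; rewrite inE. Qed.

(** The extremal bound is applied to the whole interval, so the prime must exceed a large multiple
    of N. *)
Lemma Tset_interval_le (R : realType) (k : nat) (eps : R) (N : nat) :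
  (3 <= k)%N -> 0 < eps -> (k <= N)%N ->
  (Tset k (@Omega Defs.Interval N))%:R <= (k.-1%:R^-1 + eps) * N%:R ^+ 2 + 2 * N%:R :> R.
Proof.
move=> k3 eps0 kN; have k2 : (1 < k)%N by exact: ltnW.
have aN : admissible Defs.Interval N by rewrite /=; apply: leq_trans kN; exact: ltnW (ltnW k3).
have [C hC] := cyclic_extremal k3 eps0.
have [M NM pM] := prime_above (C.+1 * N).
have NM' : (N <= M)%N by apply: leq_trans (ltnW NM); rewrite leq_pmull.
have dinj := domain_map_inj aN.
pose Om := interval_image N (@domain_map Defs.Interval N).
pose psi (x : int) : 'Z_M := x%:~R.
have psiD : {morph psi : x y / x + y} by move=> x y; rewrite /psi rmorphD.
have psi_inj : {in Om &, injective psi}.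
  move=> _ _ /imfsetP[x _ ->] /imfsetP[y _ ->].
  apply: (@Zp_intr_inj M N) => //; first exact: prime_gt1.
    by move: (ltn_ord x) => /=; clear; lia.
  by move: (ltn_ord y) => /=; clear; lia.
have tf := domain_torsionfree aN kN.
have := card_inside_image k2 tf [set: Om]%SET psiD psi_inj.
rewrite inside_setT cardsT -Tset_aps// (domain_image aN) -(ler_nat R) => /le_trans; apply.
have cA : #|[set psi (val x) | x in [set: Om]%SET]%SET| = N.
  rewrite card_imset ?cardsT ?(card_interval_image dinj)// => x y h.
  by apply: val_inj; apply: psi_inj h; exact: valP.
rewrite -[N in leRHS]cA; apply: hC => //; rewrite cA; apply: leq_trans (ltnW NM).
by rewrite leq_mul2r leqnSn orbT.
Qed.

Lemma Tset_cyclic_ge (k N : nat) : (2 <= k)%N -> prime N ->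
  (N ^ 2 <= Tset k (@Omega Cyclic N))%N.
Proof.
move=> k2 pN; have N1 := prime_gt1 pN.
have aN : admissible Cyclic N by [].
rewrite -(domain_image aN) Tset_aps//.
have memO (x : 'Z_N) : x \in interval_image N (@domain_map Cyclic N).
  by have : [set` interval_image N (@domain_map Cyclic N)] x by rewrite (domain_image aN).
have memP (u : 'Z_N * 'Z_N) : u \in aps k (interval_image N (@domain_map Cyclic N)).
  by apply/(apsP _ k2) => i _; exact: memO.
have cN : #|{: 'Z_N}| = N by rewrite card_ord Zp_cast.
have -> : (N ^ 2)%N = #|{: 'Z_N * 'Z_N}| by rewrite card_prod cN mulnn.
apply: (leq_card (fun u => [` memP u]%fset)).
by move=> u v /(congr1 val).
Qed.

(** The limit of (k - 1) T_k / N^2, in which the two explicit rates differ. *)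
Definition density (R : realType) (k : nat) (D : domain) : R :=
  match D with Defs.Interval => 1 | Cyclic => k.-1%:R end.

Lemma Tset_density (R : realType) (k : nat) (D : domain) (eps : R) : (3 <= k)%N -> 0 < eps ->
  exists n, forall N, admissible D N -> (n <= N)%N ->
    (1 - eps) * (density R k D * N%:R ^+ 2) <= k.-1%:R * (Tset k (@Omega D N))%:R /\
    k.-1%:R * (Tset k (@Omega D N))%:R <= (1 + eps) * (density R k D * N%:R ^+ 2).
Proof.
move=> k3 eps0; have k2 : (1 < k)%N by exact: ltnW.
have qn0 : (0 < k.-1)%N by rewrite -ltnS prednK// ltnW.
pose q : R := k.-1%:R; have q0 : 0 < q by rewrite ltr0n.
have [n n0 hn] := nat_above (4 * q / eps).
exists (maxn (2 * k) n) => N aN; rewrite geq_max => /andP[kN nN].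
have kN' : (k <= N)%N by apply: (leq_trans _ kN); rewrite leq_pmull.
have qN : 4 * q <= eps * N%:R.
  have : 4 * q / eps <= N%:R by apply: (le_trans hn); rewrite ler_nat.
  by rewrite ler_pdivrMr// [eps * _]mulrC.
have N0 : 0 <= N%:R :> R by exact: ler0n.
have qN2 := ler_wpM2r N0 qN.
have NN0 : 0 <= N%:R ^+ 2 :> R by exact: sqr_ge0.
have N20 : 0 <= eps * N%:R ^+ 2 by rewrite mulr_ge0// ltW.
case: D aN => aN /=.
  split; rewrite mul1r -/q.
    have h1 : (N * (N - k.-1) <= k.-1 * Tset k (@Omega Defs.Interval N))%N.
      apply: leq_trans (_ : k.-1 * (N * (N %/ k.-1)) <= _)%N; last first.
        by rewrite leq_mul2l Tset_ge// orbT.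
      rewrite mulnCA leq_mul2l; apply/orP; right.
      by move: (divn_eq N k.-1) (ltn_pmod N qn0); clear; move: (N %/ k.-1)%N (N %% k.-1)%N => x r; move: k.-1 => m; lia.
    move: h1; rewrite -(ler_nat R) !natrM natrB; last exact: leq_trans (leq_pred k) kN'.
    rewrite -/q => h1; apply: (le_trans _ h1).
    move: qN2; rewrite expr2 -/q; move: (mulr_ge0 (ltW q0) N0); clear; lra.
  have e0 : 0 < eps / (2 * q) by rewrite divr_gt0// mulr_gt0.
  have h := Tset_interval_le k3 e0 kN'.
  have := ler_wpM2l (ltW q0) h; move/le_trans; apply.
  rewrite -/q (_ : q * _ = N%:R ^+ 2 + eps / 2 * N%:R ^+ 2 + 2 * q * N%:R); last first.
    by field; rewrite gt_eqF.
  move: qN2; rewrite expr2; clear; lra.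
split; rewrite -/q.
  rewrite mulrCA ler_pM2l//.
  have : N%:R ^+ 2 <= (Tset k (@Omega Cyclic N))%:R :> R by rewrite -natrX ler_nat Tset_cyclic_ge.
  by move: N20; clear; lra.
rewrite mulrCA ler_pM2l//.
have [_ h] := Tset_bounds R k2 aN kN.
by move: h N20; clear; lra.
Qed.

Lemma explicit_rateE (R : realType) (D : domain) (k N : nat) (p de : R) :
  (0 < k)%N -> 0 <= p -> 0 <= de ->
  explicit_rate D k N p de = Num.sqrt (de * p ^+ k * (density R k D * N%:R ^+ 2)) * ln (1 / p).
Proof.
move=> k0 p0 de0.
have pE : p `^ (k%:R / 2) = Num.sqrt (p ^+ k) by rewrite powRrM powR_mulrn// powR12_sqrt// exprn_ge0.
have NE : N%:R = Num.sqrt (N%:R ^+ 2) :> R by rewrite sqrtr_sqr ger0_norm.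
have kE : k%:R - 1 = k.-1%:R :> R by rewrite -[in LHS](prednK k0) -natr1 addrK.
rewrite /explicit_rate pE {1 2}NE kE; case: D => /=; rewrite -!sqrtrM ?mulr_ge0 ?exprn_ge0//.
  by rewrite (mul1r (N%:R ^+ 2)).
by congr (Num.sqrt _ * _); ring.
Qed.

Lemma rateE (R : realType) (D : domain) (k N : nat) (p de : R) : (0 < k)%N ->
  Num.sqrt ((k%:R - 1) * de * p ^+ k * (Tset k (@Omega D N))%:R) * ln (1 / p) = rate k D N p de.
Proof.
move=> k0; have kE : k%:R - 1 = k.-1%:R :> R by rewrite -[in LHS](prednK k0) -natr1 addrK.
by rewrite /rate kE !mulrA.
Qed.

Theorem theorem2p2 (R : realType) (k : nat) (D : domain) (p delta : nat -> R) :
  (3 <= k)%N ->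
  (forall N, admissible D N -> 0 < p N < 1) ->
  (forall N, admissible D N -> 0 < delta N) ->
  p N @[N --> size_to_infty D] --> 0 ->
  delta =O_ (size_to_infty D) (fun=> 1 : R) ->
  delta N * p N ^+ k * N%:R ^+ 2 @[N --> size_to_infty D] --> +oo ->
  delta N ^- 3 * p N ^+ (k - 2) * ln (1 / p N) ^+ 2
    @[N --> size_to_infty D] --> 0 ->
  asymptotic (size_to_infty D)
    (fun N => phi k (@Omega D N) (p N) (delta N))
    (fun N => Num.sqrt ((k%:R - 1) * delta N * p N ^+ k *
                        (Tset k (@Omega D N))%:R) * ln (1 / p N))
  /\
  asymptotic (size_to_infty D)
    (fun N => phi k (@Omega D N) (p N) (delta N))
    (fun N => explicit_rate D k N (p N) (delta N)).
Proof.
move=> k3 p01 de0 p_to0 /eqO_exP[De De0 hDe] to_oo to_0.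
have k2 : (1 < k)%N by exact: ltnW.
have k1 : (0 < k)%N by exact: ltnW.
have q0 : 0 < k.-1%:R :> R by rewrite ltr0n -ltnS prednK.
set v := fun N => rate k D N (p N) (delta N).
have ev : (fun N => Num.sqrt ((k%:R - 1) * delta N * p N ^+ k *
    (Tset k (@Omega D N))%:R) * ln (1 / p N)) = v.
  by apply/funext => N; rewrite rateE.
rewrite ev; clear ev.
have posL N : admissible D N -> 0 < ln (1 / p N).
  by move=> aN; have /andP[h0 h1] := p01 _ aN; rewrite ln_gt0// ltr_pdivlMr// mul1r.
have pd N : admissible D N -> 0 < delta N * p N ^+ k.
  by move=> aN; have /andP[h0 h1] := p01 _ aN; rewrite mulr_gt0 ?de0// exprn_gt0.
have v_gt0 : \forall N \near size_to_infty D, 0 < v N.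
  near=> N.
  have aN : admissible D N by near: N; exact: near_admissible.
  have kN : (2 * k <= N)%N by near: N; exact: near_size_ge.
  have [Tlow _] := Tset_bounds R k2 aN kN.
  have N0 : 0 < N%:R :> R by rewrite ltr0n (leq_trans _ kN)// muln_gt0.
  rewrite mulr_gt0 ?posL// sqrtr_gt0 mulr_gt0// mulr_gt0 ?pd//.
  by apply: lt_le_trans Tlow; rewrite mulr_gt0 ?exprn_gt0// divr_gt0// mulr_gt0.
have main (eps : R) : 0 < eps -> \forall N \near size_to_infty D,
    (((1 - eps) * v N)%:E <= phi k (@Omega D N) (p N) (delta N))%E /\
    (phi k (@Omega D N) (p N) (delta N) <= ((1 + eps) * v N)%:E)%E.
  move=> eps0; pose e := Num.min (eps / 2) (1 / 2).
  have e0 : 0 < e by rewrite lt_min !divr_gt0.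
  have e1 : e <= 1 / 2 by rewrite ge_min lexx orbT.
  have e2 : 2 * e <= eps by rewrite mulrC -ler_pdivlMr// ge_min lexx.
  have De1 : 1 <= Num.max 1 De by rewrite le_max lexx.
  have [eta eta0 h] := rate_sandwich k3 e0 e1 De1.
  near=> N.
  have aN : admissible D N by near: N; exact: near_admissible.
  have kN : (2 * k <= N)%N by near: N; exact: near_size_ge.
  have vN : 0 < v N by near: N.
  have /andP[pN0 pN1] := p01 _ aN; have dN0 := de0 _ aN.
  have pe : p N <= eta.
    rewrite -[p N]gtr0_norm//; near: N; exact: cvgr0_norm_le.
  have dD : delta N <= Num.max 1 De.
    rewrite le_max; apply/orP; right; rewrite -[delta N]gtr0_norm// -[De]mulr1 -[1 in leRHS]normr1.
    by near: N; exact: hDe.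
  have hb : eta^-1 <= delta N * p N ^+ k * N%:R ^+ 2.
    by near: N; move/cvgryPge : to_oo; exact.
  have hs : p N ^+ (k - 2) * ln (1 / p N) ^+ 2 <= eta * delta N ^+ 3.
    have : `|delta N ^- 3 * p N ^+ (k - 2) * ln (1 / p N) ^+ 2| <= eta.
      by near: N; exact: cvgr0_norm_le.
    rewrite -mulrA normrM gtr0_norm ?invr_gt0 ?exprn_gt0// => hh.
    rewrite [leRHS]mulrC -ler_pdivrMl ?exprn_gt0//; apply: le_trans hh.
    by rewrite ler_pM2l ?invr_gt0 ?exprn_gt0// ler_norm.
  have [h1 h2] := h D N (p N) (delta N) aN kN pN0 pe dN0 dD hb hs.
  split; [apply: le_trans h1|apply: (le_trans h2)]; rewrite lee_fin ler_wpM2r ?(ltW vN)//; lra.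
split; first exact: sandwich_asymptotic.
have ew N : admissible D N -> explicit_rate D k N (p N) (delta N) =
    Num.sqrt (delta N * p N ^+ k * (density R k D * N%:R ^+ 2)) * ln (1 / p N).
  by move=> aN; have /andP[h0 _] := p01 _ aN; rewrite explicit_rateE ?ltW// de0.
have c0 : 0 < density R k D by rewrite /density; case: (D).
apply: sandwich_asymptotic.
  near=> N.
  have aN : admissible D N by near: N; exact: near_admissible.
  have N0 : 0 < N%:R :> R by rewrite ltr0n; near: N; exact: near_size_ge.
  by rewrite ew// mulr_gt0 ?posL// sqrtr_gt0 mulr_gt0 ?pd// mulr_gt0// exprn_gt0.
(* Two approximations with error e are composed, and (1 + e)^2 <= 1 + 3 e. *)
move=> eps eps0; pose e := Num.min (eps / 3) (1 / 2).
have e0 : 0 < e by rewrite lt_min !divr_gt0.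
have e1 : e <= 1 / 2 by rewrite ge_min lexx orbT.
have e2 : 3 * e <= eps by rewrite mulrC -ler_pdivlMr// ge_min lexx.
have [n hn] := Tset_density D k3 e0.
near=> N.
have aN : admissible D N by near: N; exact: near_admissible.
have nN : (n <= N)%N by near: N; exact: near_size_ge.
have [h1 h2] : (((1 - e) * v N)%:E <= phi k (@Omega D N) (p N) (delta N))%E /\
    (phi k (@Omega D N) (p N) (delta N) <= ((1 + e) * v N)%:E)%E.
  by near: N; exact: main.
have [t1 t2] := hn N aN nN.
rewrite ew//; set w := Num.sqrt _ * _.
set X := density R k D * N%:R ^+ 2 in t1 t2 w *.
set T := k.-1%:R * _ in t1 t2.
have X0 : 0 <= X by rewrite mulr_ge0 ?(ltW c0)// sqr_ge0.
have L0 := posL _ aN; have d0 := pd _ aN.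
have vE : v N = Num.sqrt (delta N * p N ^+ k * T) * ln (1 / p N).
  by rewrite /v /rate /T mulrCA.
have w0 : 0 <= w by rewrite mulr_ge0 ?sqrtr_ge0 ?(ltW L0).
have vw1 : (1 - e) * w <= v N.
  rewrite vE /w [leLHS]mulrA ler_wpM2r ?(ltW L0)//.
  have -> : 1 - e = Num.sqrt ((1 - e) ^+ 2) by rewrite sqrtr_sqr ger0_norm//; lra.
  rewrite -sqrtrM ?sqr_ge0// ler_wsqrtr// [leLHS]mulrCA ler_wpM2l ?(ltW d0)//.
  apply: le_trans t1; rewrite ler_wpM2r// expr2 ler_piMl//; lra.
have vw2 : v N <= (1 + e) * w.
  rewrite vE /w [leRHS]mulrA ler_wpM2r ?(ltW L0)//.
  have -> : 1 + e = Num.sqrt ((1 + e) ^+ 2) by rewrite sqrtr_sqr ger0_norm//; lra.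
  rewrite -sqrtrM ?sqr_ge0// ler_wsqrtr// [leRHS]mulrCA ler_wpM2l ?(ltW d0)//.
  apply: (le_trans t2); rewrite ler_wpM2r// expr2 ler_peMl//; lra.
have ew0 : 0 <= e * w by rewrite mulr_ge0// ltW.
have eew0 : 0 <= e * (e * w) by rewrite mulr_ge0// ltW.
have eew1 : e * (e * w) <= e * w by rewrite ler_piMl//; lra.
have e3w := ler_wpM2r w0 e2.
split; [apply: le_trans h1|apply: (le_trans h2)]; rewrite lee_fin.
  have f1 : 0 <= 1 - e by lra.
  have := ler_wpM2l f1 vw1; lra.
have f2 : 0 <= 1 + e by lra.
have := ler_wpM2l f2 vw2; lra.
Unshelve. all: by end_near. Qed.
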